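(* Let $K$ be an algebraically closed field of arbitrary characteristic, let $n\geq 2$ be an integer, and let $N=(n+1)(n+2)$. Let ${\mathcal A}^{(n)}$ be the set of all $K$-automorphisms of degree $n$ of the polynomial algebra $K[x,y]$, and let $\pi$ be the bijection from the set of $K$-endomorphisms of $K[x,y]$ of degree $\leq n$ onto $K^N$ given by coefficients. Then $\pi({\mathcal A}^{(n)})$ is a constructible subset of $K^N$ (with the Zariski topology) of dimension $n+6$.
   Context: A $K$-endomorphism $\varphi$ of $K[x,y]$ is written $\varphi=(f,g)$, where $f=\varphi(x)$ and $g=\varphi(y)$. Its degree is $\deg(\varphi)=\max\{\deg(f),\deg(g)\}$, where $\deg$ denotes the total degree. Let $u_1,\ldots,u_{N/2}$, $N=(n+1)(n+2)$, be the monomials of degree $\leq n$ in $K[x,y]$ in a fixed order. For an endomorphism $\varphi=(f,g)$ of degree $\leq n$ with $f=\sum_{j=1}^{N/2}a_ju_j$, $g=\sum_{j=1}^{N/2}b_ju_j$, $a_j,b_j\in K$, put $\pi(\varphi)=(a_1,\ldots,a_{N/2},b_1,\ldots,b_{N/2})\in K^N$. A subset of $K^N$ is constructible if it is a finite union of sets ${\mathcal U}_i\cap{\mathcal V}_i$ with ${\mathcal U}_i$ open and ${\mathcal V}_i$ closed in the Zariski topology. The dimension of a subset of $K^N$ is the dimension of its Zariski closure. *)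

(* Defs.v *)
From HB Require Import structures.
From mathcomp Require Import all_boot all_order all_algebra.
From mathcomp Require Import boolp classical_sets topology_structure.
From mathcomp Require Import mpoly.

Set Implicit Arguments.
Unset Strict Implicit.
Unset Printing Implicit Defensive.

Import GRing.Theory.
Local Open Scope classical_set_scope.
Local Open Scope ring_scope.

Section Topology.
Variable T : topologicalType.
Implicit Types (S X Z : set T) (d : nat).

Definition constructible S : Prop :=
  exists (m : nat) (U V : 'I_m -> set T),
    (forall i, open (U i) /\ closed (V i)) /\
    S = \bigcup_(i in [set: 'I_m]) (U i `&` V i).

Definition irreducible_set Z : Prop :=
  Z !=set0 /\
  forall A B : set T, closed A -> closed B ->
    Z `<=` A `|` B -> Z `<=` A \/ Z `<=` B.

Definition irreducible_chain X d : Prop :=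
  exists Z : nat -> set T,
    (forall i, (i <= d)%N -> [/\ closed (Z i), irreducible_set (Z i) & Z i `<=` X]) /\
    (forall i, (i < d)%N -> Z i `<` Z i.+1).

(* For closed [X], the closed irreducible subsets of the subspace [X] are those
   of [T] contained in [X], so this is the Krull dimension of [X]. *)
Definition has_krull_dim X d : Prop :=
  irreducible_chain X d /\ forall m, irreducible_chain X m -> (m <= d)%N.

(* The dimension of an arbitrary subset is that of its closure. *)
Definition has_dim S d : Prop := has_krull_dim (closure S) d.

End Topology.

(* A copy of the row vectors, carrying the Zariski topology. *)
Definition affine_space (K : fieldType) (N : nat) : Type := 'rV[K]_N.
HB.instance Definition _ (K : fieldType) (N : nat) :=
  Choice.on (affine_space K N).

Section Zariski.
Variables (K : fieldType) (N : nat).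
Local Notation T := (affine_space K N).

Definition zero_locus (I : set {mpoly K[N]}) : set T :=
  [set x : T | forall p, I p -> p.@[x 0] = 0].

Definition zariski_open (U : set T) : Prop :=
  exists I : set {mpoly K[N]}, ~` U = zero_locus I.

Fact zariski_openT : zariski_open [set: T].
Proof.
exists [set 1]; rewrite setCT; apply/seteqP; split=> // x /(_ 1 erefl)/eqP.
by rewrite meval1 oner_eq0.
Qed.

Fact zariski_openI : setI_closed zariski_open.
Proof.
move=> A B [I AI] [J BJ].
exists [set r | exists p q, [/\ I p, J q & r = p * q]].
rewrite setCI AI BJ; apply/seteqP; split=> x /=.
  move=> [Ix|Jx] _ [p [q [Ip Jq ->]]].
    by rewrite mevalM (Ix p Ip) mul0r.
  by rewrite mevalM (Jx q Jq) mulr0.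
move=> IJx; apply: contrapT => /not_orP[/existsNP[p /not_implyP[Ip px]]].
move=> /existsNP[q /not_implyP[Jq qx]].
have /eqP := IJx (p * q) (ex_intro _ p (ex_intro _ q (And3 Ip Jq erefl))).
by rewrite mevalM mulf_eq0 => /orP[]/eqP.
Qed.

Fact zariski_open_bigU (I : Type) (f : I -> set T) :
  (forall i, zariski_open (f i)) -> zariski_open (\bigcup_i f i).
Proof.
move=> /choice[J fJ]; exists (\bigcup_i J i).
rewrite setC_bigcup; apply/seteqP; split=> x /=.
  by move=> fx p [i _ Jp]; move: (fx i Logic.I); rewrite fJ; apply.
by move=> Jx i _; rewrite fJ => p Jp; apply: Jx; exists i.
Qed.

HB.instance Definition _ :=
  isOpenTopological.Build T zariski_openT zariski_openI zariski_open_bigU.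

End Zariski.

Fact zariski_closedE (K : fieldType) (N : nat) (Z : set (affine_space K N)) :
  closed Z <-> exists I : set {mpoly K[N]}, Z = zero_locus I.
Proof.
rewrite -openC; split=> -[I ZI]; exists I; first by rewrite -ZI setCK.
by rewrite setCK.
Qed.

(* The number of coefficients of a pair of polynomials of degree at most [n] in
   two variables. *)
Definition num_coefs (n : nat) : nat := (n.+1 * n.+2)%N.

Definition enumerates_monomials (n : nat)
    (u : (num_coefs n)./2.-tuple 'X_{1..2}) : Prop :=
  uniq u /\ forall m, (m \in u) = (mdeg m <= n)%N.

Fact enumerates_monomials_exists n : exists u, @enumerates_monomials n u.
Proof.
pose f k i : 'X_{1..2} := (U_(ord0) *+ i + U_(lift ord0 ord0) *+ (k - i))%MM.
pose u := [seq f k i | k <- iota 0 n.+1, i <- iota 0 k.+1].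
have f0 k i : f k i ord0 = i.
  by rewrite mnmDE !mulmnE !mnm1E /= addn0 mul1n.
have f1 k i : f k i (lift ord0 ord0) = (k - i)%N.
  by rewrite mnmDE !mulmnE !mnm1E /= add0n mul1n.
have size_u : size u == (num_coefs n)./2.
  rewrite size_allpairs_dep sumnE big_map; apply/eqP.
  under eq_bigr do rewrite size_iota.
  elim: n {u} => [|n IHn]; first by rewrite big_seq1.
  rewrite -[in LHS]addn1 iotaD big_cat big_seq1 IHn.
  have -> : num_coefs n.+1 = (num_coefs n + n.+2.*2)%N.
    by rewrite /num_coefs -muln2 [(n.+1 * _)%N]mulnC -mulnDr addn2.
  by rewrite halfD odd_double andbF doubleK.
exists (Tuple size_u); split=> [|m].
  apply: allpairs_uniq_dep; rewrite ?iota_uniq //.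
    by move=> k _; exact: iota_uniq.
  move=> _ _ /allpairsPdep[k [i [_]]] + -> /allpairsPdep[l [j [_]]] + ->.
  rewrite !mem_iota !add0n !ltnS /= => ik jl fE.
  have ij : i = j by rewrite -(f0 k i) fE f0.
  suff -> : k = l by rewrite ij.
  have := f1 k i; rewrite fE f1 -ij => kl.
  by rewrite -(subnK ik) -kl ij subnK.
have mE : mdeg m = (m ord0 + m (lift ord0 ord0))%N.
  by rewrite mdegE big_ord_recl big_ord1.
apply/allpairsPdep/idP => [[k [i []]]|le_mn].
  rewrite !mem_iota !add0n !ltnS /= => kn ik ->.
  by rewrite mdegD !mdegMn !mdeg1 !mul1n subnKC.
exists (mdeg m), (m ord0); rewrite !mem_iota !add0n !ltnS mE leq_addr -mE.
split=> //; apply/mnmP; case=> [[|[|//]]] lti.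
  by rewrite (_ : Ordinal lti = ord0) ?f0 //; apply/val_inj.
rewrite (_ : Ordinal lti = lift ord0 ord0) ?f1 ?mE ?addKn //.
by apply/val_inj.
Qed.

Section Coefficients.
Variable K : fieldType.
Local Notation endomorphism :=
  {lrmorphism {mpoly K[2]} -> {mpoly K[2]}}.
Implicit Types phi psi : endomorphism.

(* [msize p] is one more than the total degree of [p <> 0]. *)
Definition endo_degree phi : nat :=
  maxn (msize (phi 'X_0)).-1 (msize (phi 'X_1)).-1.

(* The inverse of a bijective [K]-algebra endomorphism is again one. *)
Definition automorphisms (n : nat) : set endomorphism :=
  [set phi : endomorphism | bijective phi /\ endo_degree phi = n].

(* Coordinates of [phi 'X_0] first, then those of [phi 'X_1]; coefficients in
   degree above [n] are dropped, so this is meaningful when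
   [endo_degree phi <= n]. *)
Definition coef_vector (n : nat) (u : (num_coefs n)./2.-tuple 'X_{1..2})
    phi : affine_space K (num_coefs n) :=
  \row_(i < num_coefs n)
    ([seq (phi 'X_0)@_m | m <- u] ++ [seq (phi 'X_1)@_m | m <- u])`_i.

Fact coef_vectorE n u (m : 'X_{1..2}) : @enumerates_monomials n u ->
    (mdeg m <= n)%N ->
  exists i j, forall psi : endomorphism, (psi 'X_0)@_m = coef_vector u psi 0 i /\
                          (psi 'X_1)@_m = coef_vector u psi 0 j.
Proof.
move=> [_ uE]; rewrite -uE => mu.
have szE : ((num_coefs n)./2 + (num_coefs n)./2 = num_coefs n)%N.
  by rewrite addnn even_halfK // /num_coefs oddM /= negbK andbC andbN.
have lt_m : (index m u < (num_coefs n)./2)%N.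
  by have := mu; rewrite -index_mem size_tuple.
have lti : (index m u < num_coefs n)%N.
  by rewrite (leq_trans lt_m) // -[leqRHS]szE leq_addr.
have ltj : ((num_coefs n)./2 + index m u < num_coefs n)%N.
  by rewrite -[ltnRHS]szE ltn_add2l.
exists (Ordinal lti), (Ordinal ltj) => psi; rewrite !mxE !nth_cat /=.
rewrite !size_map !size_tuple lt_m ltnNge leq_addr /= addKn.
by rewrite !(nth_map 0%MM) ?size_tuple // !nth_index.
Qed.

Fact coef_vector_inj n u phi psi : @enumerates_monomials n u ->
  (endo_degree phi <= n)%N -> (endo_degree psi <= n)%N ->
  coef_vector u phi = coef_vector u psi -> phi =1 psi.
Proof.
move=> uE phin psin pi_eq.
have big_deg (p : {mpoly K[2]}) m : ((msize p).-1 <= n)%N ->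
    ~~ (mdeg m <= n)%N -> p@_m = 0.
  move=> pn; rewrite -ltnNge => nm; apply/memN_msupp_eq0/msize_mdeg_ge.
  by rewrite (leq_trans (leqSpred _)) // (leq_trans _ nm).
have eqX i : phi 'X_i = psi 'X_i.
  apply/mpolyP => m.
  move: phin psin; rewrite !geq_max => /andP[f0 f1] /andP[g0 g1].
  have [le_mn|gt_mn] := boolP (mdeg m <= n)%N; last first.
    case: i => [[|[|//]]] lti.
      by rewrite (_ : Ordinal lti = 0) ?(big_deg _ m) //; apply/val_inj.
    by rewrite (_ : Ordinal lti = 1) ?(big_deg _ m) //; apply/val_inj.
  have [i0 [i1 E]] := coef_vectorE uE le_mn.
  case: i => [[|[|//]]] lti.
    rewrite (_ : Ordinal lti = 0) ?(E phi).1 ?(E psi).1 ?pi_eq //.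
    by apply/val_inj.
  rewrite (_ : Ordinal lti = 1) ?(E phi).2 ?(E psi).2 ?pi_eq //.
  by apply/val_inj.
move=> p; rewrite [p]mpolyE !linear_sum; apply: eq_bigr => m _.
by rewrite !linearZ mpolyXE_id !rmorph_prod /=;
   congr (_ *: _); apply: eq_bigr => i _; rewrite !rmorphXn /= eqX.
Qed.

Fact coef_vector_surj n u (v : affine_space K (num_coefs n)) :
  @enumerates_monomials n u ->
  exists phi, (endo_degree phi <= n)%N /\ coef_vector u phi = v.
Proof.
move=> uE; have [u_uniq mem_u] := uE.
pose h := (num_coefs n)./2.
have szE : (h + h = num_coefs n)%N.
  by rewrite addnn even_halfK // /num_coefs oddM /= negbK andbC andbN.
pose w k : K := nth 0 [seq v 0 i | i <- enum 'I_(num_coefs n)] k.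
have wE (i : 'I_(num_coefs n)) : w i = v 0 i.
  by rewrite /w (nth_map i) ?size_enum_ord // nth_ord_enum.
pose p k : {mpoly K[2]} := \sum_(j < h) w (k + j)%N *: 'X_[tnth u j].
have pdeg k : ((msize (p k)).-1 <= n)%N.
  rewrite -subn1 leq_subLR add1n; apply: (leq_trans (msize_sum _ _ _)).
  apply/bigmax_leqP => j _; rewrite (leq_trans (msizeZ_le _ _)) //.
  by rewrite msizeX ltnS -mem_u mem_tnth.
have pcoef k (j : 'I_h) : (p k)@_(tnth u j) = w (k + j)%N.
  rewrite raddf_sum (bigD1 j) //= mcoeffZ mcoeffX eqxx mulr1 big1 ?addr0 //.
  move=> i ij; rewrite mcoeffZ mcoeffX.
  have /negPf-> : tnth u i != tnth u j; last by rewrite mulr0.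
  by rewrite !(tnth_nth 0%MM) nth_uniq ?size_tuple.
exists (comp_mpoly [tuple p 0%N; p h]).
have E0 : 'X_0 \mPo [tuple p 0%N; p h] = p 0%N by rewrite comp_mpolyXU.
have E1 : 'X_1 \mPo [tuple p 0%N; p h] = p h by rewrite comp_mpolyXU.
split; first by rewrite /endo_degree /= E0 E1 geq_max !pdeg.
apply/rowP => i; rewrite mxE -wE /= E0 E1 nth_cat size_map size_tuple -/h.
case: ltnP => [lt_ih|le_hi].
  rewrite (nth_map 0%MM) ?size_tuple //.
  by have := pcoef 0%N (Ordinal lt_ih); rewrite (tnth_nth 0%MM).
have lt_ih : (i - h < h)%N by rewrite ltn_subLR // szE.
rewrite (nth_map 0%MM) ?size_tuple //.
by have := pcoef h (Ordinal lt_ih); rewrite (tnth_nth 0%MM) /= subnKC.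
Qed.

End Coefficients.

Arguments automorphisms K n : clear implicits.

(* Main.v *)
Require Import Defs.
From HB Require Import structures.
From mathcomp Require Import all_boot all_order all_algebra.
From mathcomp Require Import boolp classical_sets topology_structure.
From mathcomp Require Import mpoly closed_field.
From mathcomp Require Import zify ring.

Set Implicit Arguments.
Unset Strict Implicit.
Unset Printing Implicit Defensive.
Import Order.TTheory GRing.Theory Num.Theory.

(* If [(f, g)] is an automorphism with inverse [(X, Y)], substituting [f] and [g + t] in
   [X] and [Y] is a nontrivial additive one-parameter family fixing [f].  Passing to leading
   forms in [t] and for integer weights, every edge form of [f] is again fixed by a nontrivial
   family.  A form divisible by some [x^q - l y^p] with coprime [p, q > 1] is not: this is
   Fermat's equation for polynomials, solved by a Wronskian, combined with Frobenius in
   positive characteristic.  Hence an automorphism of degree [n > 1] is, up to exchanging its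
   components, one of degree [n / d] composed with an elementary map of degree [d > 1] and a
   linear map having at most one parameter; this is Jung's theorem in any characteristic.

   Iterating, the automorphisms of degree [n] lie in finitely many polynomial images of
   [K^(n + 6)], since each step adds [d] parameters and the affine maps have [6]; and a strict
   chain of irreducible closed subsets of such an image has length at most [n + 6], because
   more than [M] polynomials in [M] variables are algebraically dependent.  Conversely the
   automorphisms [f = b y + q(l)], [g = c f + d l + e], [l = x + s y], [deg q = n], depend on
   [n + 6] parameters, which are rational functions of the coefficients of [f] and [g].

   The same induction bounds the degree of the inverse by [n].  Automorphisms of degree at
   most [n] thus form a projection of the closed set of pairs of mutually inverse maps of
   degree at most [n], which is constructible by quantifier elimination. *)

(** In positive characteristic a derivation does not carry enough of an additive group action, so a
    family is kept as a pair of polynomials in t. Its group law is not recorded: starting at the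
    identity, moving, and fixing f is all that the rigidity arguments use, and all that has to pass
    to leading forms.

    Cusps appear because an edge of the Newton polygon of f that starts at y^k with non-integral
    slope carries a form that factors into y and binomials y^p - l x^q. Their rigidity leaves
    integral slopes only, which elementary maps remove one by one.

    Reducing f leaves the degree of g uncontrolled. Two mates of f agree up to a scalar and a
    polynomial in f, and comparing with a mate of small degree bounds both components at once.

    The d parameters of a step are the coefficients of x^2, ..., x^d and the scalar of the linear
    map; lower terms are left to the final affine map. As d + k <= d k for d, k > 1, a longer
    factorization of n never needs more parameters than a single step of degree n. *)

Section Evaluation.
Local Open Scope ring_scope.

Lemma eq_mpoly_rmorph (R S : nzRingType) n (F G : {rmorphism {mpoly R[n]} -> S}) :
  (forall c, F c%:MP = G c%:MP) -> (forall i, F 'X_i = G 'X_i) -> F =1 G.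
Proof.
move=> FGc FGX p; rewrite [p]mpolyE !rmorph_sum /=; apply: eq_bigr => m _.
rewrite -!mul_mpolyC !rmorphM FGc mpolyXE_id !rmorph_prod.
by congr (_ * _); apply: eq_bigr => i _; rewrite !rmorphXn /= FGX.
Qed.

Variable K : fieldType.
Local Notation A := {mpoly K[2]}.
Implicit Types (f g a b X Y : A) (U V : {poly A}).

Definition mpolyPC : K -> {poly A} := polyC \o @mpolyC 2 K.
HB.instance Definition _ := GRing.RMorphism.on mpolyPC.

(** The parameter t of a family is the indeterminate of [{poly A}]: [ev U V] is a substitution
    depending polynomially on t. *)
Definition ev U V : A -> {poly A} := mmap mpolyPC (tnth [tuple U; V]).
HB.instance Definition _ U V := GRing.RMorphism.on (ev U V).

Definition subst a b : A -> A := comp_mpoly [tuple a; b].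
HB.instance Definition _ a b := GRing.LRMorphism.on (subst a b).

Lemma ord2E (i : 'I_2) : i = 0 \/ i = 1.
Proof. by case: i => [[|[|//]]] lti; [left|right]; apply/val_inj. Qed.

Lemma evX0 U V : ev U V 'X_0 = U.
Proof. by rewrite /ev mmapX mmap1U. Qed.
Lemma evX1 U V : ev U V 'X_1 = V.
Proof. by rewrite /ev mmapX mmap1U. Qed.
Lemma evMP U V c : ev U V c%:MP = c%:MP%:P.
Proof. by rewrite /ev mmapC. Qed.
Lemma evZ U V c f : ev U V (c *: f) = c%:MP *: ev U V f.
Proof. by rewrite -mul_mpolyC rmorphM /= evMP mul_polyC. Qed.
Lemma substX0 a b : subst a b 'X_0 = a.
Proof. by rewrite /subst comp_mpolyXU. Qed.
Lemma substX1 a b : subst a b 'X_1 = b.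
Proof. by rewrite /subst comp_mpolyXU. Qed.
Lemma substMP a b c : subst a b c%:MP = c%:MP.
Proof. by rewrite /subst comp_mpolyC. Qed.

Lemma evC a b f : ev a%:P b%:P f = (subst a b f)%:P.
Proof.
apply: (eq_mpoly_rmorph (F := ev a%:P b%:P) (G := polyC \o subst a b)) => [c|i] /=.
  by rewrite evMP substMP.
by case: (ord2E i) => ->; rewrite ?evX0 ?evX1 ?substX0 ?substX1.
Qed.

Lemma ev_subst U V a b f : ev U V (subst a b f) = ev (ev U V a) (ev U V b) f.
Proof.
apply: (eq_mpoly_rmorph (F := ev U V \o subst a b)) => [c|i] /=.
  by rewrite substMP !evMP.
by case: (ord2E i) => ->; rewrite ?evX0 ?evX1 ?substX0 ?substX1.
Qed.

Lemma horner_ev U V f : (ev U V f).[0] = subst U.[0] V.[0] f.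
Proof.
apply: (eq_mpoly_rmorph (F := horner_eval 0 \o ev U V)) => [c|i] /=.
  by rewrite /horner_eval evMP substMP hornerC.
by rewrite /horner_eval; case: (ord2E i) => ->; rewrite ?evX0 ?evX1 ?substX0 ?substX1.
Qed.

Lemma subst_comp a b c d f : subst c d (subst a b f) = subst (subst c d a) (subst c d b) f.
Proof.
apply: (eq_mpoly_rmorph (F := subst c d \o subst a b)) => [k|i] /=.
  by rewrite !substMP.
by case: (ord2E i) => ->; rewrite ?substX0 ?substX1.
Qed.

Lemma subst_id f : subst 'X_0 'X_1 f = f.
Proof.
apply: (eq_mpoly_rmorph (F := subst 'X_0 'X_1) (G := idfun)) => [k|i] /=.
  by rewrite !substMP.
by case: (ord2E i) => ->; rewrite ?substX0 ?substX1.
Qed.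

Definition inv2 f g X Y :=
  [/\ subst f g X = 'X_0, subst f g Y = 'X_1, subst X Y f = 'X_0 & subst X Y g = 'X_1].

Definition aut2 f g := exists X Y, inv2 f g X Y.

Lemma aut2_comp f g a b : aut2 f g -> aut2 a b -> aut2 (subst a b f) (subst a b g).
Proof.
move=> [X [Y [XE YE fE gE]]] [P [Q [PE QE aE bE]]].
exists (subst X Y P), (subst X Y Q); split.
- by rewrite subst_comp -!(subst_comp f g a b) XE YE substX0 substX1.
- by rewrite subst_comp -!(subst_comp f g a b) XE YE substX0 substX1.
- by rewrite -(subst_comp P Q X Y) (subst_comp a b) aE bE subst_id fE.
- by rewrite -(subst_comp P Q X Y) (subst_comp a b) aE bE subst_id gE.
Qed.

Lemma inv2_swap f g X Y : inv2 f g X Y -> inv2 g f (subst 'X_1 'X_0 X) (subst 'X_1 'X_0 Y).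
Proof.
move=> [XE YE fE gE].
have sw c d e : subst (subst 'X_1 'X_0 c) (subst 'X_1 'X_0 d) e = subst 'X_1 'X_0 (subst c d e)
  :> A.
  by rewrite subst_comp.
have sw' h : subst g f (subst 'X_1 'X_0 h) = subst f g h by rewrite subst_comp substX0 substX1.
by split; rewrite ?sw' // sw ?fE ?gE ?substX0 ?substX1.
Qed.

Lemma aut2_swap f g : aut2 f g -> aut2 g f.
Proof.
move=> [X [Y XY]]; exists (subst 'X_1 'X_0 X), (subst 'X_1 'X_0 Y).
exact: inv2_swap.
Qed.

(** The trace of an additive action fixing f: at t = 0 the family (U, V) is the identity, and it is
    not constant in t. *)
Definition G_a_invariant f := exists U V : {poly A},
  [/\ U.[0] = 'X_0, V.[0] = 'X_1, (1 < size U)%N || (1 < size V)%N & ev U V f = f%:P].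

Lemma aut2_invariant f g : aut2 f g -> G_a_invariant f.
Proof.
move=> [X [Y [XE YE fE gE]]]; pose W := ev f%:P (g%:P + 'X).
have X0 : (W X).[0] = 'X_0 by rewrite horner_ev !hornerE XE.
have Y0 : (W Y).[0] = 'X_1 by rewrite horner_ev !hornerE YE.
exists (W X), (W Y); split=> //; last by rewrite -ev_subst fE evX0.
have gW : ev (W X) (W Y) g = g%:P + 'X by rewrite -ev_subst gE evX1.
move: X0 Y0 gW; move: (W X) (W Y) => U V X0 Y0 gW.
apply: contraT; rewrite negb_or -!leqNgt => /andP[/size1_polyC UE /size1_polyC VE].
move: X0 Y0 gW; rewrite UE VE !hornerC => -> ->; rewrite evC subst_id.
move=> /(congr1 (fun p : {poly A} => p`_1)); rewrite coefD !coefC coefX /= add0r => /eqP.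
by rewrite eq_sym oner_eq0.
Qed.

End Evaluation.

(** * Leading forms *)

Section LeadingForms.
Local Open Scope ring_scope.
Variable K : fieldType.
Local Notation A := {mpoly K[2]}.
Implicit Types (f g : A) (u v U V : {poly A}) (m : 'X_{1..2}) (a b c d e : int).

Definition mwt a b m : int := a * (m 0)%:Z + b * (m 1)%:Z.

Lemma mwtD a b m1 m2 : mwt a b (m1 + m2)%MM = mwt a b m1 + mwt a b m2.
Proof. by rewrite /mwt !mnmDE !PoszD; ring. Qed.

Definition lead_form a b d f : A :=
  \sum_(m <- msupp f | mwt a b m == d) f@_m *: 'X_[m].

Lemma mcoeff_lead_form a b d f m :
  (lead_form a b d f)@_m = if mwt a b m == d then f@_m else 0.
Proof.
rewrite /lead_form raddf_sum /=.
have -> : \sum_(i <- msupp f | mwt a b i == d) (f@_i *: 'X_[i])@_m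
   = \sum_(i <- msupp f | mwt a b i == d) (if i == m then f@_m else 0).
  apply: eq_bigr => i _; rewrite mcoeffZ mcoeffX.
  by case: eqP => [->|]; rewrite ?mulr1 ?mulr0.
rewrite -big_mkcondr /=; case: ifP => [md|md].
  have [mf|mf] := boolP (m \in msupp f).
    rewrite (big_rem m) //= md eqxx /= big1_seq ?addr0 // => i /andP[/andP[_ /eqP->]].
    by rewrite mem_rem_uniq ?msupp_uniq // inE eqxx.
  rewrite (memN_msupp_eq0 mf); exact: big1.
by apply: big1 => i /andP[id /eqP im]; rewrite -im id in md.
Qed.

(** Here t has weight [e]. The bound [d] need not be attained, in which case [v] is 0; sums and
    products of leading parts thus need no case distinction on cancellation. *)
Definition is_lead a b e d u v := forall i m,
  (u`_i@_m != 0 -> mwt a b m + e * i%:Z <= d) /\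
  v`_i@_m = if mwt a b m + e * i%:Z == d then u`_i@_m else 0.

Section Weights.
Variables a b e : int.
Local Notation L := (is_lead a b e).

Lemma is_lead_uniq d u v v' : L d u v -> L d u v' -> v = v'.
Proof.
by move=> H H'; apply/polyP => i; apply/mpolyP => m; rewrite (H i m).2 (H' i m).2.
Qed.

Lemma is_lead0 d : L d 0 0.
Proof. by move=> i m; rewrite coef0 mcoeff0 eqxx if_same. Qed.

Lemma is_leadD d u v u' v' : L d u v -> L d u' v' -> L d (u + u') (v + v').
Proof.
move=> H H' i m; rewrite !coefD !mcoeffD (H i m).2 (H' i m).2; split; last first.
  by case: ifP; rewrite ?addr0.
apply: contraNT => mi; have [->//|/(H i m).1] := eqVneq (u`_i@_m) 0; last by rewrite (negPf mi).
by have [->|/(H' i m).1] := eqVneq (u'`_i@_m) 0; [rewrite addr0|rewrite (negPf mi)].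
Qed.

Lemma is_lead_sum d (I : eqType) (r : seq I) (P : pred I) (u v : I -> {poly A}) :
  (forall i, i \in r -> P i -> L d (u i) (v i)) ->
  L d (\sum_(i <- r | P i) u i) (\sum_(i <- r | P i) v i).
Proof.
move=> H; elim: r H => [|i r IHr] H; first by rewrite !big_nil; exact: is_lead0.
have {}IHr : L d (\sum_(i <- r | P i) u i) (\sum_(i <- r | P i) v i).
  by apply: IHr => j jr; apply: H; rewrite inE jr orbT.
rewrite !big_cons; case: ifP => // Pi; apply: is_leadD => //.
by apply: H; rewrite // inE eqxx.
Qed.

Lemma is_lead_lt d d' u v : L d u v -> d < d' -> L d' u 0.
Proof.
move=> H dd' i m; rewrite coef0 mcoeff0; split.
  by move=> /(H i m).1; move=> /le_trans; apply; apply: ltW.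
case: eqP => // wd; apply/esym/eqP; apply: contraTT dd' => /(H i m).1.
by rewrite wd -leNgt.
Qed.

Lemma is_leadM d d' u v u' v' : L d u v -> L d' u' v' -> L (d + d') (u * u') (v * v').
Proof.
move=> H H' i m.
have eE (j : 'I_i.+1) : e * i%:Z = e * j%:Z + e * (i - j)%N%:Z.
  by rewrite -mulrDr -PoszD subnKC // -ltnS.
split.
  apply: contraNT; rewrite -ltNge => dm; rewrite coefM raddf_sum /= big1 //.
  move=> j _; rewrite mcoeffM big1 // => k /eqP mE.
  apply/eqP; rewrite mulf_eq0; apply: contraTT dm; rewrite negb_or => /andP[].
  move=> /(H _ _).1 h1 /(H' _ _).1 h2; rewrite -leNgt mE mwtD.
  by rewrite (eE j); lia.
rewrite !coefM !raddf_sum /=.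
case: eqP => [dm|dm]; last first.
  rewrite big1 // => j _; rewrite mcoeffM big1 // => k /eqP mE.
  rewrite (H _ _).2 (H' _ _).2; case: eqP => [h1|]; last by rewrite mul0r.
  case: eqP => [h2|]; last by rewrite mulr0.
  by case: dm; rewrite -h1 -h2 (eE j) [RHS]addrACA -mwtD -mE.
apply: eq_bigr => j _; rewrite !mcoeffM; apply: eq_bigr => k /eqP mE.
have E : mwt a b k.1 + e * j%:Z + (mwt a b k.2 + e * (i - j)%N%:Z) = d + d'.
  by rewrite -dm (eE j) [LHS]addrACA -mwtD -mE.
rewrite (H _ _).2 (H' _ _).2; case: eqP => h1.
  by case: eqP => // h2; case: h2; apply: (addrI d); rewrite -E h1.
rewrite mul0r; apply/esym/eqP; rewrite mulf_eq0; apply: contra_notT h1.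
rewrite negb_or => /andP[].
move=> /(H _ _).1 h1 /(H' _ _).1 h2; apply/eqP; rewrite eq_le h1 /=.
by rewrite -(lerD2r d') -E lerD2l.
Qed.

Lemma is_lead_cst (k : K) : L 0 k%:MP%:P k%:MP%:P.
Proof.
move=> i m; rewrite coefC; case: (i =P 0%N) => [->|_]; last by rewrite mcoeff0 eqxx if_same.
rewrite mcoeffC; case: (m =P 0%MM) => [->|_]; last by rewrite mulr0 eqxx if_same.
by rewrite /mwt !mnm0E !mulr0 !addr0 eqxx mulr1.
Qed.

Lemma is_lead_exp d u v n : L d u v -> L (d * n%:Z) (u ^+ n) (v ^+ n).
Proof.
move=> H; elim: n => [|n IHn]; first by rewrite !expr0 mulr0 -polyC1 -mpolyC1; apply: is_lead_cst.
by rewrite !exprS (_ : d * n.+1%:Z = d + d * n%:Z); [apply: is_leadM | rewrite intS mulrDr mulr1].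
Qed.

Lemma is_leadC d f : (forall m, m \in msupp f -> mwt a b m <= d) ->
  L d f%:P (lead_form a b d f)%:P.
Proof.
have := mcoeff_lead_form a b d f; move: (lead_form a b d f) => g gE H i m.
have := coefC f i; have := coefC g i; move: f%:P g%:P => u v -> ->.
have [->|_] := eqVneq i 0%N; last first.
  by rewrite mcoeff0 if_same; split; [rewrite eqxx | exact: erefl].
rewrite gE mulr0 addr0; split; last exact: erefl.
by rewrite -mcoeff_msupp; apply: H.
Qed.

End Weights.

Lemma evE U V f : ev U V f = \sum_(m <- msupp f) (f@_m)%:MP%:P * (U ^+ m 0 * V ^+ m 1).
Proof.
rewrite /ev /mmap; apply: eq_bigr => m _.
by rewrite /mmap1 big_ord_recl big_ord1 /= (_ : lift ord0 ord0 = 1) //; apply/val_inj.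
Qed.

Lemma ev_lead_form U V a b d f : ev U V (lead_form a b d f) =
  \sum_(m <- msupp f | mwt a b m == d) (f@_m)%:MP%:P * (U ^+ m 0 * V ^+ m 1).
Proof.
rewrite /lead_form rmorph_sum; apply: eq_bigr => m _ /=.
rewrite evZ -mul_polyC; congr (_ * _); rewrite mpolyXE_id rmorph_prod /=.
by rewrite big_ord_recl big_ord1 /= !rmorphXn /= (_ : lift ord0 ord0 = 1) ?evX0 ?evX1 //;
  apply/val_inj.
Qed.

(** The weights of U and V serve as weights of x and y in f: only the monomials of f of maximal
    weight for them can contribute to weight [d]. *)
Lemma is_lead_ev a b e d1 d2 d U V U' V' f :
  is_lead a b e d1 U U' -> is_lead a b e d2 V V' ->
  (forall m, m \in msupp f -> mwt d1 d2 m <= d) ->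
  is_lead a b e d (ev U V f) (ev U' V' (lead_form d1 d2 d f)).
Proof.
move=> HU HV Hf; rewrite evE ev_lead_form [X in is_lead _ _ _ _ _ X]big_mkcond /=.
apply: (@is_lead_sum a b e d _ (msupp f) xpredT) => m mf _.
have H : is_lead a b e (mwt d1 d2 m) ((f@_m)%:MP%:P * (U ^+ m 0 * V ^+ m 1))
   ((f@_m)%:MP%:P * (U' ^+ m 0 * V' ^+ m 1)).
  rewrite -[mwt _ _ _]add0r; apply: is_leadM; first exact: is_lead_cst.
  by apply: is_leadM; apply: is_lead_exp.
case: eqP => [<-//|/eqP md]; apply: (is_lead_lt H).
by rewrite lt_neqAle md Hf.
Qed.

End LeadingForms.

Section LeadingInvariants.
Local Open Scope ring_scope.
Variable K : fieldType.
Local Notation A := {mpoly K[2]}.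
Implicit Types (f g : A) (u v U V : {poly A}) (m : 'X_{1..2}).

(** Minimizes the ratio [x.2 / x.1], cross-multiplied to stay in the integers. It provides the
    weight of t, and later an edge of a Newton polygon. *)
Lemma exists_min_slope (s : seq (nat * int)) : s != [::] ->
  (forall x, x \in s -> (0 < x.1)%N) ->
  exists2 x, x \in s & forall y, y \in s -> x.2 * y.1%:Z <= y.2 * x.1%:Z.
Proof.
elim: s => // x [|z s] IHs _ s0.
  by exists x => [|y]; rewrite inE // => /eqP->.
have [|y ys ymin] := IHs isT; first by move=> y ys; apply: s0; rewrite inE ys orbT.
have [xy|yx] := leP (x.2 * y.1%:Z) (y.2 * x.1%:Z); last first.
  exists y => [|t]; first by rewrite inE ys orbT.
  by rewrite inE => /predU1P[->|/ymin//]; apply: ltW.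
exists x => [|t]; first by rewrite inE eqxx.
rewrite inE => /predU1P[->//|ts]; have := ymin t ts.
have y0 : (0 < y.1)%N by apply: s0; rewrite inE ys orbT.
have x0 : (0 < x.1)%N by apply: s0; rewrite inE eqxx.
have t0 : (0 < t.1)%N by apply: s0; rewrite inE ts orbT.
move: (x.1) (x.2) (y.1) (y.2) (t.1) (t.2) x0 y0 t0 xy.
by move=> x1 x2 y1 y2 t1 t2 x0 y0 xy t0 yt; nia.
Qed.

Definition lead_part a b e d u : {poly A} :=
  \poly_(i < size u) lead_form a b (d - e * i%:Z) u`_i.

Lemma mcoeff_lead_part a b e d u i m :
  (lead_part a b e d u)`_i@_m = if mwt a b m + e * i%:Z == d then u`_i@_m else 0.
Proof.
rewrite coef_poly; case: ltnP => ui; last by rewrite nth_default // mcoeff0 if_same.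
by rewrite mcoeff_lead_form -subr_eq opprK.
Qed.

Lemma is_lead_part a b e d u :
  (forall i m, u`_i@_m != 0 -> mwt a b m + e * i%:Z <= d) ->
  is_lead a b e d u (lead_part a b e d u).
Proof. by move=> H i m; split; [exact: H | exact: mcoeff_lead_part]. Qed.

Lemma mwt_scale (c a b : int) m : mwt (c * a) (c * b) m = c * mwt a b m.
Proof. by rewrite /mwt; ring. Qed.

(** Give t the largest weight for which no term of U outweighs x and no term of V outweighs y. The
    leading parts still begin with x and y, and a term attaining the bound keeps a positive power of
    t, so the family stays nontrivial. The top weight of f(U, V) = f is the required invariance. *)
Lemma lead_form_invariant (p q : int) d f :
  (forall m, m \in msupp f -> mwt p q m <= d) ->
  G_a_invariant f -> G_a_invariant (lead_form p q d f).
Proof.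
move=> fd [U [V [U0 V0 UV fUV]]].
(* A term t^i X^m of [u] with i > 0 constrains the weight r of t by [r * i <= c - mwt p q m];
   [T c u] lists these constraints. *)
pose T c u := [seq (i, c - mwt p q m) | i <- iota 1 (size u), m <- msupp u`_i].
have TP c u i m : (0 < i)%N -> u`_i@_m != 0 -> (i, c - mwt p q m) \in T c u.
  move=> i0 um; apply/allpairsPdep; exists i, m; rewrite mem_iota i0 mcoeff_msupp um.
  split=> //; rewrite add1n ltnS ltnW // ltnNge; apply: contraNN um => ui.
  by rewrite nth_default ?mcoeff0.
have TP' c u x : x \in T c u -> (0 < x.1)%N /\ exists m, u`_(x.1)@_m != 0 /\ x.2 = c - mwt p q m.
  move=> /allpairsPdep[i [m [+ + ->]]] /=; rewrite mem_iota mcoeff_msupp => /andP[i0 _] um.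
  by split=> //; exists m.
have T0 c u : (1 < size u)%N -> exists x, x \in T c u.
  move=> u1; have un : u`_(size u).-1 != 0.
    by rewrite -lead_coefE lead_coef_eq0 -size_poly_gt0 (leq_trans _ u1).
  have um : u`_(size u).-1@_(mlead u`_(size u).-1) != 0 by rewrite -mcoeff_msupp mlead_supp.
  exists ((size u).-1, c - mwt p q (mlead u`_(size u).-1)); apply: TP => //;
    by case: (size u) u1 => [|[]].
have [||[i0 r0] rS rmin] := @exists_min_slope (T p U ++ T q V).
- have [x xS] : exists x, x \in T p U ++ T q V.
    by move: UV => /orP[/(T0 p)|/(T0 q)] [x xT]; exists x; rewrite mem_cat xT ?orbT.
  by apply: contraTneq xS => ->.
- by move=> x; rewrite mem_cat => /orP[]/TP'[].
have i0_gt0 : (0 < i0)%N by move: rS; rewrite mem_cat => /orP[]/TP'[].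
(* The optimal weight of t is the fraction [r0 / i0]; scaling all weights by [i0] makes it
   integral. *)
pose a := i0%:Z * p; pose b := i0%:Z * q.
have bound c u X : (forall m, 'X_X@_m != 0 :> K -> mwt p q m = c) -> u.[0] = 'X_X ->
    (forall x, x \in T c u -> r0 * x.1%:Z <= x.2 * i0%:Z) ->
    is_lead a b r0 (i0%:Z * c) u (lead_part a b r0 (i0%:Z * c) u) /\
    (lead_part a b r0 (i0%:Z * c) u).[0] = 'X_X.
  move=> cX; rewrite !horner_coef0 => uX uT; split.
    apply: is_lead_part => -[|i] m um.
      by rewrite mulr0 addr0 mwt_scale (cX m) // -uX.
    have /= := uT _ (TP c u i.+1 m isT um); rewrite mwt_scale mulrBl mulrC [_ * i0%:Z]mulrC.
    by rewrite [_ * i0%:Z]mulrC [_ * r0]mulrC lerBrDl.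
  apply/mpolyP => m; rewrite mcoeff_lead_part mulr0 addr0 uX mwt_scale.
  by case: eqP => // H; apply/esym/eqP; apply: contra_notT H => /cX->.
have wX0 m : 'X_0@_m != 0 :> K -> mwt p q m = p.
  rewrite mcoeffX; have [<- _|_] := eqVneq U_(0%R)%MM m; last by rewrite eqxx.
  by rewrite /mwt !mnm1E /= mulr1 mulr0 addr0.
have wX1 m : 'X_1@_m != 0 :> K -> mwt p q m = q.
  rewrite mcoeffX; have [<- _|_] := eqVneq U_(1%R)%MM m; last by rewrite eqxx.
  by rewrite /mwt !mnm1E /= mulr1 mulr0 add0r.
have [|LU LU0] := bound p U 0 wX0 U0; first by move=> x xT; apply: rmin; rewrite mem_cat xT.
have [|LV LV0] := bound q V 1 wX1 V0; first by move=> x xT; apply: rmin; rewrite mem_cat xT orbT.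
have leadE : lead_form a b (i0%:Z * d) f = lead_form p q d f.
  apply/mpolyP => m; rewrite !mcoeff_lead_form mwt_scale.
  by rewrite (inj_eq (mulfI _)) // eqz_nat -lt0n.
have fa m : m \in msupp f -> mwt a b m <= i0%:Z * d.
  by move=> /fd; rewrite mwt_scale ler_pM2l // ltz_nat.
exists (lead_part a b r0 (i0%:Z * p) U), (lead_part a b r0 (i0%:Z * q) V); split=> //; last first.
  have := is_lead_ev LU LV fa; rewrite leadE fUV => H.
  by have := is_lead_uniq H (is_leadC r0 fa); rewrite leadE.
have size_lead c u m : r0 = c - mwt p q m -> u`_i0@_m != 0 ->
    (1 < size (lead_part a b r0 (i0%:Z * c) u))%N.
  move=> r0E um; rewrite (leq_trans (_ : 1 < i0.+1)%N) // ltnNge.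
  apply: contraNN um => /(nth_default 0) /(congr1 (mcoeff m)) /eqP.
  rewrite mcoeff_lead_part mcoeff0 mwt_scale r0E ifT // [_ * i0%:Z]mulrC -mulrDr.
  by rewrite addrC subrK.
move: rS; rewrite mem_cat => /orP[]/TP'[_ [m [/= um r0E]]].
  by rewrite (size_lead _ _ _ r0E um).
by rewrite (size_lead _ _ _ r0E um) orbT.
Qed.

End LeadingInvariants.

(** * Rigidity of cusps *)

Section CuspRigidity.
Local Open Scope ring_scope.
Variable K : fieldType.
Local Notation A := {mpoly K[2]}.
Implicit Types (f g : A) (u v U V : {poly A}) (m : 'X_{1..2}).

Definition pderiv (i : 'I_2) u : {poly A} := map_poly (mderiv i) u.

Lemma coef_pderiv i u j : (pderiv i u)`_j = (u`_j)^`M(i).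
Proof. by rewrite coef_map_id0 ?mderiv0. Qed.

Lemma pderivD i u v : pderiv i (u + v) = pderiv i u + pderiv i v.
Proof. by apply/polyP => j; rewrite !(coefD, coef_pderiv) mderivD. Qed.

Lemma pderivM i u v : pderiv i (u * v) = pderiv i u * v + u * pderiv i v.
Proof.
apply/polyP => j; rewrite coefD coef_pderiv !coefM raddf_sum -big_split /=.
by apply: eq_bigr => k _; rewrite mderivM !coef_pderiv.
Qed.

Lemma pderivC i f : pderiv i f%:P = (f^`M(i))%:P.
Proof.
apply/polyP => j; rewrite coef_pderiv.
apply: etrans (congr1 (mderiv i) (coefC f j)) (etrans _ (esym (coefC _ j))).
by case: ifP; rewrite ?mderiv0.
Qed.

Lemma pderivXn i u n : pderiv i (u ^+ n) = (u ^+ n.-1 * pderiv i u) *+ n.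
Proof.
elim: n => [|n IHn]; first by rewrite expr0 mulr0n -polyC1 pderivC -mpolyC1 mderivC.
rewrite exprS pderivM IHn mulrSr addrC [pderiv i u * _]mulrC; congr (_ + _).
by case: n {IHn} => [|n]; rewrite ?mulr0n ?mulr0 // -mulrnAr mulrA -exprS mulrnAr.
Qed.

Lemma mderiv_XU (i j : 'I_2) : ('X_i : A)^`M(j) = (i == j)%:R.
Proof.
rewrite mderivX mnm1E; case: eqP => [->|_]; last by rewrite scale0r.
by rewrite scale1r (_ : (_ - _)%MM = 0%MM) ?mpolyX0 //; apply/mnmP => k; rewrite mnmBE mnm0E subnn.
Qed.

Lemma size_expr_eq1 (u : {poly A}) n : (0 < n)%N -> (size (u ^+ n) == 1)%N -> (size u <= 1)%N.
Proof.
move=> n0 /eqP un; have := size_exp u n; rewrite un /= => /eqP; rewrite eq_sym muln_eq0.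
by rewrite [n == 0]eqn0Ngt n0 orbF; case: (size u) => [|[]].
Qed.

Lemma pderiv_cst i (l : K) : pderiv i l%:MP%:P = 0.
Proof. by rewrite pderivC mderivC. Qed.

(* When the characteristic divides [p], differentiating
   [v ^ p + l u ^ q] along [i] only sees the second term. *)
Lemma inseparable_rigid (i : 'I_2) (p q : nat) (l l' : K) u v f :
  (1 < q)%N -> p%:R = 0 :> K -> q%:R != 0 :> K -> l != 0 -> f^`M(i) = 0 ->
  l'%:MP%:P * v ^+ p + l%:MP%:P * u ^+ q = f%:P + l%:MP%:P * ('X_i)%:P ^+ q ->
  (size u <= 1)%N.
Proof.
move=> q1 p0 q0 l0 fi /(congr1 (pderiv i)).
have natE (x : {poly A}) n : x *+ n = mpolyPC (n%:R : K) * x.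
  by rewrite rmorph_nat mulr_natl.
rewrite !pderivD !pderivM !pderiv_cst !mul0r !add0r !pderivXn !natE p0 rmorph0.
rewrite mul0r mulr0 add0r !pderivC fi add0r mderiv_XU eqxx mulr1.
have PC_neq0 (c : K) : c != 0 -> mpolyPC c != 0.
  by rewrite polyC_eq0 mpolyC_eq0.
move=> /(mulfI (PC_neq0 _ l0))/(mulfI (PC_neq0 _ q0)) E.
have : size (u ^+ q.-1 * pderiv i u) == 1%N.
  by rewrite E -rmorphXn /= size_polyC expf_neq0 // -msize_poly_eq0 msizeX.
rewrite size_mul_eq1 => /andP[+ _]; apply: size_expr_eq1.
by rewrite -subn1 subn_gt0.
Qed.

End CuspRigidity.

Section SeparableRigidity.
Local Open Scope ring_scope.
Variable R : idomainType.
Implicit Types (u v : {poly R}) (h l : R) (p q c : nat).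

(* With [w = q u' v - p u v'], both [p h v'] and [q h u'] are multiples of [w],
   by [l u ^ (q - 1)] and [v ^ (p - 1)] respectively: too high a degree. *)
Lemma fermat_deriv0 p q u v h l : (1 < p)%N -> (1 < q)%N ->
  p%:R != 0 :> R -> q%:R != 0 :> R -> l != 0 -> h != 0 -> u != 0 -> v != 0 ->
  v ^+ p = h%:P + l%:P * u ^+ q -> u^`() = 0 /\ v^`() = 0.
Proof.
move=> p1 q1 p0 q0 l0 h0 u0 v0 E0.
have E1 : p%:R * (v ^+ p.-1 * v^`()) = q%:R * l%:P * (u ^+ q.-1 * u^`()).
  have := congr1 deriv E0; rewrite derivD derivC add0r derivM derivC mul0r add0r.
  by rewrite !deriv_exp -[_ *+ p]mulr_natl -[_ *+ q]mulr_natl [v ^+ _ * _]mulrC => ->; ring.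
have vE : v ^+ p = v * v ^+ p.-1 by rewrite -exprS prednK // ltnW.
have uE : u ^+ q = u * u ^+ q.-1 by rewrite -exprS prednK // ltnW.
pose w := q%:R * u^`() * v - p%:R * u * v^`().
have Ev : p%:R * h%:P * v^`() = l%:P * u ^+ q.-1 * w.
  have -> : h%:P = v * v ^+ p.-1 - l%:P * (u * u ^+ q.-1) by rewrite -vE -uE E0 addrK.
  transitivity (v * (p%:R * (v ^+ p.-1 * v^`())) - p%:R * l%:P * (u * u ^+ q.-1) * v^`());
    first by ring.
  by rewrite E1 /w; ring.
have Eu : q%:R * h%:P * u^`() = v ^+ p.-1 * w.
  have -> : h%:P = v * v ^+ p.-1 - l%:P * (u * u ^+ q.-1) by rewrite -vE -uE E0 addrK.
  transitivity (v * v ^+ p.-1 * (q%:R * u^`()) - u * (q%:R * l%:P * (u ^+ q.-1 * u^`())));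
    first by ring.
  by rewrite -E1 /w; ring.
have C0 n : n%:R != 0 :> R -> n%:R * h%:P != 0 :> {poly R}.
  by move=> n0; rewrite -polyC_natr -polyCM polyC_eq0 mulf_neq0.
have sizeC n x : n%:R != 0 :> R -> size (n%:R * h%:P * x) = size x.
  by move=> n0; rewrite -polyC_natr -polyCM mul_polyC size_scale // mulf_neq0.
have [w0|w0] := eqVneq w 0.
  split.
    by move: Eu; rewrite w0 mulr0 => /eqP; rewrite mulf_eq0 (negPf (C0 _ q0)) => /eqP.
  by move: Ev; rewrite w0 mulr0 => /eqP; rewrite mulf_eq0 (negPf (C0 _ p0)) => /eqP.
have sz (x y : {poly R}) n : (1 < n)%N -> x != 0 -> y != 0 -> (size x <= size (x ^+ n.-1 * y)%R)%N.
  move=> n1 x0 y0; rewrite -(prednK (_ : 0 < n.-1)%N) ?exprS -?mulrA;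
    last by rewrite -subn1 subn_gt0.
  rewrite size_mul ?mulf_neq0 ?expf_neq0 // -subn1 -addnBA ?leq_addr //.
  by rewrite size_poly_gt0 mulf_neq0 ?expf_neq0.
have szu : (size v <= size u^`())%N by rewrite -(sizeC q u^`() q0) Eu sz.
have szv : (size u <= size v^`())%N.
  by rewrite -(sizeC p v^`() p0) Ev -mulrA mul_polyC size_scale // sz.
have := leq_trans (lt_size_deriv u0) (leq_trans szv (leq_trans (ltnW (lt_size_deriv v0)) szu)).
by rewrite ltnn.
Qed.

(** Every exponent with a nonzero coefficient is 0 in [R], hence a multiple of [c]. *)
Lemma deriv0_comp_Xn c u : c \in [pchar R] -> u^`() = 0 -> exists u1, u = u1 \Po 'X^c.
Proof.
move=> cR u0; have c0 := prime_gt0 (pcharf_prime cR).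
exists (\poly_(i < size u) u`_(i * c)); apply/polyP => i.
rewrite coef_comp_poly_Xn // coef_poly; case: ifP => [ci|ci].
  rewrite divnK //; case: ltnP => // ui; rewrite nth_default //.
  by rewrite (leq_trans ui) // leq_div.
case: i ci => [|i ci]; first by rewrite dvdn0.
have /eqP := congr1 (fun x : {poly R} => x`_i) u0; rewrite coef_deriv coef0 -mulr_natr mulf_eq0.
by rewrite -(dvdn_pcharf cR) ci orbF => /eqP.
Qed.

(** The top coefficient of the derivative is the degree of [u] times the leading coefficient, so the
    degree is 0 in [R]. *)
Lemma deriv0_natr u : u^`() = 0 -> (1 < size u)%N -> exists n, (0 < n)%N && (n%:R == 0 :> R).
Proof.
move=> u0 u1; exists (size u).-1; rewrite -subn1 subn_gt0 u1 /= subn1.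
have lc : u`_(size u).-1 != 0.
  by rewrite -lead_coefE lead_coef_eq0 -size_poly_gt0 ltnW.
have := congr1 (fun x : {poly R} => x`_(size u).-2) u0; rewrite /= coef_deriv coef0 prednK.
  by move=> /eqP; rewrite -[u`__ *+ _]mulr_natr mulf_eq0 (negPf lc).
by rewrite -subn1 subn_gt0.
Qed.
End SeparableRigidity.

Section CuspRigidity2.
Local Open Scope ring_scope.
Variable K : fieldType.
Local Notation A := {mpoly K[2]}.

Lemma mpoly_natr_eq0 n : (n%:R == 0 :> A) = (n%:R == 0 :> K).
Proof. by rewrite -mpolyC_nat mpolyC_eq0. Qed.

Lemma mderiv_XnU (i j : 'I_2) n : i != j -> ('X_i ^+ n : A)^`M(j) = 0.
Proof.
move=> ij; rewrite mpolyXn mderivX mulmnE mnm1E (negPf ij) mul0n.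
by rewrite scale0r.
Qed.

Lemma size_expr_le1 (u : {poly A}) n : (0 < n)%N -> (size (u ^+ n) <= 1)%N -> (size u <= 1)%N.
Proof.
move=> n0; rewrite leq_eqVlt => /orP[|]; first exact: size_expr_eq1.
rewrite ltnS leqn0 size_poly_eq0 expf_eq0 n0 /= => /eqP->.
by rewrite size_poly0.
Qed.

Lemma comp_poly_Xn_inj (c : nat) (u v : {poly A}) : (0 < c)%N -> u \Po 'X^c = v \Po 'X^c -> u = v.
Proof.
move=> c0 uv; apply/polyP => i.
have ue := coef_comp_poly_Xn u (i * c) c0; have ve := coef_comp_poly_Xn v (i * c) c0.
rewrite dvdn_mull // mulnK // in ue ve.
by apply: etrans (esym ue) (etrans _ ve); rewrite uv.
Qed.

Lemma pchar_coprime (p q : nat) : (0 < p)%N -> coprime p q ->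
  p%:R = 0 :> K -> q%:R != 0 :> K.
Proof.
move=> p_gt0 pq p0; have [|c cK] := @natf0_pchar K p p_gt0; first exact/eqP.
apply/negP => q0; have := pcharf_prime cK.
have : (c %| gcdn p q)%N by rewrite dvdn_gcd !(dvdn_pcharf cK) p0 q0 eqxx.
by rewrite (eqP pq) dvdn1 => /eqP->.
Qed.

(** Being coprime, [p] and [q] do not both vanish in [K]. If one does, [inseparable_rigid] applies
    along the variable that carries the other exponent. If none does, [fermat_deriv0] annihilates
    both derivatives: either u and v are constant in t, or the characteristic c is positive, both
    are polynomials in t^c, and replacing t^c by t keeps the equation and lowers the degrees. *)
Lemma cusp_rigid (p q : nat) (l : K) (u v : {poly A}) :
  (1 < p)%N -> (1 < q)%N -> coprime p q -> l != 0 -> u != 0 -> v != 0 ->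
  v ^+ p - l%:MP%:P * u ^+ q = ('X_1)%:P ^+ p - l%:MP%:P * ('X_0)%:P ^+ q ->
  (size u <= 1)%N /\ (size v <= 1)%N.
Proof.
move=> p1 q1 pq l0 + + E.
pose h : A := 'X_1 ^+ p - l%:MP * 'X_0 ^+ q.
have hE : h%:P = ('X_1)%:P ^+ p - l%:MP%:P * ('X_0)%:P ^+ q.
  by rewrite /h polyCB polyCM !rmorphXn.
have Ev : v ^+ p = h%:P + l%:MP%:P * u ^+ q by rewrite hE -E subrK.
have Eu : l%:MP *: u ^+ q = v ^+ p - h%:P by rewrite Ev mul_polyC addrAC subrr add0r.
have lA : l%:MP_[2] != 0 by rewrite mpolyC_eq0.
(* The right-hand side of [E] is free of t, so either component is constant as soon as the other one
   is. *)
have uv : (size u <= 1)%N -> (size v <= 1)%N.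
  move=> /size1_polyC uE; apply: (@size_expr_le1 _ p (ltnW p1)).
  by rewrite Ev uE -rmorphXn -polyCM -polyCD size_polyC leq_b1.
have vu : (size v <= 1)%N -> (size u <= 1)%N.
  move=> /size1_polyC vE; apply: (@size_expr_le1 _ q (ltnW q1)).
  by rewrite -(size_scale _ lA) Eu vE -rmorphXn -polyCB size_polyC leq_b1.
have [p0 _ _|p0] := eqVneq (p%:R : K) 0.
  suff u1 : (size u <= 1)%N by split=> //; apply: uv.
  have f0 : ('X_1 ^+ p : A)^`M(0) = 0 by apply: mderiv_XnU.
  apply: (@inseparable_rigid K 0 p q (- l) 1 u v _ q1 p0 _ _ f0).
  - exact: pchar_coprime (ltnW p1) pq p0.
  - by rewrite oppr_eq0.
  - by rewrite mpolyC1 polyC1 mul1r mpolyCN polyCN !mulNr E rmorphXn.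
have [q0 _ _|q0] := eqVneq (q%:R : K) 0.
  suff v1 : (size v <= 1)%N by split=> //; apply: vu.
  have f0 : (- l%:MP * 'X_0 ^+ q : A)^`M(1) = 0.
    by rewrite mderivM mderiv_XnU // mulr0 addr0 mderivN mderivC oppr0 mul0r.
  apply: (@inseparable_rigid K 1 q p 1 (- l) v u _ p1 q0 p0 _ f0).
  - by rewrite oner_eq0.
  - rewrite mpolyC1 polyC1 !mul1r mpolyCN polyCN mulNr addrC E.
    by rewrite polyCM polyCN mulNr rmorphXn addrC.
have h0 : h != 0.
  apply/eqP => /(congr1 (mcoeff (U_(1%R) *+ p)%MM)) /eqP.
  rewrite /h mcoeffB mul_mpolyC mcoeffZ !mpolyXn !mcoeffX eqxx mcoeff0.
  have /negPf-> : (U_(0%R) *+ q)%MM != (U_(1%R) *+ p)%MM :> 'X_{1..2}.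
    apply/eqP => /mnmP/(_ 0%R); rewrite !mulmnE !mnm1E /= mul1n mul0n.
    by case: q q1 {E hE Ev Eu h pq vu q0}.
  by rewrite mulr0 subr0 oner_eq0.
move: Ev; clear - K p q p1 q1 p0 q0 l0 lA h0.
move: {2}(size u + size v)%N (leqnn (size u + size v)) => n.
elim: n u v => [|n IHn] u v sn E u0 v0.
  by move: sn; rewrite leqn0 addn_eq0 size_poly_eq0 (negPf u0).
have [|//|u' v'] := fermat_deriv0 p1 q1 _ _ lA h0 u0 v0 E; rewrite ?mpoly_natr_eq0 //.
have [/andP//|uv] := boolP ((size u <= 1)%N && (size v <= 1)%N).
have [c cA] : exists c, c \in [pchar A].
  have [m /andP[m0 mA]] : exists m, (0 < m)%N && (m%:R == 0 :> A).
    by move: uv; rewrite negb_and -!ltnNge => /orP[]; exact: deriv0_natr.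
  rewrite mpoly_natr_eq0 in mA; have [c cK] := natf0_pchar m0 mA; exists c.
  by rewrite inE (pcharf_prime cK) /= mpoly_natr_eq0 pcharf0.
have c1 := prime_gt1 (pcharf_prime cA); have c0 := ltnW c1.
have [u1 uE] := deriv0_comp_Xn cA u'; have [v1 vE] := deriv0_comp_Xn cA v'.
have szc (x : {poly A}) : size (x \Po 'X^c) = ((size x).-1 * c).+1 :> nat \/ x = 0.
  have [->|x0] := eqVneq x 0; [by right|left].
  rewrite -(prednK (_ : 0 < size (x \Po 'X^c))%N) ?size_comp_poly ?size_polyXn //.
  rewrite size_poly_gt0; apply: contra x0 => /eqP xc; apply/eqP.
  by apply: (comp_poly_Xn_inj c0); rewrite xc comp_poly0.
have u10 : u1 != 0 by apply: contraNneq u0 => u10; rewrite uE u10 comp_poly0.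
have v10 : v1 != 0 by apply: contraNneq v0 => v10; rewrite vE v10 comp_poly0.
have su : size u = ((size u1).-1 * c).+1 by case: (szc u1) u10 => [<-|->]; rewrite -?uE ?eqxx.
have sv : size v = ((size v1).-1 * c).+1 by case: (szc v1) v10 => [<-|->]; rewrite -?vE ?eqxx.
(* The total size drops because [c > 1] and one of u, v has positive degree. *)
have [||//|//|] := IHn u1 v1; rewrite ?su ?sv.
- have := u10; have := v10; rewrite -!size_poly_gt0 => v1_gt0 u1_gt0.
  move: uv; rewrite su sv negb_and -!ltnNge !ltnS !muln_gt0 c0 !andbT.
  move: sn; rewrite su sv.
  have := leq_mul (leqnn (size u1).-1) c1; have := leq_mul (leqnn (size v1).-1) c1.
  move: u1_gt0 v1_gt0; move: (size u1) (size v1) => x y.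
  move: (x.-1 * c)%N (y.-1 * c)%N; by clear=> xc yc; lia.
- apply: (comp_poly_Xn_inj c0); rewrite comp_polyD comp_polyC comp_polyM comp_polyC !rmorphXn /=.
  by rewrite -uE -vE.
- by case: (size u1) => [|[|k]] // _; case: (size v1) => [|[|j]].
Qed.

End CuspRigidity2.

(** * Forms carried by the edges of a Newton polygon *)

Section EdgeForms.
Local Open Scope ring_scope.
Variable K : closedFieldType.
Local Notation A := {mpoly K[2]}.
Implicit Types (f g : A) (U V : {poly A}) (m : 'X_{1..2}).

Lemma ev_monomial U V m : ev U V 'X_[m] = U ^+ m 0 * V ^+ m 1.
Proof.
rewrite mpolyXE_id rmorph_prod big_ord_recl big_ord1 /= !rmorphXn /=.
by rewrite (_ : lift ord0 ord0 = 1) ?evX0 ?evX1 //; apply/val_inj.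
Qed.

Definition mk2 (i j : nat) : 'X_{1..2} := [multinom if (k : nat) == 0%N then i else j | k < 2].

Lemma mk2_0 i j : mk2 i j 0 = i. Proof. by rewrite mnmE. Qed.
Lemma mk2_1 i j : mk2 i j 1 = j. Proof. by rewrite mnmE. Qed.
Lemma mk2_eta m : mk2 (m 0) (m 1) = m.
Proof. by apply/mnmP => i; case: (ord2E i) => ->; rewrite ?mk2_0 ?mk2_1. Qed.

(** Degrees in t add up over a domain: if both exponents were positive, invariance would make U and
    V constant. *)
Lemma invariant_monomial c m : c != 0 -> G_a_invariant (c *: 'X_[m] : A) -> m 0 = 0%N \/ m 1 = 0%N.
Proof.
move=> c0 [U [V [U0 V0 UV]]]; rewrite evZ ev_monomial => E.
have : size (U ^+ m 0 * V ^+ m 1) == 1%N.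
  rewrite -(@size_scale _ c%:MP) ?mpolyC_eq0 // E size_polyC.
  by rewrite -mul_mpolyC mulf_neq0 ?mpolyC_eq0 // -msize_poly_eq0 msizeX.
rewrite size_mul_eq1 => /andP[sU sV]; have [m0|m0] := posnP (m 0); [by left|right].
have [//|m1] := posnP (m 1); move: UV.
by rewrite !ltnNge (size_expr_eq1 m0 sU) (size_expr_eq1 m1 sV).
Qed.

(** The factorization of a univariate polynomial, homogenized in [w] and [u]. *)
Lemma prod_homog (s : seq K) (u w : {poly A}) :
  \prod_(z <- s) (w - mpolyPC z * u) =
  \sum_(l < (size s).+1) mpolyPC (\prod_(z <- s) ('X - z%:P))`_l * (w ^+ l * u ^+ (size s - l)).
Proof.
elim: s => [|z s IHs]; first by rewrite !big_nil big_ord1 coef1 rmorph1 !mul1r.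
rewrite !big_cons {}IHs; set P := \prod_(z <- s) ('X - z%:P); set n := size s.
have sP : P`_n.+1 = 0 by rewrite nth_default // size_prod_XsubC.
pose t (l : nat) := w ^+ l * u ^+ (n.+1 - l).
transitivity (\sum_(l < n.+2) mpolyPC ('X * P)`_l * t l - \sum_(l < n.+2) mpolyPC (z%:P * P)`_l *
  t l).
  rewrite mulrBl; congr (_ - _).
    rewrite [in RHS]big_ord_recl coefXM rmorph0 mul0r add0r mulr_sumr; apply: eq_bigr => l _.
    by rewrite lift0 coefXM /= /t subSS exprS mulrCA !mulrA.
  rewrite [in RHS]big_ord_recr /= coefCM sP mulr0 rmorph0 mul0r addr0 mulr_sumr.
  apply: eq_bigr => l _; rewrite coefCM rmorphM /t subSn; last by rewrite -ltnS.
  rewrite exprS mulrACA; congr (_ * _); exact: mulrCA.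
rewrite -sumrB; apply: eq_bigr => l _.
by rewrite -mulrBl -rmorphB -coefB -mulrBl.
Qed.

(* [f] is homogeneous for the weights [p, q] and contains ['X_1 ^ k]: setting
   ['X_0 ^ q] to [1] turns it into ['X_1 ^ (k %% p)] times a polynomial
   in ['X_1 ^ p]. *)
Lemma edge_factor (p q k : nat) f :
  (0 < p)%N -> (0 < q)%N -> coprime p q ->
  (forall m, m \in msupp f -> (p * m 0%R + q * m 1%R = q * k)%N) -> f@_(mk2 0 k) != 0 ->
  exists (s : seq K) (c : K), [/\ c != 0, k = (k %% p + p * size s)%N &
    forall U V, ev U V f = mpolyPC c * V ^+ (k %% p)%N * \prod_(z <- s) (V ^+ p - mpolyPC z * U
      ^+ q)].
Proof.
move=> p0 q0 pq fE fk; set L := (k %/ p)%N; set r := (k %% p)%N.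
have kE : k = (r + p * L)%N by rewrite {1}(divn_eq k p) addnC mulnC.
pose mm l := mk2 (q * l) (k - p * l); pose c l := f@_(mm l).
have fsum : f = \sum_(l < L.+1) c l *: 'X_[mm l].
  apply/mpolyP => m; rewrite raddf_sum /=.
  have [mf|mf] := boolP (m \in msupp f); last first.
    rewrite (memN_msupp_eq0 mf) big1 // => l _; rewrite mcoeffZ mcoeffX.
    case: eqP => [mE|]; last by rewrite mulr0.
    by rewrite /c mE (memN_msupp_eq0 mf) mul0r.
  have m_w := fE m mf.
  have qm0 : (q %| m 0%R)%N.
    rewrite -(Gauss_dvdr _ (_ : coprime q p)) 1?coprime_sym //.
    by rewrite -(dvdn_addl _ (dvdn_mulr (m 1) (dvdnn q))) m_w dvdn_mulr.
  have m0E : m 0 = (q * (m 0%R %/ q))%N by rewrite mulnC divnK.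
  set l := (m 0%R %/ q)%N in m0E.
  have m1E : (p * l + m 1%R = k)%N.
    by apply/eqP; rewrite -(eqn_pmul2l q0) mulnDr mulnCA -m0E m_w.
  have lL : (l < L.+1)%N by rewrite ltnS leq_divRL // mulnC -m1E leq_addr.
  have mE : mm l = m by rewrite /mm -m0E -{1}m1E addKn mk2_eta.
  rewrite (bigD1 (Ordinal lL)) //= mcoeffZ mcoeffX mE eqxx mulr1 /c mE.
  rewrite big1 ?addr0 // => j jl; rewrite mcoeffZ mcoeffX.
  case: eqP => [jE|]; last by rewrite mulr0.
  case/eqP: jl; apply/val_inj => /=; apply/eqP; rewrite -(eqn_pmul2l q0) -m0E.
  by rewrite -jE mk2_0.
pose phi : {poly K} := \poly_(l < L.+1) c (L - l)%N.
have phiL : phi`_L = c 0%N by rewrite coef_poly ltnSn subnn.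
have c0 : c 0%N != 0 by rewrite /c /mm !muln0 subn0.
have sphi : size phi = L.+1.
  apply/eqP; rewrite eqn_leq size_poly ltnNge; apply: contra c0 => phi_le.
  by rewrite -phiL nth_default.
have [s phiE] := closed_field_poly_normal phi.
have lead_phi : lead_coef phi = c 0%N by rewrite lead_coefE sphi.
have size_s : size s = L.
  by apply: succn_inj; rewrite -sphi phiE size_scale ?lead_phi // size_prod_XsubC.
exists s, (c 0%N); split; [by []|by rewrite size_s|].
move=> U V; rewrite prod_homog {1}fsum rmorph_sum (reindex_inj rev_ord_inj) /= size_s.
rewrite mulr_sumr; apply: eq_bigr => l _; rewrite subSS evZ ev_monomial mk2_0 mk2_1.
have lL : (l <= L)%N by rewrite -ltnS.
have phil : c (L - l)%N = c 0%N * (\prod_(z <- s) ('X - z%:P))`_l.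
  by rewrite -coefZ -lead_phi -phiE coef_poly ltn_ord.
have -> : (k - p * (L - l) = r + p * l)%N.
  by rewrite kE mulnBr subnBA ?leq_mul2l ?lL ?orbT // -addnA [(_ + p * l)%N]addnC addnA addnK.
rewrite phil -mul_polyC mpolyCM polyCM exprD -!exprM.
rewrite -[(c 0%N)%:MP%:P]/(mpolyPC (c 0%N)) -[X in _ * X * _](erefl (mpolyPC _)).
move: (mpolyPC _) (mpolyPC _) (U ^+ _) (V ^+ _) (V ^+ _) => a1 a2 a3 a4 a5.
by ring.
Qed.

Lemma ev_edge_eval0 p q (z : K) U V : U.[0] = 'X_0 -> V.[0] = 'X_1 ->
  (V ^+ p - mpolyPC z * U ^+ q).[0] = 'X_1 ^+ p - z%:MP * 'X_0 ^+ q.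
Proof. by move=> U0 V0; rewrite hornerD hornerN hornerM !horner_exp U0 V0 hornerC. Qed.

Section Edge.
Variables (p q k : nat) (f : A).
Hypotheses (p0 : (0 < p)%N) (q0 : (0 < q)%N) (pq : coprime p q).
Hypothesis fE : forall m, m \in msupp f -> (p * m 0%R + q * m 1%R = q * k)%N.
Hypotheses (fk : f@_(mk2 0 k) != 0) (fI : G_a_invariant f).

(** In f(U, V) = f the right side is nonzero and constant in t, hence so is every factor of the left
    side; a factor constant in t equals its value at t = 0. *)
Lemma edge_invariants : exists (s : seq K) (c : K) (U V : {poly A}),
  [/\ U != 0, V != 0, ~~ ((size U <= 1)%N && (size V <= 1)%N), k = (k %% p + p * size s)%N &
  (forall z, z \in s -> V ^+ p - mpolyPC z * U ^+ q = ('X_1 ^+ p - z%:MP * 'X_0 ^+ q)%:P) /\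
  f = c%:MP * 'X_1 ^+ (k %% p)%N * \prod_(z <- s) ('X_1 ^+ p - z%:MP * 'X_0 ^+ q)].
Proof.
have [U [V [U0 V0 UV fUV]]] := fI.
have [s [c [c0 kE evf]]] := edge_factor p0 q0 pq fE fk; exists s, c, U, V.
have XN0 (i : 'I_2) (P : {poly A}) : P.[0] = 'X_i -> P != 0.
  move=> P0; apply: contra_eq_neq P0 => ->; rewrite horner0 eq_sym.
  by rewrite -msize_poly_eq0 msizeX.
split=> //; first exact: XN0 U0.
- exact: XN0 V0.
- by rewrite negb_and -!ltnNge.
split=> [z zs|]; last first.
  apply: polyC_inj; rewrite -{1}(subst_id f) -evC evf.
  rewrite !polyCM rmorph_prod !rmorphXn /=; congr (_ * _); apply: eq_bigr => z _.
  by rewrite polyCB polyCM !rmorphXn.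
rewrite -(ev_edge_eval0 p q z U0 V0).
suff /size1_polyC E : (size (V ^+ p - mpolyPC z * U ^+ q)%R <= 1)%N by rewrite {1}E {2}E hornerC.
have : size (ev U V f) == 1%N.
  have f0 : f != 0 by apply: contraNneq fk => ->; rewrite mcoeff0.
  by rewrite fUV size_polyC f0.
rewrite evf size_mul_eq1 => /andP[_ /size_prod_seq_eq1 H].
by rewrite H.
Qed.

(** A nonzero root [z] would give an invariant cusp, against [cusp_rigid]; so all roots are 0 and
    the form is a multiple of a power of y. *)
Lemma invariant_edge_no_cusp : (1 < p)%N -> (1 < q)%N ->
  forall m, m \in msupp f -> m 0 = 0%N.
Proof.
move=> p1 q1; have [s [c [U [V [U0 V0 UV kE [sE fE']]]]]] := edge_invariants.
have s0 z : z \in s -> z = 0.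
  move=> /sE zE; apply/eqP; apply: contraNT UV => z0.
  have [|-> ->//] := cusp_rigid p1 q1 pq z0 U0 V0.
  by rewrite zE polyCB polyCM !rmorphXn.
move=> m; rewrite fE' (_ : \prod_(z <- s) _ = 'X_1 ^+ (p * size s)).
  rewrite -mulrA -exprD -kE mul_mpolyC mpolyXn => /msuppZ_le.
  by rewrite msuppX inE => /eqP->; rewrite mulmnE mnm1E /= mul0n.
rewrite big_seq (eq_bigr (fun=> 'X_1 ^+ p)) => [|z /s0->]; last by rewrite mpolyC0 mul0r subr0.
by rewrite -big_seq big_const_seq count_predT iter_mulr_1 -exprM.
Qed.

(** Two distinct roots would make two combinations V - z U^q constant in t, hence U^q by
    subtraction, and then U and V. So all roots coincide. *)
Lemma invariant_edge_power : p = 1%N ->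
  exists z c : K, f = c%:MP * ('X_1 - z%:MP * 'X_0 ^+ q) ^+ k.
Proof.
move=> p1; have [s [c [U [V [U0 V0 UV kE [sE fE']]]]]] := edge_invariants.
have ks : k = size s by rewrite kE p1 modn1 mul1n.
(* If [s] is empty then [k] is 0 and any [z] would do. *)
exists (head 0 s), c; rewrite fE' p1 modn1 expr0 mulr1; congr (_ * _).
have sz z : z \in s -> z = head 0 s.
  case: s {kE fE'} sE ks => // y s sE _ /= zs; apply/eqP; apply: contraNT UV => zy.
  have yE := sE y (mem_head _ _); have zE := sE z zs.
  have U1 : (size U <= 1)%N.
    apply: (@size_expr_le1 _ _ q q0).
    have E : (z - y)%:MP *: U ^+ q = ('X_1 ^+ p - y%:MP * 'X_0 ^+ q)%:P - ('X_1 ^+ p - z%:MP *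
      'X_0 ^+ q)%:P.
      apply: etrans (congr2 (fun a b : {poly A} => a - b) yE zE).
      rewrite -mul_polyC -[(_)%:MP%:P]/(mpolyPC (z - y)) rmorphB /=.
      by move: (mpolyPC z) (mpolyPC y) (U ^+ q) (V ^+ p) => a1 a2 a3 a4; ring.
    by rewrite -(@size_scale _ (z - y)%:MP) ?mpolyC_eq0 ?subr_eq0 // E -polyCB size_polyC leq_b1.
  rewrite U1 /=; have := yE; rewrite p1 expr1 => /eqP; rewrite subr_eq => /eqP ->.
  rewrite (size1_polyC U1) -rmorphXn -[mpolyPC y]/(y%:MP%:P) -polyCM -polyCD.
  by rewrite size_polyC leq_b1.
rewrite big_seq (eq_bigr (fun=> 'X_1 - (head 0 s)%:MP * 'X_0 ^+ q)) => [|z /sz<-];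
  last by rewrite expr1.
by rewrite -big_seq big_const_seq count_predT iter_mulr_1 -ks.
Qed.

End Edge.
End EdgeForms.

(** * Reduction by elementary maps *)

Section Elementary.
Local Open Scope ring_scope.
Variable K : closedFieldType.
Local Notation A := {mpoly K[2]}.
Implicit Types (f g : A) (m : 'X_{1..2}) (P : {poly K}).

Definition polX : {poly K} -> A := horner_eval 'X_0 \o map_poly (@mpolyC 2 K).
HB.instance Definition _ := GRing.RMorphism.on polX.

Definition shear P : A -> A := subst 'X_0 ('X_1 + polX P).
HB.instance Definition _ P := GRing.RMorphism.on (shear P).

Lemma polXC c : polX c%:P = c%:MP.
Proof. by rewrite /polX /= map_polyC /horner_eval hornerC. Qed.
Lemma polXX : polX 'X = 'X_0.
Proof. by rewrite /polX /= map_polyX /horner_eval hornerX. Qed.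

Lemma subst_polX b P : subst 'X_0 b (polX P) = polX P.
Proof.
elim/poly_ind: P => [|P c IHP]; first by rewrite !rmorph0.
by rewrite !rmorphD !rmorphM /= IHP polXC polXX substX0 substMP.
Qed.

Lemma shear0 f : shear 0 f = f.
Proof. by rewrite /shear rmorph0 addr0 subst_id. Qed.

Lemma shear_comp P Q f : shear P (shear Q f) = shear (P + Q) f.
Proof.
by rewrite /shear subst_comp substX0 rmorphD /= substX1 subst_polX rmorphD addrA.
Qed.

Lemma shearK P : cancel (shear P) (shear (- P)).
Proof. by move=> f; rewrite shear_comp addNr shear0. Qed.

Lemma aut2_shear_pair P : aut2 ('X_0 : A) ('X_1 + polX P).
Proof.
exists 'X_0, ('X_1 + polX (- P)); split; rewrite ?substX0 //.
- rewrite -/(shear P _) rmorphD /= /shear substX1 subst_polX.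
  by rewrite -addrA -rmorphD subrr rmorph0 addr0.
- rewrite -/(shear (- P) _) rmorphD /= /shear substX1 subst_polX.
  by rewrite -addrA -rmorphD addNr rmorph0 addr0.
Qed.

Lemma aut2_shear P f g : aut2 f g -> aut2 (shear P f) (shear P g).
Proof. by move=> fg; apply: aut2_comp => //; apply: aut2_shear_pair. Qed.

Lemma mwt_nat (p q : nat) m : mwt p q m = (p * m 0%R + q * m 1%R)%N.
Proof. by rewrite /mwt PoszD !PoszM. Qed.

Lemma is_lead_homog a b e d f : (forall m, m \in msupp f -> mwt a b m = d) ->
  is_lead a b e d f%:P f%:P.
Proof.
move=> fd; have {2}-> : f = lead_form a b d f.
  apply/mpolyP => m; rewrite mcoeff_lead_form; case: eqP => // md.
  by apply/eqP; rewrite mcoeff_eq0; apply: contra_notN md; apply: fd.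
by apply: is_leadC => m /fd->.
Qed.

(** The case of [is_lead_ev] that is constant in t, read off at the coefficient of t^0. *)
Lemma is_lead_subst (a b : int) d1 d2 d f u v u' v' :
  is_lead a b 0 d1 u%:P u'%:P -> is_lead a b 0 d2 v%:P v'%:P ->
  (forall m, m \in msupp f -> mwt d1 d2 m <= d) ->
  forall m, ((subst u v f)@_m != 0 -> mwt a b m <= d) /\
  (subst u' v' (lead_form d1 d2 d f))@_m = if mwt a b m == d then (subst u v f)@_m else 0.
Proof.
move=> Hu Hv fd m; have := is_lead_ev Hu Hv fd; rewrite !evC => /(_ 0%N m).
move: (subst _ _ _) (subst _ _ _) => x y; have := coefC x 0; have := coefC y 0.
by move: x%:P y%:P => X Y -> ->; rewrite mulr0 addr0.
Qed.

Lemma lead_form_edge (p q k : nat) f : coprime p q -> (0 < p)%N -> (0 < q)%N -> G_a_invariant f ->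
  (forall m, m \in msupp f -> p * m 0%R + q * m 1%R <= q * k)%N -> f@_(mk2 0 k) != 0 ->
  let f' := lead_form p q (q * k)%N f in [/\ G_a_invariant f', f'@_(mk2 0 k) != 0 &
    forall m, m \in msupp f' -> (p * m 0%R + q * m 1%R = q * k)%N].
Proof.
move=> pq p0 q0 fI fE fk f'; split.
- by apply: lead_form_invariant => // m /fE; rewrite mwt_nat.
- by rewrite mcoeff_lead_form mwt_nat mk2_0 mk2_1 muln0 add0n eqxx.
- move=> m; rewrite mcoeff_msupp mcoeff_lead_form mwt_nat eqz_nat.
  by have [//|_] := eqVneq (p * m 0%R + q * m 1%R)%N (q * k)%N; rewrite eqxx.
Qed.

Lemma subst_sheared_power c z q k :
  shear (z%:P * 'X^q) (c%:MP * ('X_1 - z%:MP * 'X_0 ^+ q) ^+ k) = c%:MP * 'X_1 ^+ k.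
Proof.
rewrite rmorphM rmorphXn rmorphB rmorphM rmorphXn /= /shear !substMP substX0 substX1.
by rewrite rmorphM rmorphXn /= polXC polXX addrK.
Qed.

(** For the weights 1 and q the leading form is c (y - z x^q)^k. The shear y -> y + z x^q is
    homogeneous for these weights and turns it into c y^k, so all other monomials fall strictly
    below the edge. *)
Lemma shear_edge (q k : nat) f : (0 < q)%N -> G_a_invariant f ->
  (forall m, m \in msupp f -> m 0%R + q * m 1%R <= q * k)%N -> f@_(mk2 0 k) != 0 ->
  exists z, let f' := shear (z%:P * 'X^q) f in f'@_(mk2 0 k) != 0 /\
    forall m, m \in msupp f' -> (m 0%R + q * m 1%R < q * k)%N \/ m = mk2 0 k.
Proof.
move=> q0 fI fE fk; have fE1 m : m \in msupp f -> (1 * m 0%R + q * m 1%R <= q * k)%N.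
  by rewrite mul1n; exact: fE.
have [f'I f'k f'E] := lead_form_edge (coprime1n q) isT q0 fI fE1 fk.
have [z [c f'z]] := @invariant_edge_power K 1 q k _ isT q0 (coprime1n q) f'E f'k f'I erefl.
have wX0 : is_lead 1%N q 0 1%N ('X_0)%:P ('X_0 : A)%:P.
  by apply: is_lead_homog => m; rewrite msuppX inE => /eqP->; rewrite mwt_nat !mnm1E /= muln0.
have wX1 : is_lead 1%N q 0 q ('X_1 + polX (z%:P * 'X^q))%:P ('X_1 + polX (z%:P * 'X^q))%:P.
  apply: is_lead_homog => m; rewrite rmorphM rmorphXn /= polXC polXX mpolyXn mul_mpolyC.
  move=> /msuppD_le; rewrite mem_cat => /orP[|/msuppZ_le]; rewrite msuppX inE => /eqP->.
    by rewrite /mwt !mnm1E /= mulr0 add0r mulr1.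
  by rewrite /mwt !mulmnE !mnm1E /= mul1r mul1n mul0n mulr0 addr0.
have fE2 m : m \in msupp f -> mwt 1%N q m <= (q * k)%N.
  by move=> /fE1; rewrite (mwt_nat 1).
have H m : (shear (z%:P * 'X^q) f)@_m != 0 -> mwt 1%N q m <= (q * k)%N.
  exact: (is_lead_subst wX0 wX1 fE2 m).1.
have Hk m : (c%:MP * 'X_1 ^+ k : A)@_m =
    if mwt 1%N q m == (q * k)%N then (shear (z%:P * 'X^q) f)@_m else 0.
  by rewrite -(subst_sheared_power c z q k) -f'z; exact: (is_lead_subst wX0 wX1 fE2 m).2.
have c0 : c != 0 by apply: contraNneq f'k => c0; rewrite f'z c0 mpolyC0 mul0r mcoeff0.
have ck m : (c%:MP * 'X_1 ^+ k : A)@_m = if m == mk2 0 k then c else 0.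
  rewrite mul_mpolyC mcoeffZ mpolyXn mcoeffX (_ : (U_(1%R) *+ k)%MM = mk2 0 k).
    by rewrite eq_sym; case: eqP; rewrite ?mulr1 ?mulr0.
  by apply/mnmP => i; case: (ord2E i) => ->; rewrite mulmnE mnm1E ?mk2_0 ?mk2_1 /= ?mul0n ?mul1n.
exists z; split.
  have := Hk (mk2 0 k); rewrite ck eqxx (mwt_nat 1) mk2_0 mk2_1 mul1n eqxx => <-.
  exact: c0.
move=> m mf; have := H m; rewrite -mcoeff_msupp (mwt_nat 1) mul1n lez_nat => /(_ mf).
rewrite leq_eqVlt => /orP[/eqP mE|]; [right|by left].
apply/eqP; apply: contraTT mf => mk; have := Hk m.
by rewrite ck (negPf mk) (mwt_nat 1) mul1n mE eqxx mcoeff_msupp => <-; rewrite eqxx.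
Qed.

(** Descent on a bound [q] for the slopes of the Newton polygon at y^k. Once [shear_edge] has
    cleared slope q + 2, an edge exceeding slope q + 1 would have a slope strictly between these
    integers; its primitive weights would both exceed 1, which [invariant_edge_no_cusp] excludes.
    Only exponents at least 2 occur in the shears, hence the factor ['X^2]. *)
Lemma shear_reduce (q k : nat) f : (0 < q)%N -> (exists g, aut2 f g) ->
  (forall m, m \in msupp f -> m 0%R + q * m 1%R <= q * k)%N -> f@_(mk2 0 k) != 0 ->
  exists P, let f' := shear ('X^2 * P) f in f'@_(mk2 0 k) != 0 /\
    forall m, m \in msupp f' -> (m 0%R + m 1%R <= k)%N.
Proof.
elim: q f => // -[|q] IHq f _ fI fE fk.
  exists 0; rewrite mulr0 shear0; split=> // m /fE; by rewrite !mul1n.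
have [g fg] := fI; have [z [f'k f'E]] := shear_edge (ltn0Sn q.+1) (aut2_invariant fg) fE fk.
have f'g := aut2_shear (z%:P * 'X^(q.+2)) fg.
suff f'E' : forall m, m \in msupp (shear (z%:P * 'X^(q.+2)) f) ->
  (m 0%R + q.+1 * m 1%R <= q.+1 * k)%N.
  have [//||P [Pk PE]] := IHq _ _ _ f'E' f'k; first by exists (shear (z%:P * 'X^(q.+2)) g).
  exists (P + z%:P * 'X^q); rewrite mulrDr mulrCA -exprD.
  by rewrite -shear_comp.
move: (shear _ _) (aut2_invariant f'g) f'k f'E => h hI hk hE {fg f'g f fI fE fk g IHq z}.
have hk1 m : m \in msupp h -> m != mk2 0 k -> (m 1%R < k)%N.
  move=> /hE[mE _|->]; last by rewrite eqxx.
  by rewrite -(ltn_pmul2l (isT : (0 < q.+2)%N)) (leq_ltn_trans _ mE) // leq_addl.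
apply: contrapT => /existsNP[m0 /not_implyP[m0h /negP]]; rewrite -ltnNge => m0E.
have m0k : m0 != mk2 0 k by apply: contraTneq m0E => ->; rewrite mk2_0 mk2_1 ltnn.
(* The slope of the segment from y^k to [m] is [m 0 / (k - m 1)]; minimizing its opposite selects
   the extremal edge at y^k. *)
pose s := [seq ((k - m 1%R)%N, - (m 0%R)%:Z) | m <- msupp h & m != mk2 0 k].
have [||x /mapP[m + ->] xmin] := @exists_min_slope s.
- by apply/eqP => s0; have : (k - m0 1%R, - (m0 0%R)%:Z)%N \in s;
   [apply: map_f; rewrite mem_filter m0k|rewrite s0].
- by move=> x /mapP[m]; rewrite mem_filter => /andP[mk /hk1/(_ mk) ?] ->; rewrite subn_gt0.
rewrite mem_filter => /andP[mk mh].
have {}xmin m' : m' \in msupp h -> m' != mk2 0 k ->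
    (m' 0%R * (k - m 1%R) <= m 0%R * (k - m' 1%R))%N.
  move=> m'h m'k; have := xmin (k - m' 1%R, - (m' 0%R)%:Z)%N.
  rewrite map_f ?mem_filter ?m'k // => /(_ isT) /=.
  by rewrite !mulNr lerN2 -!PoszM lez_nat.
have := hk1 m mh mk; have := hk1 m0 m0h m0k; have mE : (m 0%R + q.+2 * m 1%R < q.+2 * k)%N.
  by case: (hE m mh) => // mk'; rewrite mk' eqxx in mk.
have := xmin m0 m0h m0k.
set i := m 0%R in mE xmin *; set j := (k - m 1%R)%N in xmin *.
move=> x0 m01k m1k; have j0 : (0 < j)%N by rewrite subn_gt0.
have kE : k = (j + m 1%R)%N by rewrite subnK // ltnW.
have iq2 : (i < q.+2 * j)%N by move: mE; rewrite kE mulnDr ltn_add2r.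
have iq1 : (q.+1 * j < i)%N.
  have k0 : (0 < k - m0 1%R)%N by rewrite subn_gt0.
  rewrite -(ltn_pmul2r k0) (leq_trans _ x0) // mulnAC ltn_pmul2r //.
  by rewrite -(ltn_add2r (q.+1 * m0 1%R)%N) -mulnDr subnK // ltnW.
have i0 : (0 < i)%N by apply: leq_ltn_trans iq1.
pose d := gcdn i j; have d0 : (0 < d)%N by rewrite gcdn_gt0 i0.
pose p' := (j %/ d)%N; pose q' := (i %/ d)%N.
have jE : j = (p' * d)%N by rewrite divnK // dvdn_gcdr.
have iE : i = (q' * d)%N by rewrite divnK // dvdn_gcdl.
have p'0 : (0 < p')%N by move: j0; rewrite jE muln_gt0 => /andP[].
have pq'1 : (q.+1 * p' < q')%N by rewrite -(ltn_pmul2r d0) -mulnA -jE -iE.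
have pq'2 : (q' < q.+2 * p')%N by rewrite -(ltn_pmul2r d0) -mulnA -jE -iE.
have p'1 : (1 < p')%N.
  rewrite ltn_neqAle p'0 andbT eq_sym; apply/eqP => p'1.
  by move: pq'1; rewrite p'1 muln1 ltnNge -ltnS (leq_trans pq'2) // p'1 muln1.
have q'1 : (1 < q')%N by rewrite (leq_trans p'1) // ltnW // (leq_ltn_trans _ pq'1) // leq_pmull.
have pq' : coprime p' q'.
  rewrite /coprime -(eqn_pmul2r d0) muln_gcdl -jE -iE mul1n gcdnC; exact: eqxx.
have hE' m' : m' \in msupp h -> (p' * m' 0%R + q' * m' 1%R <= q' * k)%N.
  move=> m'h; have [->|m'k] := eqVneq m' (mk2 0 k); first by rewrite mk2_0 mk2_1 muln0.
  have := xmin m' m'h m'k; rewrite jE iE mulnA [X in (_ <= X)%N]mulnAC leq_pmul2r // mulnC.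
  by rewrite -(leq_add2r (q' * m' 1%R)%N) -mulnDr subnK // ltnW // hk1.
have [h'I h'k h'E] := lead_form_edge pq' p'0 (ltnW q'1) hI hE' hk.
have := @invariant_edge_no_cusp K p' q' k _ p'0 (ltnW q'1) pq' h'E h'k h'I p'1 q'1 m.
suff mh' : m \in msupp (lead_form p' q' (q' * k)%N h).
  by move=> /(_ mh') mi; move: i0; rewrite /i mi.
rewrite mcoeff_msupp mcoeff_lead_form mwt_nat eqz_nat ifT; first by rewrite -mcoeff_msupp.
by rewrite -[m 0%R]/i kE mulnDr eqn_add2r iE jE mulnCA.
Qed.

End Elementary.

Section Coordinates.
Local Open Scope ring_scope.
Variable K : closedFieldType.
Local Notation A := {mpoly K[2]}.
Implicit Types (f g u v : A) (m : 'X_{1..2}) (P : {poly K}).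

Lemma mdeg2 m : mdeg m = (m 0%R + m 1%R)%N.
Proof. by rewrite mdegE big_ord_recl big_ord1; congr (_ + m _)%N; apply/val_inj. Qed.

Lemma msize_leP d f : reflect (forall m, m \in msupp f -> m 0%R + m 1%R <= d)%N (msize f <= d.+1)%N.
Proof.
apply: (iffP idP) => [fd m mf|fd]; first by rewrite -mdeg2 -ltnS (leq_trans _ fd) // msize_mdeg_lt.
by rewrite msizeE; apply/bigmax_leqP_seq => m mf _; rewrite ltnS mdeg2 fd.
Qed.

Lemma is_lead_le (a b d : int) f : (forall m, m \in msupp f -> mwt a b m <= d) ->
  is_lead a b 0 d f%:P (lead_form a b d f)%:P.
Proof. exact: is_leadC. Qed.

Lemma subst_wt_le (p q d1 d2 d : nat) u v f :
  (forall m, m \in msupp u -> p * m 0%R + q * m 1%R <= d1)%N ->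
  (forall m, m \in msupp v -> p * m 0%R + q * m 1%R <= d2)%N ->
  (forall m, m \in msupp f -> d1 * m 0%R + d2 * m 1%R <= d)%N ->
  forall m, m \in msupp (subst u v f) -> (p * m 0%R + q * m 1%R <= d)%N.
Proof.
move=> Hu Hv Hf m; rewrite mcoeff_msupp -lez_nat -mwt_nat.
have Lu : forall m, m \in msupp u -> mwt p q m <= d1 by move=> m'; rewrite mwt_nat lez_nat;
  apply: Hu.
have Lv : forall m, m \in msupp v -> mwt p q m <= d2 by move=> m'; rewrite mwt_nat lez_nat;
  apply: Hv.
have Lf : forall m, m \in msupp f -> mwt d1 d2 m <= d by move=> m'; rewrite mwt_nat lez_nat;
  apply: Hf.
exact: (is_lead_subst (is_lead_le Lu) (is_lead_le Lv) Lf m).1.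
Qed.

Lemma msize_subst d u v f : (msize u <= d.+1)%N -> (msize v <= d.+1)%N ->
  forall e, (msize f <= e.+1)%N -> (msize (subst u v f) <= (d * e).+1)%N.
Proof.
move=> /msize_leP Hu /msize_leP Hv e /msize_leP Hf; apply/msize_leP => m.
rewrite -[m 0]mul1n -[m 1]mul1n => mf; apply: (subst_wt_le (f := f) _ _ _ mf) => m'.
- by rewrite !mul1n; apply: Hu.
- by rewrite !mul1n; apply: Hv.
- by move=> /Hf m'e; rewrite -mulnDr leq_mul2l m'e orbT.
Qed.

Lemma polX_of f : (forall m, m \in msupp f -> m 1 = 0%N) ->
  exists2 P, f = polX P & (size P <= msize f)%N.
Proof.
move=> f1; exists (\sum_(m <- msupp f) (f@_m)%:P * 'X^(m 0)); last first.
  apply: (leq_trans (size_sum _ _ _)); apply/bigmax_leqP_seq => m mf _.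
  rewrite mul_polyC (leq_trans (size_scale_leq _ _)) // size_polyXn.
  by rewrite (leq_trans _ (msize_mdeg_lt mf)) // ltnS mdeg2 leq_addr.
rewrite rmorph_sum {1}[f]mpolyE /=; apply: eq_big_seq => m /f1 m1.
rewrite rmorphM rmorphXn /= polXC polXX mul_mpolyC mpolyXn; congr (_ *: 'X_[_]).
by apply/mnmP => i; case: (ord2E i) => ->; rewrite mulmnE mnm1E /= ?mul1n ?mul0n.
Qed.

Definition uev (u v : {poly K}) : A -> {poly K} := mmap (@polyC K) (tnth [tuple u; v]).
HB.instance Definition _ a b := GRing.RMorphism.on (uev a b).

Lemma uevX0 a b : uev a b 'X_0 = a. Proof. by rewrite /uev mmapX mmap1U. Qed.
Lemma uevX1 a b : uev a b 'X_1 = b. Proof. by rewrite /uev mmapX mmap1U. Qed.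
Lemma uevMP a b c : uev a b c%:MP = c%:P. Proof. by rewrite /uev mmapC. Qed.

Lemma uev_polX a b P X Y : uev a b (subst X Y (polX P)) = P \Po uev a b X.
Proof.
elim/poly_ind: P => [|P c IHP]; first by rewrite !rmorph0.
rewrite !rmorphD !rmorphM /= IHP polXC polXX substX0 substMP uevMP.
by rewrite ?comp_polyD ?comp_polyM comp_polyX comp_polyC.
Qed.

Lemma coordinate_polX P g : aut2 (polX P) g -> (size P <= 2)%N.
Proof.
move=> [X [Y [_ _ PE _]]]; have := congr1 (fun h => size (uev 'X 0 h)) PE.
rewrite /= uev_polX uevX0 size_polyX => E.
have := size_comp_poly P (uev 'X 0 X); rewrite E /= => /esym/eqP.
by rewrite muln_eq1 => /andP[]; case: (size P) => [|[|[]]].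
Qed.

End Coordinates.

Section Mates.
Local Open Scope ring_scope.
Variable K : closedFieldType.
Local Notation A := {mpoly K[2]}.
Implicit Types (f g h u v : A) (m : 'X_{1..2}) (P : {poly K}).

Lemma lex_lead h : h != 0 -> exists2 m, m \in msupp h &
  forall m', m' \in msupp h -> m' != m -> (m' 1%R < m 1%R)%N \/ m' 1 = m 1 /\ (m' 0%R < m 0%R)%N.
Proof.
move=> h0; pose wt m := (m 0%R + msize h * m 1%R)%N.
have [||x /mapP[m mh ->] xmin] := @exists_min_slope [seq (1%N, - (wt m)%:Z) | m <- msupp h].
- by apply: contra h0 => /eqP H; apply/eqP/msuppnil0; case: (msupp h) H.
- by move=> x /mapP[m _ ->].
exists m => // m' m'h m'm.
have m0h m1 : m1 \in msupp h -> (m1 0%R < msize h)%N.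
  by move=> /msize_mdeg_lt; rewrite mdeg2; apply: leq_ltn_trans; apply: leq_addr.
have := xmin _ (map_f _ m'h); rewrite /= !mulr1 lerN2 lez_nat /wt => wt_le.
have [m1|m1|m1] := ltngtP (m' 1) (m 1); first by left.
  exfalso; move: wt_le; rewrite leqNgt => /negP; apply.
  apply: (@leq_trans (msize h * (m 1%R).+1)); last by rewrite (leq_trans _ (leq_addl _ _)) //
    leq_mul2l m1 orbT.
  by rewrite mulnS ltn_add2r m0h.
right; split=> //; move: wt_le; rewrite m1 leq_add2r leq_eqVlt => /orP[/eqP m0|//].
by case/eqP: m'm; rewrite -(mk2_eta m') m0 m1 mk2_eta.
Qed.

Lemma lex_lead_form h m (Q : nat) : (msize h <= Q)%N -> m \in msupp h ->
  (forall m', m' \in msupp h -> m' != m -> (m' 1%R < m 1%R)%N \/ m' 1 = m 1 /\ (m' 0%R < m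
    0%R)%N) ->
  (forall m', m' \in msupp h -> m' 0%R + Q * m' 1%R <= m 0%R + Q * m 1%R)%N /\
  lead_form 1%N Q (m 0%R + Q * m 1%R)%N h = h@_m *: 'X_[m].
Proof.
move=> hQ mh mlead.
have lt m' : m' \in msupp h -> m' != m -> (m' 0%R + Q * m' 1%R < m 0%R + Q * m 1%R)%N.
  move=> m'h m'm; case: (mlead m' m'h m'm) => [m1|[-> m0]]; last by rewrite ltn_add2r.
  apply: (@leq_trans (Q * (m' 1%R).+1)); last by rewrite (leq_trans _ (leq_addl _ _)) //
    leq_mul2l m1 orbT.
  rewrite mulnS ltn_add2r (leq_trans _ hQ) //.
  by apply: leq_ltn_trans (msize_mdeg_lt m'h); rewrite mdeg2 leq_addr.
split=> [m' m'h|].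
  by have [->//|m'm] := eqVneq m' m; apply/ltnW/lt.
apply/mpolyP => m'; rewrite mcoeff_lead_form mcoeffZ mcoeffX mwt_nat mul1n eqz_nat.
have [->|m'm] := eqVneq m m'; first by rewrite eqxx mulr1.
rewrite mulr0; case: eqP => // wtE; apply/eqP; rewrite mcoeff_eq0.
by apply/negP => m'h; have := lt m' m'h; rewrite eq_sym m'm wtE ltnn => /(_ isT).
Qed.

Lemma subst_monomial u v m : subst u v 'X_[m] = u ^+ m 0 * v ^+ m 1.
Proof.
rewrite mpolyXE_id rmorph_prod big_ord_recl big_ord1 /= !rmorphXn /=.
by rewrite (_ : lift ord0 ord0 = 1) ?substX0 ?substX1 //; apply/val_inj.
Qed.

Lemma aut2_X0 g : aut2 'X_0 g -> exists a P, a != 0 /\ g = a%:MP * 'X_1 + polX P.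
Proof.
move=> [X [Y [_ gY XE]]]; rewrite substX0 in XE; rewrite XE => Yg {X XE}.
have neq0 h u v : subst u v h = 'X_1 -> h != 0.
  move=> hE; apply: contra_eq_neq hE => ->; rewrite rmorph0 eq_sym.
  by rewrite -msize_poly_eq0 msizeX.
have g0 := neq0 _ _ _ Yg; have Y0 := neq0 _ _ _ gY.
have [m mg mlead] := lex_lead g0; have [n nY nlead] := lex_lead Y0.
have n1 : (0 < n 1%R)%N.
  rewrite lt0n; apply/eqP => n10.
  have [P PE _] : exists2 P, Y = polX P & (size P <= msize Y)%N.
    apply: polX_of => n' n'Y; have [->//|n'n] := eqVneq n' n.
    by case: (nlead n' n'Y n'n) => [|[-> _ //]]; rewrite n10.
  have := congr1 (subst 'X_0 0) Yg; rewrite substX1 subst_comp substX0 PE subst_polX -PE Yg.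
  by move=> /eqP; rewrite -msize_poly_eq0 msizeX.
pose Q := (msize g + msize Y)%N; pose Q' := (n 0%R + Q * n 1%R)%N.
have [Yle Ylead] := lex_lead_form (leq_addl _ _ : msize Y <= Q)%N nY nlead.
have gQ' : (msize g <= Q')%N.
  by rewrite (leq_trans (leq_addr (msize Y) _)) // (leq_trans _ (leq_addl _ _)) // leq_pmulr.
have [gle glead] := lex_lead_form gQ' mg mlead.
have LX : is_lead 1%N Q 0 1%N ('X_0)%:P ('X_0 : A)%:P.
  by apply: is_lead_homog => m'; rewrite msuppX inE => /eqP->; rewrite mwt_nat !mnm1E /= muln0.
have LY : is_lead 1%N Q 0 Q' Y%:P (Y@_n *: 'X_[n])%:P.
  by rewrite -Ylead; apply: is_leadC => m' /Yle; rewrite mwt_nat mul1n lez_nat.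
have Lg m' : m' \in msupp g -> mwt 1%N Q' m' <= (m 0%R + Q' * m 1%R)%N.
  by move=> /gle; rewrite mwt_nat mul1n lez_nat.
pose mm := mk2 (m 0%R + n 0%R * m 1%R) (n 1%R * m 1%R).
have := (is_lead_subst LX LY Lg mm).2; rewrite glead Yg.
have -> : subst 'X_0 (Y@_n *: 'X_[n]) (g@_m *: 'X_[m]) = (g@_m * Y@_n ^+ m 1) *: 'X_[mm] :> A.
  rewrite linearZ /= subst_monomial exprZn !mpolyXn -scalerAr -mpolyXD scalerA; congr (_ *: 'X_[_]).
  by apply/mnmP => i; case: (ord2E i) => ->; rewrite mnmDE !mulmnE mnm1E /= ?mk2_0 ?mk2_1 ?mul1n
    ?mul0n.
rewrite mcoeffZ !mcoeffX eqxx mulr1 => E.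
have cn0 : g@_m * Y@_n ^+ m 1 != 0 by rewrite mulf_neq0 ?expf_neq0 // -mcoeff_msupp.
have [mmE|mmE] := eqVneq U_(1%R)%MM mm; last first.
  by case/eqP: cn0; rewrite E (negPf mmE) if_same.
have := congr1 (fun m : 'X_{1..2} => m 0) mmE; have := congr1 (fun m : 'X_{1..2} => m 1) mmE.
rewrite /= !mk2_0 !mk2_1 !mnm1E /= => /esym/eqP; rewrite muln_eq1 => /andP[_ /eqP m1].
move=> /esym/eqP; rewrite addn_eq0 => /andP[/eqP m0 _].
exists g@_m; have [|P PE _] := @polX_of K (g - (g@_m)%:MP * 'X_1).
  move=> m'; rewrite mcoeff_msupp mcoeffB mul_mpolyC mcoeffZ mcoeffX.
  have mU : U_(1%R)%MM = m by apply/mnmP => i; case: (ord2E i) => ->; rewrite mnm1E ?m0 ?m1.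
  have [<-|m'm] := eqVneq U_(1%R)%MM m'; first by rewrite {1}mU mulr1 subrr eqxx.
  rewrite mulr0 subr0 -mcoeff_msupp => m'g.
  have [|m'1|[_]] := mlead m' m'g; first by rewrite -mU eq_sym.
    by move: m'1; rewrite m1; case: (m' 1).
  by rewrite m0.
exists P; split; first by rewrite -mcoeff_msupp.
by rewrite -PE addrC subrK.
Qed.

Lemma subst_polXE u v P : subst u v (polX P) = (map_poly (@mpolyC 2 K) P).[u].
Proof.
rewrite /polX /= /horner_eval -horner_map /= substX0 -map_poly_comp; congr _.[_].
by apply: eq_map_poly => c /=; rewrite substMP.
Qed.

Lemma aut2_mates f g g' : aut2 f g -> aut2 f g' ->
  exists a P, a != 0 /\ g' = a%:MP * g + subst f 0 (polX P).
Proof.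
move=> fg fg'; have [X [Y [XE YE fE gE]]] := fg.
have XY : aut2 X Y by exists f, g; split.
have := aut2_comp fg' XY; rewrite fE => /aut2_X0[a [P [a0 PE]]]; exists a, P; split=> //.
have -> : g' = subst f g (subst X Y g') by rewrite subst_comp XE YE subst_id.
rewrite PE rmorphD rmorphM /= substMP substX1; congr (_ + _).
by rewrite !subst_polXE.
Qed.

End Mates.

Section LinearChange.
Local Open Scope ring_scope.
Variable K : closedFieldType.
Local Notation A := {mpoly K[2]}.
Implicit Types (f g h u v : A) (m : 'X_{1..2}) (P : {poly K}).

Definition lin (o : option K) : A * A :=
  if o is Some s then ('X_0 + s%:MP * 'X_1, 'X_1) else ('X_1, 'X_0).

Definition lsubst o : A -> A := subst (lin o).1 (lin o).2.
HB.instance Definition _ o := GRing.RMorphism.on (lsubst o).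

Lemma lsubstK o : cancel (lsubst (omap -%R o)) (lsubst o).
Proof.
move=> f; rewrite /lsubst subst_comp; case: o => [s|] /=; last by rewrite substX0 substX1 subst_id.
rewrite rmorphD rmorphM /= substMP substX0 substX1 mpolyCN mulNr addrK.
exact: subst_id.
Qed.

Lemma lsubstNK o : cancel (lsubst o) (lsubst (omap -%R o)).
Proof.
have E : omap -%R (omap -%R o) = o by case: o => //= s; rewrite opprK.
by move=> f; have := lsubstK (omap -%R o) f; rewrite E.
Qed.

Lemma aut2_lin o : aut2 (lin o).1 (lin o).2.
Proof.
exists (lin (omap -%R o)).1, (lin (omap -%R o)).2.
have := lsubstNK o; have := lsubstK o => H1 H2.
have := H2 'X_0; have := H2 'X_1; have := H1 'X_0; have := H1 'X_1.
by rewrite /lsubst !substX0 !substX1 => *; split.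
Qed.

Lemma aut2_lsubst o f g : aut2 f g -> aut2 (lsubst o f) (lsubst o g).
Proof. by move=> fg; apply: aut2_comp fg (aut2_lin o). Qed.

Lemma msize_lsubst o f : msize (lsubst o f) = msize f.
Proof.
have le o' h : (msize (lsubst o' h) <= msize h)%N.
  case E : (msize h) => [|e].
    by move/eqP: E; rewrite msize_poly_eq0 => /eqP->; rewrite rmorph0 msize0.
  rewrite -[e]mul1n; apply: msize_subst; rewrite ?E //.
    case: o' => [s|] /=; rewrite ?msizeX ?mdeg1 //.
    rewrite (leq_trans (msizeD_le _ _)) // geq_max msizeX mdeg1 mul_mpolyC /=.
    by rewrite (leq_trans (msizeZ_le _ _)) // msizeX mdeg1.
  by case: o' => [s|] /=; rewrite msizeX mdeg1.
by apply/eqP; rewrite eqn_leq le -{1}(lsubstNK o f) le.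
Qed.

Lemma uevE (a b : {poly K}) f :
  uev a b f = \sum_(m <- msupp f) (f@_m)%:P * (a ^+ m 0 * b ^+ m 1).
Proof.
rewrite /uev /mmap; apply: eq_bigr => m _; congr (_ * _).
by rewrite /mmap1 big_ord_recl big_ord1 /= (_ : lift ord0 ord0 = 1) //; apply/val_inj.
Qed.

Lemma uev_subst (a b : {poly K}) u v f : uev a b (subst u v f) = uev (uev a b u) (uev a b v) f.
Proof.
apply: (eq_mpoly_rmorph (F := uev a b \o subst u v)) => [c|i] /=.
  by rewrite substMP !uevMP.
by case: (ord2E i) => ->; rewrite ?uevX0 ?uevX1 ?substX0 ?substX1.
Qed.

Lemma sum_msupp_delta f (m0 : 'X_{1..2}) (D : pred 'X_{1..2}) (F : 'X_{1..2} -> K) :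
  (forall m, D m -> F m = (m == m0)%:R) -> D m0 ->
  \sum_(m <- msupp f | D m) f@_m * F m = f@_m0.
Proof.
move=> FE Dm0; transitivity (\sum_(m <- msupp f | D m && (m == m0)) f@_m).
  by rewrite big_mkcondr; apply: eq_bigr => m /FE->; case: eqP; rewrite ?mulr1 ?mulr0.
have [mf|mf] := boolP (m0 \in msupp f).
  rewrite (big_rem m0) //= Dm0 eqxx /= big1_seq ?addr0 // => i /andP[/andP[_ /eqP->]].
  by rewrite mem_rem_uniq ?msupp_uniq // inE eqxx.
rewrite (memN_msupp_eq0 mf) big1 // => i /andP[_ /eqP->].
exact: memN_msupp_eq0.
Qed.

Lemma eq_mk2 m i j : (m == mk2 i j) = (m 0 == i) && (m 1 == j).
Proof.
apply/eqP/andP => [->|[/eqP<- /eqP<-]]; last by rewrite mk2_eta.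
by rewrite mk2_0 mk2_1.
Qed.

Lemma coef_uev_0X f n : (uev 0 'X f)`_n = f@_(mk2 0 n).
Proof.
rewrite uevE coef_sum; under eq_bigr do rewrite coefCM.
apply: (@sum_msupp_delta f (mk2 0 n) xpredT) => // m _; rewrite eq_mk2.
by rewrite expr0n; case: eqP; rewrite ?mul0r ?coef0 ?mul1r ?coefXn //= eq_sym.
Qed.

Lemma coef_uev_X0 f n : (uev 'X 0 f)`_n = f@_(mk2 n 0).
Proof.
rewrite uevE coef_sum; under eq_bigr do rewrite coefCM.
apply: (@sum_msupp_delta f (mk2 n 0) xpredT) => // m _; rewrite eq_mk2.
by rewrite expr0n andbC; case: eqP; rewrite ?mulr0 ?coef0 ?mulr1 ?coefXn //= eq_sym.
Qed.

(* A root [s] of [f(s, 1)], [f] replaced by its part of degree [n], gives the shear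
   ['X_0 + s 'X_1] that kills ['X_1 ^ n]; without one, that part is [c 'X_1 ^ n], and exchanging
   the variables kills it. *)
Lemma kill_pure_power f n : (0 < n)%N -> exists o, (lsubst o f)@_(mk2 0 n) = 0.
Proof.
move=> n0; pose D m := (m 0%R + m 1%R == n)%N.
pose psi : {poly K} := \sum_(m <- msupp f | D m) (f@_m)%:P * 'X^(m 0).
have [/closed_rootP[s /rootP ps]|/negPn/eqP ps] := boolP (size psi != 1).
  exists (Some s); rewrite -coef_uev_0X uev_subst /= rmorphD rmorphM /= uevX0 uevX1 uevMP add0r.
  rewrite uevE coef_sum -[RHS]ps /psi horner_sum [RHS]big_mkcond; apply: eq_bigr => m _.
  rewrite coefCM hornerCM hornerXn exprMn -mulrA -exprD -rmorphXn coefCM coefXn eq_sym /D.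
  by case: eqP; rewrite ?mulr1 ?mulr0.
exists None; rewrite -coef_uev_0X uev_subst /= uevX0 uevX1 coef_uev_X0.
have : psi`_n = 0 by rewrite nth_default // ps.
rewrite /psi coef_sum; under eq_bigr do rewrite coefCM.
move=> <-; apply/esym; apply: sum_msupp_delta; last by rewrite /D mk2_0 mk2_1 addn0.
move=> m /eqP <-; rewrite coefXn eq_mk2 [m 0 == _]eq_sym.
case: (m 1) => [|k]; rewrite ?addn0 ?eqxx // andbF.
by rewrite -[X in _ == X]addn0 eqn_add2l.
Qed.

End LinearChange.

Section Structure.
Local Open Scope ring_scope.
Variable K : closedFieldType.
Local Notation A := {mpoly K[2]}.
Implicit Types (f g h u v : A) (m : 'X_{1..2}) (P : {poly K}).

Lemma msize_polX P : (msize (polX P) <= size P)%N.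
Proof.
have -> : P = \sum_(i < size P) (P`_i)%:P * 'X^i.
  by rewrite -{1}[P]coefK poly_def; apply: eq_bigr => i _; rewrite mul_polyC.
rewrite rmorph_sum /=; apply: (leq_trans (msize_sum _ _ _)); apply/bigmax_leqP => i _.
rewrite rmorphM rmorphXn /= polXC polXX mul_mpolyC (leq_trans (msizeZ_le _ _)) //.
rewrite mpolyXn msizeX mdegMn mdeg1 mul1n.
rewrite -(_ : P = \sum_(i < size P) (P`_i)%:P * 'X^i) //.
by rewrite -{1}[P]coefK poly_def; apply: eq_bigr => j _; rewrite mul_polyC.
Qed.

Lemma mcoeff_polX P i : (polX P)@_(mk2 i 0) = P`_i.
Proof.
by rewrite -coef_uev_X0 -(subst_id (polX P)) uev_polX uevX0 comp_polyXr.
Qed.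

Lemma msize_shear_power f P k : (forall m, m \in msupp f -> m 0%R + m 1%R <= k)%N ->
  f@_(mk2 0 k) != 0 -> (2 < size P)%N -> msize (shear P f) = ((size P).-1 * k).+1.
Proof.
move=> fk f0; case E : (size P) => [|[|[|d]]] // _; set D := d.+2.
have P0 : P`_D != 0.
  have -> : D = (size P).-1 by rewrite E.
  by rewrite -lead_coefE lead_coef_eq0 -size_poly_eq0 E.
have f1D m : m \in msupp f -> (1 * m 0%R + D * m 1%R <= D * k)%N /\
    (1 * m 0%R + D * m 1%R = D * k -> m = mk2 0 k)%N.
  move=> /fk mk; rewrite mul1n; have -> : (m 0%R + D * m 1%R = m 0%R + m 1%R + d.+1 * m 1%R)%N.
    by rewrite -addnA -mulSn.
  have m1k : (m 1%R <= k)%N by apply: leq_trans mk; apply: leq_addl.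
  rewrite [(D * k)%N]mulSn; split; first by rewrite leq_add // leq_mul2l m1k orbT.
  move=> wE; have m1E : m 1 = k.
    apply/eqP; rewrite eqn_leq m1k /= -(leq_pmul2l (isT : 0 < d.+1)%N).
    by rewrite -(leq_add2l k) -wE leq_add2r.
  by apply/eqP; rewrite eq_mk2 m1E eqxx andbT -(eqn_add2r (k + d.+1 * k)) addnA -{1}m1E -{1}m1E wE.
have vD : (msize ('X_1 + polX P)%R <= D.+1)%N.
  rewrite (leq_trans (msizeD_le _ _)) // geq_max msizeX mdeg1 /=.
  by rewrite (leq_trans (msize_polX P)) // E.
apply/eqP; rewrite eqn_leq; apply/andP; split.
  apply/msize_leP => m; rewrite -[m 0]mul1n -[m 1]mul1n => mf.
  apply: (subst_wt_le (f := f) (d1 := 1) (d2 := D) _ _ _ mf) => m'; last by move=> /f1D[].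
    by rewrite msuppX inE => /eqP->; rewrite !mnm1E.
  by rewrite !mul1n; move: m'; apply/msize_leP.
pose v := lead_form 1%N 1%N D ('X_1 + polX P : A).
have LX : is_lead 1%N 1%N 0 1%N ('X_0)%:P ('X_0 : A)%:P.
  by apply: is_lead_homog => m; rewrite msuppX inE => /eqP->; rewrite mwt_nat !mnm1E.
have LY : is_lead 1%N 1%N 0 D ('X_1 + polX P)%:P v%:P.
  by apply: is_leadC => m mv; rewrite mwt_nat lez_nat !mul1n; apply: (msize_leP _ _ vD).
have Lf m : m \in msupp f -> mwt 1%N D m <= (D * k)%N.
  by move=> /f1D[+ _]; rewrite mwt_nat lez_nat.
have L := is_lead_subst LX LY Lf.
have v0 : v != 0.
  apply: contraNneq P0 => v0; have := mcoeff_lead_form 1%N 1%N D ('X_1 + polX P : A) (mk2 D 0).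
  rewrite -/v v0 mcoeff0 mwt_nat mk2_0 mk2_1 !mul1n addn0 eqxx mcoeffD mcoeff_polX mcoeffX eq_mk2.
  by rewrite mnm1E add0r => <-.
have fE : lead_form 1%N D (D * k)%N f = f@_(mk2 0 k) *: 'X_[mk2 0 k].
  apply/mpolyP => m; rewrite mcoeff_lead_form mcoeffZ mcoeffX mwt_nat eqz_nat.
  have [<-|mk] := eqVneq (mk2 0 k) m; first by rewrite mk2_0 mk2_1 muln0 eqxx mulr1.
  rewrite mulr0; case: eqP => // wE; apply/eqP; rewrite mcoeff_eq0; apply/negP.
  by move=> /f1D[_ /(_ wE)] mE; rewrite mE eqxx in mk.
have : f@_(mk2 0 k) *: v ^+ k != 0.
  by rewrite -mul_mpolyC mulf_neq0 ?mpolyC_eq0 ?expf_neq0.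
have -> : f@_(mk2 0 k) *: v ^+ k = subst 'X_0 v (lead_form 1%N D (D * k)%N f).
  by rewrite fE linearZ /= subst_monomial mk2_0 mk2_1 expr0 mul1r.
move: (subst 'X_0 v _) L => w L w0; have := mlead_supp w0; rewrite mcoeff_msupp (L _).2.
have [wE|_] := eqVneq (mwt 1%N 1%N (mlead w)) (D * k)%N; last by rewrite eqxx.
rewrite -mcoeff_msupp => /msize_mdeg_lt; rewrite mdeg2; move: wE.
by rewrite mwt_nat !mul1n => /eqP; rewrite eqz_nat => /eqP->.
Qed.

Lemma coordinate_step f g n : aut2 f g -> msize f = n.+1 -> (2 <= n)%N ->
  exists o P d k f1 g1, [/\ n = (d * k)%N, (2 <= d)%N, (0 < k)%N & (size P <= d.-1)%N] /\
   [/\ aut2 f1 g1, msize f1 = k.+1, f = lsubst o (shear ('X^2 * P) f1) &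
     g = lsubst o (shear ('X^2 * P) g1)].
Proof.
move=> fg fn n2; have [o0 F0] := kill_pure_power f (ltnW n2).
set F := lsubst o0 f in F0; set G := lsubst o0 g.
have FG : aut2 F G := aut2_lsubst o0 fg.
have Fn : msize F = n.+1 by rewrite msize_lsubst.
have Fneq0 : F != 0 by rewrite -msize_poly_eq0 Fn.
have [m mF mlead] := lex_lead Fneq0.
have [Fle Flead] := lex_lead_form (leqnn _) mF mlead; rewrite Fn in Fle Flead.
have m01 : m 0 = 0%N \/ m 1 = 0%N.
  apply: (@invariant_monomial K F@_m); first by rewrite -mcoeff_msupp.
  rewrite -Flead; apply: lead_form_invariant (aut2_invariant FG) => m'.
  by rewrite mwt_nat lez_nat mul1n; apply: Fle.
have [m1|m1] := posnP (m 1).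
  have [|r FE _] := @polX_of K F.
    move=> m' m'F; have [->//|m'm] := eqVneq m' m.
    by case: (mlead m' m'F m'm) => [|[-> _//]]; rewrite m1.
  have := msize_polX r; rewrite -FE Fn ltnNge (leq_trans _ n2) //.
  by rewrite FE in FG; apply: coordinate_polX FG.
have m0 : m 0 = 0%N by case: m01 => // m10; rewrite m10 in m1.
have mE : m = mk2 0 (m 1) by apply/eqP; rewrite eq_mk2 m0 !eqxx.
move: m1 mE Fle; set k := m 1%R => k0 mE Fle.
have Fk : F@_(mk2 0 k) != 0 by rewrite -mE -mcoeff_msupp.
have kn : (k < n)%N.
  rewrite ltn_neqAle; apply/andP; split; first by apply: contraNneq Fk => ->; rewrite F0.
  by move: (msize_mdeg_lt mF); rewrite Fn mdeg2 m0.
have [|P [f1k f1E]] := shear_reduce (ltn0Sn n) (ex_intro _ G FG) _ Fk.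
  by move=> m' /Fle; rewrite m0.
set f1 := shear _ F in f1k f1E.
have FE : F = shear ('X^2 * - P) f1 by rewrite mulrN shearK.
have GE : G = shear ('X^2 * - P) (shear ('X^2 * P) G) by rewrite mulrN shearK.
have P0 : P != 0.
  apply: contraTneq kn => P0; move: FE; rewrite P0 oppr0 mulr0 shear0 => FE.
  by rewrite -leqNgt -ltnS -Fn FE; apply/msize_leP.
have sP : size ('X^2 * - P) = (size P).+2.
  by rewrite mulrC size_mulXn ?size_polyN // oppr_eq0.
have sP0 : (0 < size P)%N by rewrite size_poly_gt0.
exists (omap -%R o0), (- P), (size P).+1, k, f1, (shear ('X^2 * P) G); split; split.
- have := msize_shear_power f1E f1k (P := 'X^2 * - P); rewrite sP ltnS => /(_ sP0) /=.
  by rewrite -FE Fn => -[].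
- by rewrite ltnS.
- exact: k0.
- by rewrite size_polyN.
- exact: aut2_shear.
- apply/eqP; rewrite eqn_leq; apply/andP; split; first exact/msize_leP.
  have : mk2 0 k \in msupp f1 by rewrite mcoeff_msupp.
  by move=> /msize_mdeg_lt; rewrite mdeg2 mk2_0 mk2_1.
- by rewrite -FE lsubstNK.
- by rewrite -GE lsubstNK.
Qed.

End Structure.

Section Jung.
Local Open Scope ring_scope.
Variable K : closedFieldType.
Local Notation A := {mpoly K[2]}.
Implicit Types (f g h u v : A) (m : 'X_{1..2}) (P r : {poly K}).

Definition step (o : option K) P : A -> A := lsubst o \o shear ('X^2 * P).
HB.instance Definition _ o P := GRing.RMorphism.on (step o P).

Lemma msize_shear d P f e : (size P <= d.+1)%N -> (1 <= d)%N -> (msize f <= e.+1)%N ->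
  (msize (shear P f) <= (d * e).+1)%N.
Proof.
move=> Pd d1; apply: msize_subst; first by rewrite msizeX mdeg1.
rewrite (leq_trans (msizeD_le _ _)) // geq_max msizeX mdeg1 ltnS d1 /=.
exact: leq_trans (msize_polX P) Pd.
Qed.

Lemma size_X2M P d : (1 < d)%N -> (size P <= d.-1)%N -> (size ('X^2 * P)%R <= d.+1)%N.
Proof.
case: d => [|d] //= _ Pd; rewrite (leq_trans (size_polyMleq _ _)) // size_polyXn.
by rewrite !addSn /= !ltnS.
Qed.

Lemma msize_step d o P f e : (1 < d)%N -> (size P <= d.-1)%N -> (msize f <= e.+1)%N ->
  (msize (step o P f) <= (d * e).+1)%N.
Proof.
by move=> d1 Pd fe; rewrite msize_lsubst msize_shear ?(ltnW d1) // size_X2M.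
Qed.

Lemma msize_horner_ge f n r : msize f = n.+1 -> (0 < n)%N -> r != 0 ->
  ((size r).-1 * n < msize (subst f 0 (polX r)))%N.
Proof.
move=> fn n0; elim/poly_ind: r => [|r c IHr] rc; first by rewrite eqxx in rc.
rewrite rmorphD rmorphM rmorphD rmorphM /= polXC polXX substX0 substMP.
have [r0|r0] := eqVneq r 0.
  move: rc; rewrite r0 mul0r add0r polyC_eq0 => c0.
  by rewrite !rmorph0 mul0r add0r size_polyC c0 mul0n msizeC c0.
have {}IHr := IHr r0; have rf0 : subst f 0 (polX r) != 0.
  by rewrite -msize_poly_eq0 -lt0n (leq_ltn_trans _ IHr).
have f0 : f != 0 by rewrite -msize_poly_eq0 fn.
have sr : (size (r * 'X + c%:P)).-1 = size r by rewrite size_MXaddC (negPf r0).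
rewrite sr; set w := subst f 0 (polX r) * f; move: IHr => IHr.
have sw : (size r * n < msize w)%N.
  rewrite msizeM // fn addnS /= -[X in (X * n)%N](prednK (_ : 0 < size r)%N) ?size_poly_gt0 //.
  by rewrite mulSn addnC ltn_add2r.
have w1 : (1 < msize w)%N.
  by apply: leq_ltn_trans sw; rewrite muln_gt0 n0 size_poly_gt0 r0.
rewrite (leq_trans sw) // leqNgt; apply/negP => wc.
have := msizeD_le (w + c%:MP) (- c%:MP); rewrite addrK msizeN msizeC leqNgt => /negP; apply.
by rewrite gtn_max wc (leq_ltn_trans _ w1) // leq_b1.
Qed.

Lemma affine_coordinate f g : aut2 f g -> msize f = 2 ->
  exists o a c, a != 0 /\ f = lsubst o (a%:MP * 'X_0 + c%:MP).
Proof.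
move=> fg f2; have [o0 F0] := kill_pure_power f (ltn0Sn 0).
set F := lsubst o0 f in F0; have F2 : msize F = 2 by rewrite msize_lsubst.
have [|r FE rF] := @polX_of K F.
  move=> m mF; have := msize_mdeg_lt mF; rewrite F2 mdeg2 ltnS.
  case E : (m 1) => [|[|j]] // m1; last by move: m1; rewrite !addnS.
  have mE : m = mk2 0 1.
    apply/eqP; rewrite eq_mk2 E eqxx andbT -leqn0.
    by rewrite -(leq_add2r 1) add0n.
  by move: mF; rewrite mE mcoeff_msupp F0 eqxx.
have rE : r = (r`_1)%:P * 'X + (r`_0)%:P.
  apply/polyP => -[|[|i]]; rewrite coefD coefMX !coefC ?add0r ?addr0 //=.
  by rewrite nth_default ?addr0 // (leq_trans rF) // F2.
exists (omap -%R o0), r`_1, r`_0; split; last first.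
  have <- : polX r = (r`_1)%:MP * 'X_0 + (r`_0)%:MP.
    by rewrite {1}rE rmorphD rmorphM /= !polXC polXX.
  by rewrite -FE lsubstNK.
apply/eqP => r1; move: F2; rewrite FE rE r1 polyC0 mul0r add0r polXC msizeC.
by case: (_ != 0).
Qed.

Lemma good_mate n f g : aut2 f g -> msize f = n.+1 -> (0 < n)%N ->
  exists2 g', aut2 f g' & (msize g' <= n.+1)%N.
Proof.
elim/ltn_ind: n f g => n IHn f g fg fn n0.
have [n1|n2] := leqP n 1.
  have {}n1 : n = 1%N by apply/eqP; rewrite eqn_leq n1.
  rewrite n1 in fn; have [o [a [c [a0 ->]]]] := affine_coordinate fg fn.
  exists (lsubst o 'X_1); last by rewrite msize_lsubst msizeX mdeg1 n1.
  apply: aut2_lsubst; exists (a^-1%:MP * ('X_0 - c%:MP)), 'X_1.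
  have aK : a^-1%:MP * a%:MP = 1 :> A by rewrite -mpolyCM mulVf.
  have aK' : a%:MP * a^-1%:MP = 1 :> A by rewrite -mpolyCM mulfV.
  split; rewrite ?substX1 //.
    by rewrite rmorphM rmorphB /= !substMP substX0 addrK mulrA aK mul1r.
  by rewrite rmorphD rmorphM /= !substMP substX0 mulrA aK' mul1r subrK.
have [o [P [d [k [f1 [g1 [[nE d2 k0 Pd] [fg1 f1k fE gE]]]]]]]] := coordinate_step fg fn n2.
have kn : (k < n)%N by rewrite nE -{1}[k]mul1n ltn_pmul2r.
have [g' fg' g'k] := IHn k kn f1 g1 fg1 f1k k0.
exists (step o P g'); first by rewrite fE; apply: aut2_lsubst; apply: aut2_shear.
by rewrite nE msize_step.
Qed.

Lemma jung_step n f g : aut2 f g -> msize f = n.+1 -> (msize g <= n.+1)%N -> (1 < n)%N ->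
  exists o P d k f1 g1, [/\ n = (d * k)%N, (2 <= d)%N, (0 < k)%N & (size P <= d.-1)%N] /\
   [/\ aut2 f1 g1, maxn (msize f1) (msize g1) = k.+1, f = step o P f1 & g = step o P g1].
Proof.
move=> fg fn gn n2.
have [o [P [d [k [f1 [g1 [[nE d2 k0 Pd] [fg1 f1k fE gE]]]]]]]] := coordinate_step fg fn n2.
exists o, P, d, k, f1, g1; split; first by split.
split; [exact: fg1| |exact: fE|exact: gE].
rewrite f1k; apply/maxn_idPl; have [g2 fg2 g2k] := good_mate fg1 f1k k0.
have [a [r [a0 g1E]]] := aut2_mates fg2 fg1.
have rE : subst f 0 (polX r) = g - a%:MP * step o P g2.
  rewrite gE -[lsubst o _]/(step o P g1) g1E rmorphD rmorphM /=.
  rewrite {1}/step /= {1}/shear substMP {1}/lsubst substMP addrAC subrr add0r.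
  by rewrite /step /= /lsubst /shear !subst_comp !subst_polXE fE /lsubst /shear subst_comp.
have r2 : (size r <= 2)%N.
  have [->|r0] := eqVneq r 0; first by rewrite size_poly0.
  have := msize_horner_ge fn (ltnW n2) r0; rewrite rE => rn.
  have : (msize (g - a%:MP * step o P g2) <= n.+1)%N.
    rewrite (leq_trans (msizeD_le _ _)) // geq_max gn msizeN mul_mpolyC.
    by rewrite (leq_trans (msizeZ_le _ _)) // nE msize_step.
  move=> /(leq_trans rn); rewrite ltnS -{2}[n]mul1n leq_pmul2r ?(ltnW n2) //.
  by case: (size r).
rewrite g1E (leq_trans (msizeD_le _ _)) // geq_max; apply/andP; split.
  by rewrite mul_mpolyC (leq_trans (msizeZ_le _ _)).
have -> : r = (r`_1)%:P * 'X + (r`_0)%:P.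
  apply/polyP => -[|[|i]]; rewrite coefD coefMX !coefC ?add0r ?addr0 //=.
  by rewrite nth_default ?addr0 // (leq_trans r2).
rewrite rmorphD rmorphM /= !polXC polXX rmorphD rmorphM /= !substMP substX0.
rewrite (leq_trans (msizeD_le _ _)) // geq_max mul_mpolyC (leq_trans (msizeZ_le _ _)) ?f1k //=.
by rewrite msizeC (leq_trans (leq_b1 _)).
Qed.

End Jung.

Section InverseDegree.
Local Open Scope ring_scope.
Variable K : closedFieldType.
Local Notation A := {mpoly K[2]}.
Implicit Types (f g h u v X Y : A) (m : 'X_{1..2}) (P R : {poly K}).

Lemma msize_lin (o : option K) : (msize (lin o).1 <= 2)%N /\ (msize (lin o).2 <= 2)%N.
Proof.
have := msize_lsubst o 'X_0; have := msize_lsubst o 'X_1.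
by rewrite /lsubst substX0 substX1 !msizeX !mdeg1 => -> ->.
Qed.

Lemma inv2_step (o : option K) R f g X Y (o' := omap -%R o) : inv2 f g X Y ->
  inv2 (lsubst o (shear R f)) (lsubst o (shear R g))
    (subst X Y (shear (- R) (lin o').1)) (subst X Y (shear (- R) (lin o').2)).
Proof.
move=> [XE YE fE gE].
have backE h : subst (shear (- R) (lin o').1) (shear (- R) (lin o').2) h = shear (- R) (lsubst o'
  h).
  by rewrite /shear /lsubst subst_comp.
have stepE h : subst (lsubst o (shear R f)) (lsubst o (shear R g)) h = lsubst o (shear R (subst f
  g h)).
  by rewrite /lsubst /shear !subst_comp.
have lin1 : (lin o').1 = lsubst o' 'X_0 by rewrite /lsubst substX0.
have lin2 : (lin o').2 = lsubst o' 'X_1 by rewrite /lsubst substX1.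
have shK h : shear R (shear (- R) h) = h by rewrite shear_comp subrr shear0.
split; rewrite ?stepE.
- by rewrite subst_comp XE YE subst_id shK lin1 lsubstK.
- by rewrite subst_comp XE YE subst_id shK lin2 lsubstK.
- by rewrite -subst_comp backE lsubstNK shearK.
- by rewrite -subst_comp backE lsubstNK shearK.
Qed.

Definition inverse_le n f g :=
  exists X Y, inv2 f g X Y /\ (msize X <= n.+1)%N && (msize Y <= n.+1)%N.

Lemma inverse_le_step o R f g k d : (0 < d)%N -> (size R <= d.+1)%N -> inverse_le k f g ->
  inverse_le (d * k) (lsubst o (shear R f)) (lsubst o (shear R g)).
Proof.
move=> d0 Rd [X [Y [XY /andP[Xk Yk]]]].
have [l1 l2] := msize_lin (omap -%R o).
have le h : (msize h <= 2)%N -> (msize (subst X Y (shear (- R) h)) <= (d * k).+1)%N.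
  move=> h2; rewrite mulnC; apply: msize_subst => //.
  by rewrite -[d]muln1; apply: msize_shear => //; rewrite size_polyN.
exists (subst X Y (shear (- R) (lin (omap -%R o)).1)),
  (subst X Y (shear (- R) (lin (omap -%R o)).2)).
split; first exact: (inv2_step o R XY).
apply/andP; split; [exact: le l1|exact: le l2].
Qed.

Lemma inverse_le_swap n f g : inverse_le n f g -> inverse_le n g f.
Proof.
move=> [X [Y [XY le]]]; exists (lsubst None X), (lsubst None Y).
by split; [exact: inv2_swap|rewrite !msize_lsubst].
Qed.

Lemma affine_inverse_le f g : aut2 f g -> msize f = 2 -> (msize g <= 2)%N -> inverse_le 1 f g.
Proof.
move=> fg f2 g2; have [o [a [c [a0 fE]]]] := affine_coordinate fg f2.
set F := a%:MP * 'X_0 + c%:MP in fE; pose G := lsubst (omap -%R o) g.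
have gE : g = lsubst o G by rewrite lsubstK.
have FE : F = lsubst (omap -%R o) f by rewrite fE lsubstNK.
have FG : aut2 F G by rewrite FE; apply: aut2_lsubst.
have F2 : msize F = 2 by rewrite FE msize_lsubst.
have G2 : (msize G <= 2)%N by rewrite msize_lsubst.
pose X : A := a^-1%:MP * ('X_0 - c%:MP).
have aK : a^-1%:MP * a%:MP = 1 :> A by rewrite -mpolyCM mulVf.
have aK' : a%:MP * a^-1%:MP = 1 :> A by rewrite -mpolyCM mulfV.
have XF h : subst F h X = 'X_0.
  by rewrite /X rmorphM rmorphB /= !substMP substX0 addrK mulrA aK mul1r.
have FX h : subst X h F = 'X_0.
  by rewrite /F rmorphD rmorphM /= !substMP substX0 mulrA aK' mul1r subrK.
have FX1 : aut2 F 'X_1 by exists X, 'X_1; split; rewrite ?substX1.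
have [b [r [b0 GE]]] := aut2_mates FX1 FG.
have r2 : (size r <= 2)%N.
  have [->|r0] := eqVneq r 0; first by rewrite size_poly0.
  have rE : subst F 0 (polX r) = G - b%:MP * 'X_1.
    by move: (subst F 0 _) GE => w ->; rewrite addrAC subrr add0r.
  have := msize_horner_ge F2 isT r0; rewrite rE muln1 => /leq_trans le.
  have : ((size r).-1 < 2)%N.
    apply: le; rewrite (leq_trans (msizeD_le _ _)) // geq_max G2 msizeN mul_mpolyC.
    by rewrite (leq_trans (msizeZ_le _ _)) // msizeX mdeg1.
  by case: (size r).
have rE : r = (r`_1)%:P * 'X + (r`_0)%:P.
  apply/polyP => -[|[|i]]; rewrite coefD coefMX !coefC ?add0r ?addr0 //=.
  by rewrite nth_default ?addr0 // (leq_trans r2).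
have {GE} GE : G = b%:MP * 'X_1 + ((r`_1)%:MP * F + (r`_0)%:MP).
  rewrite GE {1}rE rmorphD rmorphM /= !polXC polXX rmorphD rmorphM /= !substMP substX0.
  by [].
rewrite fE gE -(shear0 F) -(shear0 G) -[1%N]muln1; apply: inverse_le_step.
- by [].
- by rewrite size_poly0.
have bK : b^-1%:MP * b%:MP = 1 :> A by rewrite -mpolyCM mulVf.
have bK' : b%:MP * b^-1%:MP = 1 :> A by rewrite -mpolyCM mulfV.
pose Y : A := b^-1%:MP * ('X_1 - ((r`_1)%:MP * 'X_0 + (r`_0)%:MP)).
have affine_le (s t e : K) (p : A) : (msize p <= 2)%N ->
  (msize (s%:MP * (p - (t%:MP * 'X_0 + e%:MP)))%R <= 2)%N.
  move=> p2; rewrite mul_mpolyC (leq_trans (msizeZ_le _ _)) // (leq_trans (msizeD_le _ _)) //.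
  rewrite geq_max p2 msizeN (leq_trans (msizeD_le _ _)) // geq_max mul_mpolyC.
  by rewrite (leq_trans (msizeZ_le _ _)) ?msizeX ?mdeg1 //= msizeC (leq_trans (leq_b1 _)).
exists X, Y; split; last first.
  apply/andP; split; last by apply: affine_le; rewrite msizeX mdeg1.
  have -> : X = a^-1%:MP * ('X_0 - (0%:MP * 'X_0 + c%:MP)) by rewrite mpolyC0 mul0r add0r.
  apply: affine_le.
  by rewrite msizeX mdeg1.
split; [exact: XF| |exact: FX|].
  rewrite /Y rmorphM rmorphB rmorphD rmorphM /= !substMP substX0 substX1.
  by rewrite GE addrK mulrA bK mul1r.
rewrite GE rmorphD rmorphM rmorphD rmorphM /= !substMP substX1 FX.
by rewrite /Y mulrA bK' mul1r subrK.
Qed.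

Lemma inverse_degree n f g : aut2 f g -> maxn (msize f) (msize g) = n.+1 -> (0 < n)%N ->
  inverse_le n f g.
Proof.
elim/ltn_ind: n f g => n IHn f g fg fgn n0.
wlog fn : f g fg fgn / msize f = n.+1.
  move=> H; case: (leqP (msize f) (msize g)) fgn => [le E|lt E].
    by apply: inverse_le_swap; apply: H; [exact: aut2_swap|rewrite maxnC (maxn_idPr le)|].
  by apply: H; rewrite // (maxn_idPl (ltnW lt)).
have gn : (msize g <= n.+1)%N by rewrite -fgn leq_maxr.
have [n1|n2] := leqP n 1.
  have {}n1 : n = 1%N by apply/eqP; rewrite eqn_leq n1.
  by rewrite n1 in fn gn *; apply: affine_inverse_le.
have [o [P [d [k [f1 [g1 [[nE d2 k0 Pd] [fg1 fgk fE gE]]]]]]]] := jung_step fg fn gn n2.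
have kn : (k < n)%N by rewrite nE -{1}[k]mul1n ltn_pmul2r.
have := IHn k kn f1 g1 fg1 fgk k0; rewrite nE fE gE.
by apply: inverse_le_step; [exact: ltnW|exact: size_X2M].
Qed.

End InverseDegree.

Local Open Scope classical_set_scope.

(** * Dimension of polynomial images *)

Section Nonvanishing.
Local Open Scope ring_scope.
Variable K : closedFieldType.

Lemma base_expansion_inj (B n : nat) (a b : nat -> nat) :
  (forall i, i < n -> a i < B)%N -> (forall i, i < n -> b i < B)%N ->
  (\sum_(i < n) a i * B ^ i = \sum_(i < n) b i * B ^ i)%N ->
  forall i, (i < n)%N -> a i = b i.
Proof.
elim: n a b => // n IHn a b aB bB.
rewrite !big_ord_recl /= !expn0 !muln1.
have E (c : nat -> nat) : (\sum_(i < n) c (bump 0 i) * B ^ bump 0 i = (\sum_(i < n) c i.+1 * B ^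
  i) * B)%N.
  by rewrite big_distrl; apply: eq_bigr => i _; rewrite /bump leq0n add1n expnSr mulnA.
rewrite !E => H.
have B0 : (0 < B)%N by apply: leq_ltn_trans (aB 0%N isT).
have a0 : a 0%N = b 0%N.
  have := congr1 (modn^~ B) H; rewrite ![(_ + _ * B)%N]addnC !modnMDl !modn_small //.
    exact: bB.
  exact: aB.
move: H; rewrite a0 => /eqP; rewrite eqn_add2l eqn_pmul2r // => /eqP H [//|i] iN.
apply: (IHn (fun i => a i.+1) (fun i => b i.+1)) => //.
- by move=> j jn; apply: aB.
- by move=> j jn; apply: bB.
Qed.

(* Kronecker's substitution ['X_i := 'X ^ (B ^ i)] *)
Lemma mpoly_nonvanishing n (p : {mpoly K[n]}) : p != 0 -> exists t : nat -> K, p.@[fun i =>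
  t i] != 0.
Proof.
move=> p0; pose B := msize p.
pose code (m : 'X_{1..n}) := (\sum_(i < n) m i * B ^ i)%N.
pose q : {poly K} := mmap (@polyC K) (fun i : 'I_n => 'X^(B ^ i)) p.
have qE : q = \sum_(m <- msupp p) (p@_m)%:P * 'X^(code m).
  rewrite /q /mmap; apply: eq_bigr => m _; congr (_ * _).
  rewrite /mmap1 /code expr_sum; apply: eq_bigr => i _.
  by rewrite -exprM mulnC.
pose m0 := mlead p; have m0p : m0 \in msupp p by apply: mlead_supp.
have codeI m : m \in msupp p -> code m = code m0 -> m = m0.
  move=> mp; pose c (m1 : 'X_{1..n}) (i : nat) := if insub i is Some j then m1 j else 0%N.
  have cE m1 (i : 'I_n) : c m1 i = m1 i by rewrite /c valK.
  have cB m1 : m1 \in msupp p -> forall i, (i < n)%N -> (c m1 i < B)%N.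
    move=> m1p i iN; rewrite -[i]/(nat_of_ord (Ordinal iN)) cE.
    apply: leq_ltn_trans (msize_mdeg_lt m1p); rewrite mdegE.
    by rewrite (bigD1 (Ordinal iN)) //= leq_addr.
  have codeE m1 : code m1 = (\sum_(i < n) c m1 i * B ^ i)%N.
    by apply: eq_bigr => i _; rewrite cE.
  rewrite !codeE => H; apply/mnmP => i; rewrite -!cE.
  exact: (base_expansion_inj (cB m mp) (cB m0 m0p) H).
have q0 : q != 0.
  suff : q`_(code m0) != 0 by apply: contraNneq => ->; rewrite coef0.
  rewrite qE coef_sum (bigD1_seq m0) ?msupp_uniq //= coefCM coefXn eqxx mulr1.
  rewrite big_seq_cond big1 ?addr0 -?mcoeff_msupp // => m /andP[mp mm0].
  rewrite coefCM coefXn; case: eqP => [/esym/(codeI m mp) E|]; last by rewrite mulr0.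
  by rewrite E eqxx in mm0.
have /closed_nonrootP[x qx] := q0.
exists (fun i => x ^+ (B ^ i)); apply: contraNneq qx => px; rewrite /root -px qE horner_sum.
rewrite mevalE; apply/eqP; apply: eq_bigr => m _; rewrite hornerCM hornerXn; congr (_ * _).
by rewrite /code expr_sum; apply: eq_bigr => i _; rewrite -exprM mulnC.
Qed.

End Nonvanishing.

Section PolynomialMaps.
Local Open Scope ring_scope.
Variable K : closedFieldType.

Definition polymap M N (Phi : 'I_N -> {mpoly K[M]}) (t : nat -> K) : affine_space K N :=
  \row_i (Phi i).@[fun j => t j].

Definition pullback M N (Phi : 'I_N -> {mpoly K[M]}) : {mpoly K[N]} -> {mpoly K[M]} :=
  comp_mpoly [tuple Phi i | i < N].
HB.instance Definition _ M N (Phi : 'I_N -> {mpoly K[M]}) := GRing.RMorphism.on (pullback Phi).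

Lemma meval_polymap M N (Phi : 'I_N -> {mpoly K[M]}) p t :
  p.@[polymap Phi t 0] = (pullback Phi p).@[fun j => t j].
Proof.
by rewrite comp_mpoly_meval; apply: meval_eq => i; rewrite tnth_mktuple mxE.
Qed.

Lemma closed_zero_locus1 N (p : {mpoly K[N]}) : closed [set x : affine_space K N | p.@[x 0] = 0].
Proof.
apply/zariski_closedE; exists [set p]; apply/seteqP; split=> x /=; first by move=> px _ ->.
by apply.
Qed.

Lemma closure_min (T : topologicalType) (A B : set T) : closed B -> A `<=` B -> closure A `<=` B.
Proof. by move=> cB AB; apply: subset_trans cB; apply: closureS. Qed.

Lemma closed_separate N (Z : set (affine_space K N)) x : closed Z -> ~ Z x ->
  exists2 p : {mpoly K[N]}, (forall y, Z y -> p.@[y 0] = 0) & p.@[x 0] != 0.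
Proof.
move=> /zariski_closedE[I ->] /existsNP[p /not_implyP[Ip px]]; exists p; last exact/eqP.
by move=> y; apply.
Qed.

Lemma irreducible_closure_polymap M N (Phi : 'I_N -> {mpoly K[M]}) :
  irreducible_set (closure (range (polymap Phi))).
Proof.
split; first by exists (polymap Phi (fun=> 0)); apply: subset_closure; exists (fun=> 0).
move=> A B cA cB AB.
have sep (C : set (affine_space K N)) : closed C -> ~ closure (range (polymap Phi)) `<=` C ->
    exists2 p : {mpoly K[N]}, (forall y, C y -> p.@[y 0] = 0) & pullback Phi p != 0.
  move=> cC nC; have [t Ct] : exists t, ~ C (polymap Phi t).
    apply/existsNP => H; apply: nC; apply: closure_min => // _ [t _ <-]; exact: H.
  have [p pC pt] := closed_separate cC Ct; exists p => //.
  by apply: contraNneq pt => p0; rewrite meval_polymap p0 meval0.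
apply: contrapT => /not_orP[/(sep A cA)[p pA p0] /(sep B cB)[q qB q0]].
have [t] := mpoly_nonvanishing (mulf_neq0 p0 q0).
rewrite mevalM mulf_eq0 -!meval_polymap => /norP[/eqP pt /eqP qt].
have : closure (range (polymap Phi)) (polymap Phi t) by apply: subset_closure; exists t.
by move=> /AB[/pA|/qB].
Qed.

End PolynomialMaps.

Section AlgebraicDependence.
Local Open Scope ring_scope.
Variable K : closedFieldType.

Lemma linear_dependence (S T : finType) (a : S -> T -> K) : (#|T| < #|S|)%N ->
  exists2 c : S -> K, exists s, c s != 0 & forall t, \sum_s c s * a s t = 0.
Proof.
move=> TS; pose A := \matrix_(i < #|S|, j < #|T|) a (enum_val i) (enum_val j).
have [v vA v0] : exists2 v : 'rV[K]_#|S|, v *m A = 0 & v != 0.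
  have : kermx A != 0.
    rewrite -mxrank_eq0 mxrank_ker -lt0n subn_gt0.
    exact: leq_ltn_trans (rank_leq_col A) TS.
  by case/rowV0Pn => v /sub_kermxP vA v0; exists v.
exists (fun s => v 0 (enum_rank s)).
  by have /rV0Pn[i vi] := v0; exists (enum_val i); rewrite enum_valK.
move=> t; have /rowP/(_ (enum_rank t)) := vA; rewrite !mxE => E; rewrite -[RHS]E {E}.
rewrite (reindex_onto (fun i : 'I_#|S| => enum_val i) enum_rank) => [|s _]; last exact: enum_rankK.
rewrite [LHS]big_mkcond; apply: eq_bigr => i _.
by rewrite enum_valK eqxx mxE enum_rankK.
Qed.

Lemma power_bound (m M e : nat) : (M < m)%N ->
  exists2 D, (0 < D)%N & ((m * (D * e)).+1 ^ M < D ^ m)%N.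
Proof.
move=> Mm; pose c := (m * e).+1; exists (c ^ M).+1 => //; set D := (c ^ M).+1.
apply: (@leq_ltn_trans ((c * D) ^ M)).
  have le : ((m * (D * e)).+1 <= c * D)%N.
    by rewrite /c mulSn [(D * e)%N]mulnC mulnA -add1n leq_add2r.
  by case: (M) => // i; rewrite leq_exp2r.
rewrite expnMn (@leq_trans (D ^ M.+1)) //; last by rewrite leq_pexp2l.
by rewrite expnS ltn_pmul2r ?expn_gt0.
Qed.

Lemma msizeM_leS n (p q : {mpoly K[n]}) a b : (msize p <= a.+1)%N -> (msize q <= b.+1)%N ->
  (msize (p * q) <= (a + b).+1)%N.
Proof.
move=> pa qb; have [->|p0] := eqVneq p 0; first by rewrite mul0r msize0.
have [->|q0] := eqVneq q 0; first by rewrite mulr0 msize0.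
rewrite msizeM // -ltnS prednK ?addn_gt0 ?lt0n ?msize_poly_eq0 ?p0 //.
by rewrite -addnS -addSn leq_add.
Qed.

Lemma msize_exp_leS n (p : {mpoly K[n]}) a k : (msize p <= a.+1)%N ->
  (msize (p ^+ k) <= (k * a).+1)%N.
Proof.
move=> pa; elim: k => [|k IHk]; first by rewrite expr0 msize1.
by rewrite exprS mulSn msizeM_leS.
Qed.

Lemma msize_prod_leS n (I : Type) (r : seq I) (F : I -> {mpoly K[n]}) d :
  (forall i, msize (F i) <= d.+1)%N -> (msize (\prod_(i <- r) F i) <= (size r * d).+1)%N.
Proof.
move=> Fd; elim: r => [|i r IHr]; first by rewrite big_nil msize1.
by rewrite big_cons mulSn msizeM_leS.
Qed.

Lemma algebraic_dependence m M (q : 'I_m -> {mpoly K[M]}) : (M < m)%N ->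
  exists2 Q : {mpoly K[m]}, Q != 0 & pullback q Q = 0.
Proof.
move=> Mm; pose e := \max_i msize (q i).
have [D D0 lt] := power_bound e Mm; set B := (m * (D * e)).+1 in lt.
pose mS (s : {ffun 'I_m -> 'I_D}) : 'X_{1..m} := [multinom s i : nat | i < m].
pose mT (s : {ffun 'I_M -> 'I_B}) : 'X_{1..M} := [multinom s i : nat | i < M].
have [|c [s0 cs0] cE] := @linear_dependence _ _ (fun s t => (pullback q 'X_[mS s])@_(mT t)).
  by rewrite !card_ffun !card_ord.
have mS_inj : injective mS.
  by move=> s s' /mnmP E; apply/ffunP => i; apply/val_inj; have := E i; rewrite !mnmE.
exists (\sum_s c s *: 'X_[mS s]).
  suff : (\sum_s c s *: 'X_[mS s])@_(mS s0) != 0 by apply: contraNneq => ->; rewrite mcoeff0.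
  rewrite raddf_sum (bigD1 s0) //= mcoeffZ mcoeffX eqxx mulr1 big1 ?addr0 // => s ss0.
  by rewrite mcoeffZ mcoeffX (inj_eq mS_inj) (negPf ss0) mulr0.
rewrite rmorph_sum; apply/mpolyP => mu; rewrite mcoeff0 raddf_sum /=.
have H s : (msize (pullback q 'X_[mS s]) <= B)%N.
  rewrite /pullback comp_mpolyX /B.
  have szm : size (index_enum 'I_m) = m by rewrite -[RHS]card_ord cardT enumT.
  rewrite -[X in (X * _)%N]szm; apply: msize_prod_leS => i; rewrite tnth_mktuple mnmE.
  rewrite (@leq_trans (s i * e).+1) //; last by rewrite ltnS leq_mul2r ltnW ?orbT.
  by apply: msize_exp_leS; rewrite leqW // (leq_bigmax i).
have cZ s : (pullback q (c s *: 'X_[mS s]))@_mu = c s * (pullback q 'X_[mS s])@_mu.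
  by rewrite /pullback comp_mpolyZ mcoeffZ.
under eq_bigr do rewrite cZ.
have [muB|muB] := boolP [forall i, mu i < B]%N.
  pose t := [ffun i => Ordinal (forallP muB i)].
  have <- : mT t = mu by apply/mnmP => i; rewrite mnmE ffunE.
  exact: cE.
rewrite big1 // => s _; rewrite (_ : _@_mu = 0) ?mulr0 //.
apply/eqP; rewrite mcoeff_eq0; apply: contra muB => mus; apply/forallP => i.
rewrite (leq_trans _ (H s)) // (leq_ltn_trans _ (msize_mdeg_lt mus)) //.
by rewrite mdegE (bigD1 i) //= leq_addr.
Qed.

End AlgebraicDependence.

Section ChainBound.
Local Open Scope ring_scope.
Variable K : closedFieldType.

Lemma meval_muni n (Q : {mpoly K[n.+1]}) (v : 'I_n.+1 -> K) :
  Q.@[v] = (map_poly (meval (fun i => v (widen_ord (leqnSn n) i))) (muni Q)).[v ord_max].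
Proof.
rewrite muniE rmorph_sum horner_sum mevalE /=; apply: eq_bigr => m _.
rewrite -mul_polyC rmorphM /= map_polyC map_polyXn hornerM hornerC hornerXn /= mevalZ mevalX.
rewrite big_ord_recr /= mulrA; congr (_ * _ * _); apply: eq_bigr => i _.
by rewrite mnmE.
Qed.

Section Chain.
Variables (N m : nat) (Z : nat -> set (affine_space K N)) (b : nat -> {mpoly K[N]}).
Hypothesis Zirr : forall i, (i <= m)%N -> irreducible_set (Z i).
Hypothesis ZS : forall i, (i < m)%N -> Z i `<=` Z i.+1.
Hypothesis b0 : forall i, (i < m)%N -> forall x, Z i x -> (b i).@[x 0] = 0.
Hypothesis b1 : forall i, (i < m)%N -> exists2 x, Z i.+1 x & (b i).@[x 0] != 0.

Lemma chain_independent j (Q : {mpoly K[j]}) : (j <= m)%N ->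
  (forall x, Z j x -> Q.@[fun i => (b i).@[x 0]] = 0) -> Q = 0.
Proof.
elim: j Q => [|j IHj] Q jm Qb.
  have [[x Zx] _] := Zirr jm; have := Qb x Zx.
  by rewrite [Q]nvar0_mpolyC mevalC => ->; rewrite mpolyC0.
apply/eqP; apply: contraT => Q0.
have R0 : muni Q != 0.
  have [t] := mpoly_nonvanishing Q0; apply: contraNneq => R0.
  by rewrite meval_muni R0 map_poly0 horner0.
have [e [R' R'0 RE]] := multiplicity_XsubC (muni Q) 0; rewrite R0 /= in R'0.
rewrite polyC0 subr0 in RE.
pose w := (map_poly (pullback (fun i : 'I_j => b i)) R').[b j].
have wE (x : affine_space K N) : w.@[x 0] = (map_poly (meval (fun i : 'I_j =>
  (b i).@[x 0])) R').[(b j).@[x 0]].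
  rewrite /w -horner_map /= -map_poly_comp; congr _.[_]; apply: eq_map_poly => p /=.
  by rewrite /pullback comp_mpoly_meval; apply: meval_eq => i; rewrite tnth_mktuple.
have [] := (Zirr jm).2 _ _ (@closed_zero_locus1 K N (b j)) (@closed_zero_locus1 K N w).
- move=> x Zx /=; have := Qb x Zx; rewrite meval_muni RE.
  rewrite rmorphM rmorphXn /= map_polyX hornerM hornerXn.
  rewrite -wE => /eqP; rewrite mulf_eq0 expf_eq0 => /orP[/eqP|/andP[_ /eqP]]; by [right|left].
- by have [x Zx /eqP bx] := b1 jm => /(_ x Zx).
move=> wZ; move: R'0; rewrite /root (IHj R'.[0] (ltnW jm)) ?eqxx // => x Zx.
have := wZ x (ZS jm Zx); rewrite /= wE (b0 jm Zx) => <-.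
by rewrite -horner_map /= meval0.
Qed.
End Chain.

Lemma irreducible_chain_polymap N M m (Phi : 'I_N -> {mpoly K[M]}) (Z : nat ->
  set (affine_space K N)) :
  (forall i, (i <= m)%N -> closed (Z i) /\ irreducible_set (Z i)) ->
  (forall i, (i < m)%N -> Z i `<` Z i.+1) -> Z m `<=` closure (range (polymap Phi)) -> (m <= M)%N.
Proof.
move=> Zc ZS ZX; rewrite leqNgt; apply/negP => Mm.
have bE i : exists b : {mpoly K[N]}, (i < m)%N ->
    (forall x, Z i x -> b.@[x 0] = 0) /\ exists2 x, Z i.+1 x & b.@[x 0] != 0.
  have [im|im] := ltnP i m; last by exists 0.
  have [x [Zx nZx]] := nonsubset (ZS i im).2.
  have [p pZ px] := closed_separate (Zc i (ltnW im)).1 nZx.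
  by exists p => _; split=> //; exists x.
have [b bP] := choice bE.
have [Q Q0 QE] := algebraic_dependence (fun i : 'I_m => pullback Phi (b i)) Mm.
case/eqP: Q0; apply: (@chain_independent N m Z b) => //.
- by move=> i /Zc[].
- by move=> i im; apply: (ZS i im).1.
- by move=> i /bP[].
- by move=> i /bP[].
move=> x /ZX; pose w := pullback (fun i : 'I_m => b i) Q.
have wE (y : affine_space K N) : w.@[y 0] = Q.@[fun i => (b i).@[y 0]].
  by rewrite /w /pullback comp_mpoly_meval; apply: meval_eq => i; rewrite tnth_mktuple.
rewrite -wE; apply: (closure_min (@closed_zero_locus1 K N w)) => _ [t _ <-] /=.
rewrite wE; have := congr1 (meval (fun j => t j)) QE; rewrite meval0 => <-.
rewrite /pullback comp_mpoly_meval; apply: meval_eq => i; rewrite tnth_mktuple.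
exact: meval_polymap.
Qed.

End ChainBound.

Section DimensionBounds.
Local Open Scope ring_scope.
Variable K : closedFieldType.

Lemma closed_bigcup_seq (T : topologicalType) (I : eqType) (L : seq I) (C : I -> set T) :
  (forall i, closed (C i)) -> closed [set x | exists2 i, i \in L & C i x].
Proof.
move=> cC; elim: L => [|i L IHL].
  by rewrite (_ : [set x | _] = set0); [exact: closed0|apply/seteqP; split=> x // [i]].
rewrite (_ : [set x | _] = C i `|` [set x | exists2 i, i \in L & C i x]); first exact: closedU.
apply/seteqP; split=> x /=.
  by move=> [j]; rewrite inE => /predU1P[->|jL Cx]; [left|right; exists j].
by move=> [Cx|[j jL Cx]]; [exists i|exists j]; rewrite ?inE ?eqxx ?jL ?orbT.
Qed.

Lemma irreducible_seq (T : topologicalType) (I : eqType) (L : seq I) (C : I -> set T) (Z : set T) :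
  (forall i, closed (C i)) -> irreducible_set Z ->
  Z `<=` [set x | exists2 i, i \in L & C i x] -> exists2 i, i \in L & Z `<=` C i.
Proof.
move=> cC [[z Zz] Zirr]; elim: L => [|i L IHL] ZL; first by have [] := ZL z Zz.
have [|Zi|ZL'] := Zirr _ _ (cC i) (closed_bigcup_seq (L := L) cC).
- by move=> x /ZL[j]; rewrite inE => /predU1P[->|jL Cx]; [left|right; exists j].
- by exists i; rewrite // inE eqxx.
- by have [j jL ZC] := IHL ZL'; exists j; rewrite // inE jL orbT.
Qed.

Lemma irreducible_chain_cover N M m (I : eqType) (L : seq I) (Phi : I -> 'I_N -> {mpoly K[M]})
    (S : set (affine_space K N)) :
  (forall x, S x -> exists2 i, i \in L & exists t, x = polymap (Phi i) t) ->
  irreducible_chain (closure S) m -> (m <= M)%N.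
Proof.
move=> SL [Z [Zc ZS]]; have [cZ iZ ZX] := Zc m (leqnn m).
have [i iL Zi] : exists2 i, i \in L & Z m `<=` closure (range (polymap (Phi i))).
  apply: irreducible_seq iZ _; first by move=> i; apply: closed_closure.
  apply: subset_trans ZX _; apply: closure_min.
    by apply: closed_bigcup_seq => i; apply: closed_closure.
  by move=> x /SL[i iL [t ->]]; exists i => //; apply: subset_closure; exists t.
apply: (irreducible_chain_polymap _ ZS Zi) => j /Zc[]; by split.
Qed.

(* The images of the subspaces [t_j = c j] for [j >= i] form the chain: [t_i] is the
   quotient of two polynomial functions on the image, so the chain is strict. *)
Lemma irreducible_chain_birational N M (Phi : 'I_N -> {mpoly K[M]}) (c : nat -> K)
    (num den : nat -> {mpoly K[N]}) :
  (forall i t, (i < M)%N ->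
     (num i).@[polymap Phi t 0] = t i * (den i).@[polymap Phi t 0]) ->
  (forall i, (i < M)%N -> (den i).@[polymap Phi (fun j =>
    if j == i then c i + 1 else c j) 0] != 0) ->
  irreducible_chain (closure (range (polymap Phi))) M.
Proof.
move=> numE den0.
pose trunc i (t : nat -> K) j := if (j < i)%N then t j else c j.
pose Psi i k := pullback (fun j : 'I_M => if (j < i)%N then 'X_j else (c j)%:MP) (Phi k).
have PsiE i t : polymap (Psi i) t = polymap Phi (trunc i t).
  apply/rowP => k; rewrite !mxE /Psi /pullback comp_mpoly_meval; apply: meval_eq => j.
  by rewrite tnth_mktuple /trunc; case: ifP; rewrite ?mevalXU ?mevalC.
exists (fun i => closure (range (polymap (Psi i)))); split=> i iM.
  split; [exact: closed_closure|exact: irreducible_closure_polymap|].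
  by apply: closureS => _ [t _ <-]; rewrite PsiE; exists (trunc i t).
split.
  apply: closureS => _ [t _ <-]; exists (trunc i t) => //; rewrite !PsiE.
  congr polymap; apply/funext => j; rewrite /trunc; case: (ltnP j i) => ji.
    by rewrite ltnW.
  by rewrite if_same.
pose w := num i - (c i)%:MP * den i.
have wE t : w.@[polymap Phi t 0] = (t i - c i) * (den i).@[polymap Phi t 0].
  by rewrite mevalB mevalM mevalC numE // -mulrBl.
have wZ : closure (range (polymap (Psi i))) `<=` [set x : affine_space K N | w.@[x 0] = 0].
  apply: closure_min; first exact: closed_zero_locus1.
  by move=> _ [t _ <-] /=; rewrite PsiE wE /trunc ltnn subrr mul0r.
pose t := (fun j => if j == i then c i + 1 else c j).
have : closure (range (polymap (Psi i.+1))) (polymap Phi t).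
  apply: subset_closure; exists t => //; rewrite PsiE; congr polymap; apply/funext => j.
  rewrite /trunc /t; case: ltnP => // ij; case: eqP => // ji.
  by rewrite ji ltnn in ij.
move=> tZ /(_ _ tZ) /wZ /= /eqP; rewrite wE mulf_eq0 (negPf (den0 i iM)) orbF.
by rewrite /t eqxx addrAC subrr add0r oner_eq0.
Qed.

End DimensionBounds.

(** * Projections of closed sets *)

Section Constructible.
Local Open Scope ring_scope.
Variable K : closedFieldType.

Lemma quantifier_elimination (f : GRing.formula K) : GRing.rformula f ->
  exists2 bcs : seq (seq (GRing.term K) * seq (GRing.term K)),
    all (@GRing.dnf_rterm K) bcs &
    forall e, GRing.holds e f <->
      has (fun bc => all (fun t => GRing.eval e t == 0) bc.1 && all (fun t =>
        GRing.eval e t != 0) bc.2) bcs.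
Proof.
move=> fr.
have wf := @ClosedFieldQE.wf_ex_elim K.
have ok := @ClosedFieldQE.holds_ex_elim K (@GRing.solve_monicpoly K).
pose g := GRing.quantifier_elim (@ClosedFieldQE.ex_elim K) f.
have /andP[g_qf g_r] : GRing.qf_form g && GRing.rformula g := GRing.quantifier_elim_wf wf fr.
exists (GRing.qf_to_dnf g false); first exact: GRing.qf_to_dnf_rterm.
move=> e; apply: (iff_trans (rwP (GRing.quantifier_elim_rformP wf ok e fr))).
have gE : GRing.qf_eval e (GRing.dnf_to_form (GRing.qf_to_dnf g false)) = GRing.qf_eval e g.
  by apply: GRing.qf_to_dnfP; rewrite g_qf.
rewrite -/g -gE.
set h := fun bc : _ * _ => _; suff -> : GRing.qf_eval e (GRing.dnf_to_form (GRing.qf_to_dnf g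
  false)) =
  has h (GRing.qf_to_dnf g false) by exact: iff_refl.
elim: (GRing.qf_to_dnf g false) => //= bc bcs ->; congr (_ && _ || _).
  by elim: (bc.1) => //= t s ->.
by elim: (bc.2) => //= t s ->.
Qed.

Fixpoint mpoly_of_term N (t : GRing.term K) : {mpoly K[N]} :=
  match t with
  | GRing.Var i => if insub i is Some j then 'X_j else 0
  | GRing.Const c => c%:MP
  | GRing.NatConst n => n%:R
  | GRing.Add t1 t2 => mpoly_of_term N t1 + mpoly_of_term N t2
  | GRing.Opp t1 => - mpoly_of_term N t1
  | GRing.NatMul t1 n => mpoly_of_term N t1 *+ n
  | GRing.Mul t1 t2 => mpoly_of_term N t1 * mpoly_of_term N t2
  | GRing.Inv _ => 0
  | GRing.Exp t1 n => mpoly_of_term N t1 ^+ n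
  end.

Lemma meval_of_term N (t : GRing.term K) (v : affine_space K N) : GRing.rterm t ->
  GRing.eval [seq v 0 i | i <- enum 'I_N] t = (mpoly_of_term N t).@[v 0].
Proof.
elim: t => //=.
- move=> i _; case: insubP => [j _ <-|]; last first.
    by rewrite -leqNgt => Ni; rewrite nth_default ?meval0 // size_map size_enum_ord.
  by rewrite -[\val j]/(nat_of_ord j) (nth_map j) ?size_enum_ord // nth_ord_enum mevalXU.
- by move=> c _; rewrite mevalC.
- by move=> n _; rewrite rmorph_nat.
- by move=> t1 IH1 t2 IH2 /andP[/IH1-> /IH2->]; rewrite mevalD.
- by move=> t1 IH1 /IH1->; rewrite mevalN.
- by move=> t1 IH1 n /IH1->; rewrite mevalMn.
- by move=> t1 IH1 t2 IH2 /andP[/IH1-> /IH2->]; rewrite mevalM.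
- by move=> t1 IH1 n /IH1->; rewrite rmorphXn.
Qed.

Definition term_of_mpoly L (p : {mpoly K[L]}) : GRing.term K :=
  foldr (fun m t => GRing.Add (GRing.Mul (GRing.Const p@_m)
      (foldr (fun i u => GRing.Mul (GRing.Exp (GRing.Var K (nat_of_ord i)) (m i)) u) (GRing.Const
        1) (enum 'I_L))) t)
    (GRing.Const 0) (msupp p).

Lemma rterm_of_mpoly L (p : {mpoly K[L]}) : GRing.rterm (term_of_mpoly p).
Proof.
rewrite /term_of_mpoly; elim: (msupp p) => //= m s ->; rewrite andbT.
by elim: (enum _).
Qed.

Lemma eval_term_of_mpoly L (p : {mpoly K[L]}) e :
  GRing.eval e (term_of_mpoly p) = p.@[fun i => e`_i].
Proof.
rewrite mevalE /term_of_mpoly; elim: (msupp p) => [|m s IHs] /=; first by rewrite big_nil.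
rewrite big_cons {}IHs; congr (_ * _ + _).
rewrite -big_enum /=; elim: (enum _) => [|i r IHr] /=; first by rewrite big_nil.
by rewrite big_cons IHr.
Qed.

Lemma constructible_projection N L (E : seq {mpoly K[L]}) :
  constructible [set v : affine_space K N | exists x : nat -> K,
    (forall i : 'I_N, x i = v 0 i) /\ {in E, forall p, p.@[fun i => x i] = 0}].
Proof.
pose f := foldr (@GRing.Exists K)
  (foldr (fun p g => GRing.And (GRing.Equal (term_of_mpoly p) (GRing.Const 0)) g) (@GRing.Bool K
    true) E)
  (iota N L).
have fr : GRing.rformula f.
  rewrite /f; elim: (iota N L) => //=; elim: E {f} => //= p E ->.
  by rewrite rterm_of_mpoly.
have [bcs bcs_r bcsP] := quantifier_elimination fr.
pose env (v : affine_space K N) := [seq v 0 i | i <- enum 'I_N].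
have envE v (i : 'I_N) : (env v)`_i = v 0 i.
  by rewrite (nth_map i) ?size_enum_ord // nth_ord_enum.
have SE (v : affine_space K N) : (exists x : nat -> K,
    (forall i : 'I_N, x i = v 0 i) /\ {in E, forall p, p.@[fun i =>
      x i] = 0}) <-> GRing.holds (env v) f.
  have holdsE e : GRing.holds e (foldr (fun p g =>
    GRing.And (GRing.Equal (term_of_mpoly p) (GRing.Const 0)) g)
      (@GRing.Bool K true) E) <-> {in E, forall p, p.@[fun i => e`_i] = 0}.
    elim: (E) => [|p E' IH] /=; first by split.
    rewrite eval_term_of_mpoly IH; split=> [[p0 E0] q|H]; last first.
      by split=> [|q qE]; [apply: H; rewrite inE eqxx | apply: H; rewrite inE qE orbT].
    by rewrite inE => /predU1P[->//|]; apply: E0.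
  rewrite /f -GRing.foldExistsP; split=> [[x [xv xE]]|[e ev /holdsE eE]].
    exists (mkseq x (N + L)).
      move=> i; rewrite !inE mem_iota negb_and -leqNgt -ltnNge /env.
      have [iN _|iN /= NLi] := ltnP i N.
        by rewrite nth_mkseq ?(leq_trans iN) ?leq_addr // -[i]/(nat_of_ord (Ordinal iN)) envE xv.
      apply: etrans (_ : _ = 0) (esym _); apply: nth_default; last by rewrite size_mkseq.
        by rewrite size_map size_enum_ord.
    apply/holdsE => p pE; rewrite -[RHS](xE p pE); apply: meval_eq => i.
    by rewrite nth_mkseq // (leq_trans (ltn_ord i)) // leq_addl.
  exists (nth 0 e); split=> // i; rewrite -envE ev // !inE mem_iota negb_and -ltnNge.
  by rewrite ltn_ord.
pose P (t : GRing.term K) := mpoly_of_term N t.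
pose bc i := nth ([::], [::]) bcs i.
have evalE (v : affine_space K N) t : GRing.rterm t ->
  (GRing.eval (env v) t == 0) = ((P t).@[v 0] == 0).
  by move=> tr; rewrite meval_of_term.
exists (size bcs), (fun i => ~` [set v : affine_space K N | (\prod_(t <- (bc i).2) P t).@[v 0] =
  0]),
  (fun i => zero_locus [set p | p \in [seq P t | t <- (bc i).1]]).
split=> [i|]; first split.
- by rewrite openC; apply: closed_zero_locus1.
- by apply/zariski_closedE; eexists.
have VE (v : affine_space K N) (s : seq (GRing.term K)) : all (@GRing.rterm K) s ->
    all (fun t => GRing.eval (env v) t == 0) s <->
    (forall p, p \in [seq P t | t <- s] -> p.@[v 0] = 0).
  elim: s => [|t s IH] //= /andP[tr sr]; rewrite evalE //; split.
    by move=> /andP[/eqP t0 s0] p; rewrite inE => /predU1P[->//|]; apply: (IH sr).1.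
  move=> H; rewrite H ?inE ?eqxx //=; apply/(IH sr) => p ps.
  by apply: H; rewrite inE ps orbT.
have UE (v : affine_space K N) (s : seq (GRing.term K)) : all (@GRing.rterm K) s ->
    all (fun t => GRing.eval (env v) t != 0) s = ((\prod_(t <- s) P t).@[v 0] != 0).
  elim: s => [|t s IH] /=; first by rewrite big_nil meval1 oner_eq0.
  by move=> /andP[tr sr]; rewrite big_cons mevalM mulf_eq0 negb_or -IH // evalE.
apply/seteqP; split=> v /=.
  move=> /SE/bcsP/(has_nthP ([::], [::]))[i iN]; rewrite -/(bc i) => /andP[H1 H2].
  have /andP[r1 r2] : GRing.dnf_rterm (bc i) by apply: (all_nthP _ bcs_r).
  by exists (Ordinal iN) => //=; split; [apply/eqP; rewrite -UE | apply/VE].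
move=> [i _ /= [/eqP Ui Vi]]; apply/SE/bcsP/(has_nthP ([::], [::])); exists i => //.
have /andP[r1 r2] : GRing.dnf_rterm (bc i) by apply: (all_nthP _ bcs_r).
by apply/andP; split; [apply/VE | rewrite UE].
Qed.

Lemma constructibleI_open (T : topologicalType) (S O : set T) :
  open O -> constructible S -> constructible (S `&` O).
Proof.
move=> oO [m [U [V [UV ->]]]]; exists m, (fun i => U i `&` O), V; split.
  by move=> i; split; [apply: openI => //; exact: (UV i).1|exact: (UV i).2].
rewrite setI_bigcupl; apply: eq_bigcupr => i _.
by rewrite -!setIA; congr (_ `&` _); rewrite setIC.
Qed.

End Constructible.

(** * Families of automorphisms *)

Section Families.
Local Open Scope ring_scope.
Variable K : closedFieldType.
Local Notation A := {mpoly K[2]}.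
Local Notation fam M := {mpoly {mpoly K[M]}[2]}.
Implicit Types (t : nat -> K).

Definition var M i : {mpoly K[M]} := if insub i is Some j then 'X_j else 0.

Lemma meval_var M i t : (i < M)%N -> (var M i).@[fun j => t j] = t i.
Proof. by move=> iM; rewrite /var insubT mevalXU. Qed.

(* An element of [fam M] is a family of polynomials parametrized by [K^M], and [spec t] is
   its member at [t]. *)
Definition spec M t : fam M -> A := map_mpoly (meval (fun j : 'I_M => t j)).
HB.instance Definition _ M t := GRing.RMorphism.on (@spec M t).

Lemma spec_cst M t c : @spec M t c%:MP = (c.@[fun j => t j])%:MP.
Proof. by rewrite /spec map_mpolyC. Qed.

Lemma spec_X M t i : @spec M t 'X_i = 'X_i.
Proof. by rewrite /spec map_mpolyX. Qed.

Lemma spec_var M t i : (i < M)%N -> @spec M t (var M i)%:MP = (t i)%:MP.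
Proof. by move=> iM; rewrite spec_cst meval_var. Qed.

Definition fsubst M (a b : fam M) : fam M -> fam M := comp_mpoly [tuple a; b].
HB.instance Definition _ M (a b : fam M) := GRing.RMorphism.on (fsubst a b).

Lemma spec_fsubst M t (a b : fam M) p : spec t (fsubst a b p) = subst (spec t a) (spec t b) (spec
  t p).
Proof.
apply: (eq_mpoly_rmorph (F := @spec M t \o fsubst a b) (G := subst (spec t a) (spec t b) \o @spec
  M t)) => [c|i] /=.
  by rewrite /fsubst comp_mpolyC spec_cst substMP.
rewrite spec_X /fsubst comp_mpolyXU.
by case: (ord2E i) => ->; rewrite ?substX0 ?substX1.
Qed.

Definition fam_lift M0 M : fam M0 -> fam M :=
  map_mpoly (comp_mpoly [tuple var M i | i < M0]).

Lemma spec_fam_lift M0 M t (p : fam M0) : (M0 <= M)%N -> spec t (fam_lift M p) = spec t p.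
Proof.
move=> le; apply/mpolyP => m; rewrite !mcoeff_map_mpoly /=.
rewrite comp_mpoly_meval; apply: meval_eq => i.
by rewrite tnth_mktuple meval_var // (leq_trans (ltn_ord i)).
Qed.

Lemma eq_in_spec M t t' (p : fam M) : (forall i, (i < M)%N -> t i = t' i) -> spec t p = spec t' p.
Proof.
move=> tt'; apply/mpolyP => m; rewrite !mcoeff_map_mpoly /=.
by apply: meval_eq => i; apply: tt'.
Qed.

Definition covered M (S : A -> A -> Prop) := exists L : seq (fam M * fam M),
  forall f g, S f g -> exists2 FG, FG \in L & exists t, f = spec t FG.1 /\ g = spec t FG.2.

Lemma covered_seq M (I : eqType) (r : seq I) (S : I -> A -> A -> Prop) :
  (forall i, i \in r -> covered M (S i)) -> covered M (fun f g => exists2 i, i \in r & S i f g).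
Proof.
elim: r => [|i r IHr] Sr; first by exists [::] => f g [].
have [|L SL] := IHr; first by move=> j jr; apply: Sr; rewrite inE jr orbT.
have [L' SL'] := Sr i (mem_head i r).
exists (L' ++ L) => f g [j]; rewrite inE => /predU1P[-> /SL'|jr Sj].
  by move=> [FG FGL H]; exists FG => //; rewrite mem_cat FGL.
have [FG FGL H] := SL f g (ex_intro2 _ _ j jr Sj).
by exists FG => //; rewrite mem_cat FGL orbT.
Qed.

Definition steps d (S : A -> A -> Prop) (f g : A) :=
  exists (o : option K) (P : {poly K}) (f1 g1 : A),
  [/\ (size P <= d.-1)%N, S f1 g1, f = step o P f1 & g = step o P g1].

Definition fam_step M M0 d (sw : bool) (p : fam M) : fam M :=
  fsubst (if sw then 'X_1 else 'X_0 + (var M (M0 + d.-1))%:MP * 'X_1) (if sw then 'X_0 else 'X_1)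
    (fsubst 'X_0 ('X_1 + 'X_0 ^+ 2 * \sum_(j < d.-1) (var M (M0 + j))%:MP * 'X_0 ^+ j) p).

Lemma covered_steps M0 M d S : (0 < d)%N -> (M0 + d <= M)%N -> covered M0 S ->
  covered M (steps d S).
Proof.
move=> d0 le [L SL].
exists [seq (fam_step M0 d b (fam_lift M FG.1), fam_step M0 d b (fam_lift M FG.2)) | FG <- L,
  b <- [:: true; false]].
move=> f g [o [P [f1 [g1 [Pd /SL[FG FGL [t [-> ->]]] -> ->]]]]].
pose t' i := if (i < M0)%N then t i else if (i - M0 < d.-1)%N then P`_(i - M0) else odflt 0 o.
have M0M : (M0 <= M)%N by apply: leq_trans le; apply: leq_addr.
have tE (p : fam M0) : spec t' p = spec t p by apply: eq_in_spec => i iM; rewrite /t' iM.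
have PE : spec t' (\sum_(j < d.-1) (var M (M0 + j))%:MP * 'X_0 ^+ j) = polX P.
  rewrite rmorph_sum /=.
  have -> : P = \sum_(j < d.-1) (P`_j)%:P * 'X^j.
    transitivity (\sum_(j < d.-1) P`_j *: 'X^j); last by apply: eq_bigr => j _; rewrite mul_polyC.
    by rewrite -poly_def; apply/polyP => i; rewrite coef_poly;
      case: ltnP => // /(leq_trans Pd)/(nth_default 0).
  rewrite rmorph_sum; apply: eq_bigr => j _.
  rewrite !rmorphM !rmorphXn /= spec_X polXX polXC spec_var; last first.
    by rewrite (leq_trans _ le) // ltn_add2l (leq_trans (ltn_ord j)) // leq_pred.
  by rewrite /t' ltnNge leq_addr /= addKn ltn_ord.
have shearE : spec t' ('X_1 + 'X_0 ^+ 2 * \sum_(j < d.-1) (var M (M0 + j))%:MP * 'X_0 ^+ j) =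
    'X_1 + polX ('X^2 * P).
  rewrite rmorphD rmorphM rmorphXn /= PE !spec_X; congr (_ + _).
  by rewrite rmorphM rmorphXn /= polXX.
pose sw := o == None.
have lin1 : @spec M t' (if sw then 'X_1 else 'X_0 + (var M (M0 + d.-1))%:MP * 'X_1) = (lin o).1.
  rewrite /sw; case: o @t' {tE PE shearE sw} => [s|] t' /=; last exact: spec_X.
  rewrite rmorphD rmorphM /= !spec_X spec_var; last first.
    by rewrite (leq_trans _ le) // ltn_add2l prednK.
  by rewrite /t' ltnNge leq_addr /= addKn ltnn.
have lin2 : @spec M t' (if sw then 'X_0 else 'X_1) = (lin o).2.
  by rewrite /sw; case: (o) => [s|] /=; exact: spec_X.
have stepE (p : fam M0) : spec t' (fam_step M0 d sw (fam_lift M p)) = step o P (spec t p).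
  apply: etrans (spec_fsubst _ _ _ _) _; rewrite lin1 lin2 -[RHS]/(subst _ _ _);
    congr (subst _ _ _).
  apply: etrans (spec_fsubst _ _ _ _) _; rewrite shearE spec_X (spec_fam_lift _ _ M0M) tE.
  exact: erefl.
exists (fam_step M0 d sw (fam_lift M FG.1), fam_step M0 d sw (fam_lift M FG.2)).
  apply/allpairsP; exists (FG, sw); split; [exact: FGL|by case: (sw)|exact: erefl].
by exists t'; split; apply/esym/stepE.
Qed.

End Families.

Section Covering.
Local Open Scope ring_scope.
Variable K : closedFieldType.
Local Notation A := {mpoly K[2]}.
Local Notation fam M := {mpoly {mpoly K[M]}[2]}.

Definition autdeg n (f g : A) := aut2 f g /\ maxn (msize f) (msize g) = n.+1.

Lemma affine_expand (f : A) : (msize f <= 2)%N ->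
  f = (f@_(mk2 0 0))%:MP + (f@_(mk2 1 0))%:MP * 'X_0 + (f@_(mk2 0 1))%:MP * 'X_1.
Proof.
move=> /msize_leP f1; apply/mpolyP => m.
rewrite !mcoeffD !mul_mpolyC !mcoeffZ mcoeffC !mcoeffX.
have eqm i j : (mk2 i j == m) = (m 0 == i) && (m 1 == j) by rewrite eq_sym eq_mk2.
have U0 : U_(0%R)%MM = mk2 1 0 by apply/eqP; rewrite eq_mk2 !mnm1E.
have U1 : U_(1%R)%MM = mk2 0 1 by apply/eqP; rewrite eq_mk2 !mnm1E.
have Z : 0%MM = mk2 0 0 :> 'X_{1..2} by apply/eqP; rewrite eq_mk2 !mnm0E.
rewrite U0 U1 Z [m == _]eq_sym.
have [mf|mf] := boolP (m \in msupp f); last first.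
  rewrite (memN_msupp_eq0 mf).
  have z i j : f@_(mk2 i j) * (mk2 i j == m)%:R = 0.
    by case: eqP => [->|]; rewrite ?mulr0 // (memN_msupp_eq0 mf) mul0r.
  by rewrite !z !addr0.
have := f1 m mf; rewrite -{3}(mk2_eta m) !eqm; move: (m 0) (m 1) => i j ij.
have : (i, j) \in [:: (0, 0); (1, 0); (0, 1)]%N by move: ij; case: i j => [|[|i]] [|[|j]].
by rewrite !inE => /or3P[] /eqP[-> ->]; rewrite /= ?mulr1 ?mulr0 ?addr0 ?add0r.
Qed.

Definition affine_fam i : fam 6 :=
  (var K 6 i)%:MP + (var K 6 i.+1)%:MP * 'X_0 + (var K 6 i.+2)%:MP * 'X_1.

Lemma covered_affine : covered 6 (autdeg 1).
Proof.
exists [:: (affine_fam 0, affine_fam 3)] => f g [_ fg].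
have f2 : (msize f <= 2)%N by exact: leq_trans (leq_maxl _ _) (eq_leq fg).
have g2 : (msize g <= 2)%N by exact: leq_trans (leq_maxr _ _) (eq_leq fg).
exists (affine_fam 0, affine_fam 3); first exact: mem_head.
pose c (h : A) := [:: h@_(mk2 0 0); h@_(mk2 1 0); h@_(mk2 0 1)].
exists (nth 0 (c f ++ c g)); rewrite /affine_fam; split.
  by rewrite /= {1}(affine_expand f2) !rmorphD !rmorphM /= !spec_var // !spec_X.
by rewrite /= {1}(affine_expand g2) !rmorphD !rmorphM /= !spec_var // !spec_X.
Qed.

Lemma autdeg_steps n f g : autdeg n f g -> (1 < n)%N -> exists d k,
  [/\ n = (d * k)%N, (1 < d)%N, (0 < k)%N & steps d (autdeg k) f g].
Proof.
move=> [fg fgn] n1; case: (leqP (msize g) (msize f)) fgn => [gf fn|fg_lt gn].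
  have [o [P [d [k [f1 [g1 [[nE d2 k0 Pd] [fg1 fgk fE gE]]]]]]]] := jung_step fg fn (leq_trans gf
    (eq_leq fn)) n1.
  by exists d, k; split=> //; exists o, P, f1, g1.
have [o [P [d [k [f1 [g1 [[nE d2 k0 Pd] [fg1 fgk fE gE]]]]]]]] :=
  jung_step (aut2_swap fg) gn (leq_trans (ltnW fg_lt) (eq_leq gn)) n1.
exists d, k; split=> //; exists o, P, g1, f1; split=> //; split; first exact: aut2_swap.
by rewrite maxnC.
Qed.

Lemma covered_autdeg n : (1 < n)%N -> covered (n + 6) (autdeg n).
Proof.
elim/ltn_ind: n => n IHn n1.
pose ok := [pred dk : nat * nat | [&& n == dk.1 * dk.2, 1 < dk.1 & 0 < dk.2]%N].
pose r := [seq dk <- [seq (d, k) | d <- iota 0 n.+1, k <- iota 0 n.+1] | ok dk].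
have [L SL] : covered (n + 6) (fun f g => exists2 dk, dk \in r & steps dk.1 (autdeg dk.2) f g).
  apply: covered_seq => -[d k]; rewrite mem_filter /= => /andP[/and3P[/eqP nE d1 k0] _].
  have kn : (k < n)%N by rewrite nE -{1}[k]mul1n ltn_pmul2r.
  have [k1|k1] := leqP k 1.
    have {}k1 : k = 1%N by apply/eqP; rewrite eqn_leq k1.
    rewrite k1; apply: covered_steps covered_affine; first exact: ltnW.
    by rewrite nE k1 muln1 addnC.
  apply: covered_steps (IHn k kn k1); first exact: ltnW.
  rewrite addnAC leq_add2r nE; move: d1 k1; clear.
  by case: d k => [|[|d]] [|[|k]] // _ _; rewrite mulSn leq_add2l mulnS; lia.
exists L => f g fg; apply: SL; have [d [k [nE d1 k0 S]]] := autdeg_steps fg n1.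
exists (d, k) => //; rewrite mem_filter; apply/andP; split; first by rewrite /= nE eqxx d1 k0.
apply/allpairsP; exists (d, k); rewrite nE !mem_iota !ltnS /=; split=> //.
  by rewrite leq_pmulr.
by rewrite leq_pmull // ltnW.
Qed.

End Covering.

Section Automorphisms.
Local Open Scope ring_scope.
Variable K : closedFieldType.
Local Notation A := {mpoly K[2]}.
Local Notation fam M := {mpoly {mpoly K[M]}[2]}.
Variables (n : nat) (u : (num_coefs n)./2.-tuple 'X_{1..2}).
Hypothesis hu : enumerates_monomials u.
Local Notation h := (num_coefs n)./2.
Local Notation N := (num_coefs n).
Implicit Types (f g X Y : A) (x : nat -> K).

Definition coefs (R : nzRingType) (F G : {mpoly R[2]}) : seq R :=
  [seq F@_m | m <- u] ++ [seq G@_m | m <- u].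

Definition pvec f g : affine_space K N := \row_(i < N) (coefs f g)`_i.

Lemma num_coefs_half : (h + h = N)%N.
Proof. by rewrite addnn even_halfK // /num_coefs oddM /= negbK andbC andbN. Qed.

Definition vpoly k x : A := \sum_(j < h) x (k + j)%N *: 'X_[tnth u j].

Lemma mcoeff_vpoly k x m : (vpoly k x)@_m = if m \in u then x (k + index m u)%N else 0.
Proof.
rewrite /vpoly raddf_sum /=; case: ifP => mu.
  have mh : (index m u < h)%N by rewrite -{2}(size_tuple u) index_mem.
  rewrite (bigD1 (Ordinal mh)) //= mcoeffZ mcoeffX (tnth_nth m) /= nth_index // eqxx mulr1.
  rewrite big1 ?addr0 // => j jm; rewrite mcoeffZ mcoeffX; case: eqP => [E|]; last by rewrite mulr0.
  case/eqP: jm; apply/val_inj => /=; rewrite -E (tnth_nth m) index_uniq ?size_tuple //.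
  by case: hu.
rewrite big1 // => j _; rewrite mcoeffZ mcoeffX; case: eqP => [E|]; last by rewrite mulr0.
by rewrite -E mem_tnth in mu.
Qed.

Lemma msize_vpoly k x : (msize (vpoly k x) <= n.+1)%N.
Proof.
apply: (leq_trans (msize_sum _ _ _)); apply/bigmax_leqP => j _.
by rewrite (leq_trans (msizeZ_le _ _)) // msizeX ltnS -(proj2 hu) mem_tnth.
Qed.

Lemma vpolyE k x f : (msize f <= n.+1)%N ->
  (forall j, (j < h)%N -> x (k + j)%N = f@_(nth 0%MM u j)) -> vpoly k x = f.
Proof.
move=> fn xf; apply/mpolyP => m; rewrite mcoeff_vpoly; case: ifP => mu.
  by rewrite xf ?nth_index // -{2}(size_tuple u) index_mem.
apply/esym/memN_msupp_eq0/msize_mdeg_ge; apply: leq_trans fn _.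
by rewrite ltnNge -(proj2 hu) mu.
Qed.

Lemma coefsE (R : nzRingType) (F G : {mpoly R[2]}) i : (i < N)%N ->
  (coefs F G)`_i = if (i < h)%N then F@_(nth 0%MM u i) else G@_(nth 0%MM u (i - h)).
Proof.
move=> iN; rewrite nth_cat size_map size_tuple; case: ltnP => ih.
  by rewrite (nth_map 0%MM) // size_tuple.
by rewrite (nth_map 0%MM) // size_tuple ltn_subLR // num_coefs_half.
Qed.

Definition gpoly M k : fam M := \sum_(j < h) (var K M (k + j)%N)%:MP * 'X_[tnth u j].

Lemma spec_gpoly M k x : (k + h <= M)%N -> spec x (gpoly M k) = vpoly k x.
Proof.
move=> kM; rewrite rmorph_sum; apply: eq_bigr => j _.
rewrite rmorphM /= spec_var ?mul_mpolyC; last by apply: leq_trans kM; rewrite ltn_add2l.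
by congr (_ *: _); rewrite /spec map_mpolyX.
Qed.

Lemma spec_eq0 M x (p : fam M) :
  spec x p = 0 <-> {in [seq p@_m | m <- msupp p], forall c, c.@[fun i => x i] = 0}.
Proof.
split=> [p0 c /mapP[m _ ->]|p0].
  by have := mcoeff_map_mpoly (meval (fun j : 'I_M => x j)) m p; rewrite -/(spec x p) p0 mcoeff0.
apply/mpolyP => m; rewrite mcoeff_map_mpoly mcoeff0 /=.
have [mp|mp] := boolP (m \in msupp p); first by apply: p0; apply: map_f.
by rewrite (memN_msupp_eq0 mp) meval0.
Qed.

Lemma spec_system M x (eqs : seq (fam M)) :
  {in flatten [seq [seq p@_m | m <- msupp p] | p <- eqs], forall c, c.@[fun i => x i] = 0} <->
  {in eqs, forall p, spec x p = 0}.
Proof.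
split=> [Ex p pe|eqs0 c /flattenP[_ /mapP[p pe ->] cp]].
  apply/spec_eq0 => c cp; apply: Ex; apply/flattenP.
  by exists [seq p@_m | m <- msupp p] => //; exact: (map_f (fun p : fam M =>
    [seq p@_m | m <- msupp p])).
by have /spec_eq0 := eqs0 p pe; apply.
Qed.

Lemma in_seq4 (T : eqType) (P : T -> Prop) a b c d :
  {in [:: a; b; c; d], forall e, P e} <-> [/\ P a, P b, P c & P d].
Proof.
split=> [H|[Pa Pb Pc Pd] e]; first by split; apply: H; rewrite !seq.inE eqxx ?orbT.
by rewrite !seq.inE => /or4P[] /eqP->.
Qed.

Lemma constructible_inverse_pairs : constructible [set v : affine_space K N |
  exists f g X Y, [/\ inv2 f g X Y, (msize f <= n.+1)%N && (msize g <= n.+1)%N,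
    (msize X <= n.+1)%N && (msize Y <= n.+1)%N & v = pvec f g]].
Proof.
pose L := (N + N)%N.
pose G k : fam L := gpoly L (k * h).
pose eqs := [:: fsubst (G 0%N) (G 1%N) (G 2) - 'X_0; fsubst (G 0%N) (G 1%N) (G 3) - 'X_1;
                fsubst (G 2) (G 3) (G 0%N) - 'X_0; fsubst (G 2) (G 3) (G 1%N) - 'X_1].
pose E := flatten [seq [seq p@_m | m <- msupp p] | p : fam L <- eqs].
have Nh := num_coefs_half.
have EP x : {in E, forall c, c.@[fun i => x i] = 0} <->
    inv2 (vpoly (0 * h) x) (vpoly (1 * h) x) (vpoly (2 * h) x) (vpoly (3 * h) x).
  have GE k : (k < 4)%N -> spec x (G k) = vpoly (k * h) x.
    by move=> k4; apply: spec_gpoly; rewrite /L; move: k4 Nh; clear; case: k => [|[|[|[|]]]] //;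
      lia.
  have eqE a b c i : (a < 4)%N -> (b < 4)%N -> (c < 4)%N ->
      spec x (fsubst (G a) (G b) (G c) - 'X_i) =
      subst (vpoly (a * h) x) (vpoly (b * h) x) (vpoly (c * h) x) - 'X_i.
    move=> a4 b4 c4; have specB (p q : fam L) : spec x (p - q) = spec x p - spec x q by exact:
      rmorphB.
    apply: etrans (specB _ _) _; congr (_ - _); last exact: spec_X.
    by apply: etrans (spec_fsubst _ _ _ _) _; rewrite !GE.
  have eqP0 a b c i : (a < 4)%N -> (b < 4)%N -> (c < 4)%N ->
      spec x (fsubst (G a) (G b) (G c) - 'X_i) = 0 <->
      subst (vpoly (a * h) x) (vpoly (b * h) x) (vpoly (c * h) x) = 'X_i.
    move=> a4 b4 c4; rewrite eqE //; move: (subst _ _ _) => y.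
    by split=> [/subr0_eq|->]; rewrite ?subrr.
  apply: iff_trans (spec_system _ _) _; apply: iff_trans (in_seq4 _ _ _ _ _) _.
  have e1 := eqP0 0%N 1%N 2 0 isT isT isT; have e2 := eqP0 0%N 1%N 3 1 isT isT isT.
  have e3 := eqP0 2 3 0%N 0 isT isT isT; have e4 := eqP0 2 3 1%N 1 isT isT isT.
  by split=> -[H1 H2 H3 H4]; (split; [exact/e1|exact/e2|exact/e3|exact/e4]).
have := constructible_projection N E; congr (constructible _); apply/seteqP; split=> v /=.
  move=> [x [xv /EP XY]]; exists (vpoly (0 * h) x), (vpoly (1 * h) x), (vpoly (2 * h) x),
    (vpoly (3 * h) x).
  split; rewrite ?msize_vpoly //; apply/rowP => i; rewrite mxE -xv coefsE //.
  have uu j : (j < h)%N -> nth 0%MM u j \in u by move=> jh; rewrite mem_nth // size_tuple.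
  have idx j : (j < h)%N -> index (nth 0%MM u j) u = j.
    by move=> jh; rewrite index_uniq ?size_tuple //; case: hu.
  case: ltnP => ih; rewrite mcoeff_vpoly; first by rewrite uu // idx // mul0n.
  have ih' : (i - h < h)%N by rewrite ltn_subLR // Nh.
  by rewrite uu // idx // mul1n subnKC.
move=> [f [g [X [Y [XY /andP[fn gn] /andP[Xn Yn] ->]]]]].
pose x := nth 0 (coefs f g ++ coefs X Y).
have szc F G' : size (coefs F G' : seq K) = N by rewrite size_cat !size_map size_tuple Nh.
have ltN j : (j < h)%N -> (j < N)%N by move=> jh; rewrite -[ltnRHS]Nh ltn_addr.
have ltN' j : (j < h)%N -> (h + j < N)%N by move=> jh; rewrite -[ltnRHS]Nh ltn_add2l.
have xE F G' : forall j, (j < h)%N -> (coefs F G')`_j = F@_(nth 0%MM u j) :> K.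
  by move=> j jh; rewrite coefsE ?jh // ltN.
have xE' F G' : forall j, (j < h)%N -> (coefs F G')`_(h + j) = G'@_(nth 0%MM u j) :> K.
  by move=> j jh; rewrite coefsE ?ltN' // ltnNge leq_addr /= addKn.
exists x; split.
  by move=> i; rewrite mxE /x nth_cat szc ltn_ord.
apply/EP.
have -> : vpoly (0 * h) x = f.
  by apply: vpolyE => // j jh; rewrite mul0n /x nth_cat szc ltN // xE.
have -> : vpoly (1 * h) x = g.
  by apply: vpolyE => // j jh; rewrite mul1n /x nth_cat szc ltN' // xE'.
have -> : vpoly (2 * h) x = X.
  by apply: vpolyE => // j jh; rewrite (_ : 2 * h + j = N +
    j)%N ?mul2n -?addnn ?Nh // /x nth_cat szc ltnNge leq_addr /= addKn xE.
have -> // : vpoly (3 * h) x = Y.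
apply: vpolyE => // j jh; rewrite (_ : 3 * h + j = N + (h + j))%N; last by rewrite -Nh; lia.
by rewrite /x nth_cat szc ltnNge leq_addr /= addKn xE'.
Qed.

Definition degree_locus : set (affine_space K N) :=
  [set v | exists2 i : 'I_N, mdeg (nth 0%MM (u ++ u) i) = n & v 0 i != 0].

Lemma open_degree_locus : open degree_locus.
Proof.
rewrite -[degree_locus]setCK openC; apply/zariski_closedE.
exists [set p | exists2 i : 'I_N, mdeg (nth 0%MM (u ++ u) i) = n & p = 'X_i].
apply/seteqP; split=> v /= H.
  move=> p [i iu ->]; rewrite mevalXU; apply/eqP; apply: contra_notT H => vi.
  by exists i.
by move=> [i iu]; rewrite -(mevalXU (v 0) i) H ?eqxx //; exists i.
Qed.

Lemma degree_locusP f g : (0 < n)%N -> (msize f <= n.+1)%N -> (msize g <= n.+1)%N ->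
  degree_locus (pvec f g) <-> maxn (msize f) (msize g) = n.+1.
Proof.
move=> n0 fn gn; have Nh := num_coefs_half.
have uE m : mdeg m = n -> nth 0%MM u (index m u) = m /\ (index m u < h)%N.
  move=> mn; have mu : m \in u by rewrite (proj2 hu) mn.
  by rewrite nth_index // -[X in (_ < X)%N](size_tuple u) index_mem.
split.
  move=> [i iu]; rewrite mxE coefsE //; move: iu; rewrite nth_cat size_tuple => iu vi.
  apply/eqP; rewrite eqn_leq geq_max fn gn leq_max; apply/orP.
  move: iu vi; case: ifP => ih iu vi; [left|right].
    by rewrite -[n in (n < _)%N]iu msize_mdeg_lt // mcoeff_msupp.
  by rewrite -[n in (n < _)%N]iu msize_mdeg_lt // mcoeff_msupp.
move=> fgn; apply: contraPP (isT) => nD _.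
have small (F : A) : (msize F <= n.+1)%N -> (forall m, mdeg m = n -> F@_m = 0) -> (msize F <= n)%N.
  move=> Fn F0; rewrite -[n]prednK //; rewrite msizeE; apply/bigmax_leqP_seq => m mF _.
  rewrite prednK // ltn_neqAle -ltnS (leq_trans (msize_mdeg_lt mF) Fn) andbT.
  by apply: contraTneq mF => /F0 m0; rewrite mcoeff_msupp m0 eqxx.
have : (maxn (msize f) (msize g) <= n)%N.
  rewrite geq_max !small // => m mn; have [mE mh] := uE m mn; apply/eqP;
    apply: contra_notT nD => fm.
    have iN : (h + index m u < N)%N by rewrite -[ltnRHS]Nh ltn_add2l.
    exists (Ordinal iN); rewrite ?mxE ?coefsE //= ?nth_cat ?size_tuple ltnNge leq_addr /= addKn
      mE //.
  have iN : (index m u < N)%N by rewrite -[ltnRHS]Nh ltn_addr.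
  by exists (Ordinal iN); rewrite ?mxE ?coefsE //= ?nth_cat ?size_tuple mh mE.
by rewrite fgn ltnn.
Qed.

Lemma constructible_autdeg : (0 < n)%N ->
  constructible [set v | exists f g, autdeg n f g /\ v = pvec f g].
Proof.
move=> n0; have := constructibleI_open open_degree_locus constructible_inverse_pairs.
congr (constructible _); apply/seteqP; split=> v /=.
  move=> [[f [g [X [Y [XY /andP[fn gn] _ ->]]]]] /(degree_locusP n0 fn gn) fgn].
  by exists f, g; split=> //; split=> //; exists X, Y.
move=> [f [g [[fg fgn] ->]]]; have [X [Y [XY XYn]]] := inverse_degree fg fgn n0.
have /andP[fn gn] : (msize f <= n.+1)%N && (msize g <= n.+1)%N by rewrite -geq_max fgn.
by split; [exists f, g, X, Y; rewrite fn gn|apply/degree_locusP].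
Qed.

Lemma coef_vector_automorphisms : (0 < n)%N ->
  coef_vector u @` automorphisms K n = [set v | exists f g, autdeg n f g /\ v = pvec f g].
Proof.
move=> n0; apply/seteqP; split=> v /=.
  move=> [phi [[psi phiK psiK] phin] <-]; exists (phi 'X_0), (phi 'X_1); split; last exact: erefl.
  have phiE p : phi p = subst (phi 'X_0) (phi 'X_1) p.
    have phiC c : phi c%:MP = c%:MP by rewrite -[c%:MP]mulr1 mul_mpolyC linearZ rmorph1.
    apply: (eq_mpoly_rmorph (F := phi)) => [c|i];
      first exact: etrans (phiC c) (esym (substMP _ _ c)).
    by case: (ord2E i) => ->; [exact: esym (substX0 _ _)|exact: esym (substX1 _ _)].
  have psiE p : subst (psi 'X_0) (psi 'X_1) p = psi p.
    apply: (can_inj phiK); rewrite psiK phiE subst_comp -!phiE !psiK; exact: subst_id.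
  split; first by exists (psi 'X_0), (psi 'X_1); split; rewrite -?phiE ?psiK // psiE phiK.
  move: phin; rewrite /endo_degree; move: (phi 'X_0) (phi 'X_1) => f g; move: n0; clear.
  by move: (mmeasure _ f) (mmeasure _ g) => a b; lia.
move=> [f [g [[[X [Y [XE YE fE gE]]] fgn] ->]]].
exists (subst f g); last by apply/rowP => i; rewrite !mxE /= substX0 substX1.
split.
  by exists (subst X Y) => p; apply: etrans (subst_comp _ _ _ _ p) _;
    rewrite ?fE ?gE ?XE ?YE subst_id.
rewrite /endo_degree /= substX0 substX1; move: fgn; clear.
by move: (mmeasure _ f) (mmeasure _ g) => a b; lia.
Qed.

Lemma chain_autdeg_le m : (1 < n)%N ->
  irreducible_chain (closure [set v | exists f g, autdeg n f g /\ v = pvec f g]) m ->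
    (m <= n + 6)%N.
Proof.
move=> n1; have [L SL] := covered_autdeg K n1.
apply: (irreducible_chain_cover (L := L) (Phi := fun FG i => (coefs FG.1 FG.2)`_i)).
move=> _ [f [g [/SL[FG FGL [t [-> ->]]] ->]]]; exists FG => //; exists t.
apply/rowP => i; rewrite !mxE !coefsE //.
by case: ifP => _; rewrite /spec mcoeff_map_mpoly.
Qed.

End Automorphisms.

Section LowerBound.
Local Open Scope ring_scope.
Variable K : closedFieldType.
Local Notation A := {mpoly K[2]}.
Local Notation fam M := {mpoly {mpoly K[M]}[2]}.

Lemma range_polymap_closure M N (Phi : 'I_N -> {mpoly K[M]}) (w : {mpoly K[M]}) (S : set
  (affine_space K N)) :
  w != 0 -> (forall t : nat -> K, w.@[fun j => t j] != 0 -> S (polymap Phi t)) ->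
  range (polymap Phi) `<=` closure S.
Proof.
move=> w0 wS _ [t _ <-]; apply: contrapT => /(closed_separate (@closed_closure _ S))[p pS].
rewrite meval_polymap; suff -> : pullback Phi p = 0 by rewrite meval0 eqxx.
apply/eqP; apply: contraT => p0.
have [s] : exists s : nat -> K, (pullback Phi p * w).@[fun j => s j] != 0.
  by apply: mpoly_nonvanishing; rewrite mulf_neq0.
rewrite mevalM mulf_eq0 negb_or => /andP[ps /wS Ss].
by move: ps; rewrite -meval_polymap pS ?eqxx //; apply: subset_closure.
Qed.

Lemma irreducible_chain_subset (T : topologicalType) (X Y : set T) d :
  X `<=` Y -> irreducible_chain X d -> irreducible_chain Y d.
Proof.
move=> XY [Z [Zc ZS]]; exists Z; split=> // i /Zc[cZ iZ ZX]; split=> //.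
exact: subset_trans XY.
Qed.

Lemma aut2_scale (b : K) : b != 0 -> aut2 ('X_0 : A) (b%:MP * 'X_1).
Proof.
move=> b0; exists 'X_0, (b^-1%:MP * 'X_1); split; rewrite ?substX0 //.
  by rewrite rmorphM /= substMP substX1 mulrA -rmorphM mulVf // mul1r.
by rewrite rmorphM /= substMP substX1 mulrA -rmorphM mulfV // mul1r.
Qed.

Lemma aut2_triangular (b : K) P : b != 0 -> aut2 ('X_0 : A) (b%:MP * 'X_1 + polX P).
Proof.
move=> b0; have := aut2_comp (aut2_shear_pair P) (aut2_scale b0).
by rewrite substX0 rmorphD /= substX1 subst_polX.
Qed.

(* [chain_f = b y + q(l)] and [chain_g = c chain_f + d l + e], where [l = x + s y] and
   [t 0, .., t n] are the coefficients of [q]. *)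
Section Family.
Variables (n : nat) (t : nat -> K).
Hypothesis n1 : (1 < n)%N.
Local Notation c := (t n.+1).
Local Notation d := (t n.+2).
Local Notation e := (t n.+3).
Local Notation s := (t n.+4).
Local Notation b := (t n.+4.+1).

Definition chain_line : A := 'X_0 + s%:MP * 'X_1.
Definition chain_f : A := b%:MP * 'X_1 + \sum_(k < n.+1) (t k)%:MP * chain_line ^+ k.
Definition chain_g : A := c%:MP * chain_f + d%:MP * chain_line + e%:MP.
Let Q : {poly K} := \poly_(k < n.+1) t k.

Lemma chain_fE : chain_f = lsubst (Some s) (b%:MP * 'X_1 + polX Q).
Proof.
rewrite /lsubst rmorphD rmorphM /= substX1 substMP; congr (_ + _).
rewrite /Q poly_def !rmorph_sum; apply: eq_bigr => k _.
by rewrite -mul_polyC !rmorphM !rmorphXn /= polXC polXX substX0 substMP.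
Qed.

Lemma aut2_chain : b != 0 -> d != 0 -> aut2 chain_f chain_g.
Proof.
move=> b0 d0; have FX := aut2_swap (aut2_triangular Q b0).
have := aut2_lsubst (Some s) (aut2_comp (aut2_triangular (c%:P * 'X + e%:P) d0) FX).
have E1 : polX (c%:P * 'X + e%:P) = c%:MP * 'X_0 + e%:MP :> A.
  by rewrite rmorphD rmorphM /= !polXC polXX.
have E2 (a : A) : subst a 'X_0 (d%:MP * 'X_1 + (c%:MP * 'X_0 + e%:MP)) = d%:MP * 'X_0 +
  (c%:MP * a + e%:MP).
  by rewrite rmorphD rmorphM rmorphD rmorphM /= !substMP substX0 substX1.
have E3 (a : A) : lsubst (Some s) (d%:MP * 'X_0 + (c%:MP * a + e%:MP)) = d%:MP * chain_line +
  (c%:MP * lsubst (Some s) a + e%:MP).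
  by rewrite /lsubst rmorphD rmorphM rmorphD rmorphM /= !substMP substX0.
rewrite substX0 E1 E2 E3 -chain_fE; congr (aut2 _ _).
by rewrite /chain_g addrA [_ + c%:MP * _]addrC.
Qed.

Lemma uev_chain_f : uev 'X 0 chain_f = Q.
Proof.
rewrite /chain_f rmorphD rmorphM rmorph_sum /= uevX1 mulr0 add0r /Q poly_def.
apply: eq_bigr => k _; rewrite rmorphM rmorphXn rmorphD rmorphM /= uevX0 uevX1 mulr0 addr0.
by rewrite uevMP mul_polyC.
Qed.

Lemma mcoeff_chain_f k : chain_f@_(mk2 k 0) = if (k < n.+1)%N then t k else 0.
Proof. by rewrite -coef_uev_X0 uev_chain_f coef_poly. Qed.

Lemma mcoeff_chain_f01 : chain_f@_(mk2 0 1) = b + t 1%N * s.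
Proof.
rewrite -coef_uev_0X /chain_f rmorphD rmorphM rmorph_sum /= uevX1 uevMP.
rewrite coefD coefCM coefX mulr1; congr (_ + _).
rewrite coef_sum (bigD1 (Ordinal (ltnW n1 : 1 < n.+1)%N)) //= big1 ?addr0.
  rewrite rmorphM rmorphXn rmorphD rmorphM /= uevX0 uevX1 !uevMP add0r expr1 !coefCM coefX.
  by rewrite mulr1.
move=> k k1; rewrite rmorphM rmorphXn rmorphD rmorphM /= uevX0 uevX1 !uevMP add0r.
rewrite exprMn -rmorphXn /= !coefCM coefXn; case: eqP => [E|]; last by rewrite !mulr0.
by case/eqP: k1; apply/val_inj; exact: esym E.
Qed.

Lemma mcoeff_chain_g m : chain_g@_m = c * chain_f@_m + d * ((m == mk2 1 0)%:R +
  s * (m == mk2 0 1)%:R) + e * (m == mk2 0 0)%:R.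
Proof.
have U0 : U_(0%R)%MM = mk2 1 0 by apply/eqP; rewrite eq_mk2 !mnm1E.
have U1 : U_(1%R)%MM = mk2 0 1 by apply/eqP; rewrite eq_mk2 !mnm1E.
have Z : 0%MM = mk2 0 0 :> 'X_{1..2} by apply/eqP; rewrite eq_mk2 !mnm0E.
rewrite /chain_g /chain_line; move: chain_f => F.
by rewrite !mcoeffD !mul_mpolyC !mcoeffZ !mcoeffD mcoeffC !mcoeffZ !mcoeffX U0 U1 Z ![_ == m]eq_sym.
Qed.

Lemma autdeg_chain : t n != 0 -> b != 0 -> d != 0 -> autdeg n chain_f chain_g.
Proof.
move=> tn b0 d0; split; first exact: aut2_chain.
have Fn : (msize chain_f <= n.+1)%N.
  rewrite chain_fE msize_lsubst (leq_trans (msizeD_le _ _)) // geq_max.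
  rewrite (leq_trans (msize_polX _)) ?size_poly // andbT mul_mpolyC (leq_trans (msizeZ_le _ _)) //.
  by rewrite msizeX mdeg1 ltnS ltnW.
have Gn : (msize chain_g <= n.+1)%N.
  apply/msize_leP => m; rewrite mcoeff_msupp mcoeff_chain_g leqNgt; apply: contra => mn.
  have small i j : (i + j <= 1)%N -> (m == mk2 i j) = false.
    move=> ij; apply/eqP => mE; move: mn; rewrite mE mk2_0 mk2_1 ltnNge; case/negP.
    exact: leq_trans ij (ltnW n1).
  rewrite !small // mulr0 addr0 !mulr0 !addr0 (_ : chain_f@_m = 0) ?mulr0 //.
  apply/memN_msupp_eq0; apply: contraL mn => mf; rewrite -leqNgt.
  by have /msize_leP := Fn; apply.
apply/eqP; rewrite eqn_leq geq_max Fn Gn leq_max; apply/orP; left.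
have mn : mk2 n 0 \in msupp chain_f by rewrite mcoeff_msupp mcoeff_chain_f ltnSn.
rewrite ltnNge; apply: contra tn => Fn'.
have := Fn'; rewrite -[X in (_ <= X)%N](prednK (ltnW n1)) => /msize_leP/(_ _ mn).
by rewrite mk2_0 mk2_1 addn0 leqNgt prednK ?leqnn // ltnW.
Qed.

End Family.

Definition line_family n M : fam M := 'X_0 + (var K M n.+4)%:MP * 'X_1.
Definition f_family n M : fam M := (var K M n.+4.+1)%:MP * 'X_1 +
  \sum_(k < n.+1) (var K M k)%:MP * line_family n M ^+ k.
Definition g_family n M : fam M := (var K M n.+1)%:MP * f_family n M +
  (var K M n.+2)%:MP * line_family n M + (var K M n.+3)%:MP.

Lemma spec_line_family n M t : (n + 6 <= M)%N -> spec t (line_family n M) = chain_line n t.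
Proof.
move=> nM; rewrite /line_family rmorphD rmorphM /= !spec_X spec_var //.
by rewrite (leq_trans _ nM) // !addnS addn0 ltnS.
Qed.

Lemma spec_f_family n M t : (n + 6 <= M)%N -> spec t (f_family n M) = chain_f n t.
Proof.
move=> nM; rewrite /f_family rmorphD rmorphM rmorph_sum /= spec_X spec_var; last first.
  by rewrite (leq_trans _ nM) // !addnS addn0.
congr (_ + _); apply: eq_bigr => k _; rewrite rmorphM rmorphXn /= spec_line_family // spec_var //.
by apply: leq_trans nM; apply: leq_trans (ltn_ord k) _; rewrite !addnS addn0; lia.
Qed.

Lemma spec_g_family n M t : (n + 6 <= M)%N -> spec t (g_family n M) = chain_g n t.
Proof.
move=> nM; rewrite /g_family rmorphD rmorphD rmorphM rmorphM /= spec_line_family // spec_f_family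
  //.
by rewrite !spec_var //; apply: leq_trans nM; rewrite !addnS addn0; lia.
Qed.

End LowerBound.

Section LowerChain.
Local Open Scope ring_scope.
Variable K : closedFieldType.
Local Notation A := {mpoly K[2]}.
Local Notation fam M := {mpoly {mpoly K[M]}[2]}.
Variables (n : nat) (u : (num_coefs n)./2.-tuple 'X_{1..2}).
Hypotheses (hu : enumerates_monomials u) (n1 : (1 < n)%N).
Local Notation h := (num_coefs n)./2.
Local Notation N := (num_coefs n).

Definition generic_aut : 'I_N -> {mpoly K[n + 6]} :=
  fun i => (coefs u (f_family K n (n + 6)) (g_family K n (n + 6)))`_i.

Lemma polymap_generic_aut t : polymap generic_aut t = pvec u (chain_f n t) (chain_g n t).
Proof.
apply/rowP => i; rewrite !mxE /generic_aut !coefsE // -(spec_f_family t (leqnn _))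
  -(spec_g_family t (leqnn _)).
by case: ifP => _; rewrite /spec mcoeff_map_mpoly.
Qed.

Definition fco i j : {mpoly K[N]} := var K N (index (mk2 i j) u).
Definition gco i j : {mpoly K[N]} := var K N (h + index (mk2 i j) u).

Lemma mdeg_mk2 i j : mdeg (mk2 i j) = (i + j)%N.
Proof. by rewrite mdeg2 mk2_0 mk2_1. Qed.

Lemma meval_fco (f g : A) i j : (i + j <= n)%N -> (fco i j).@[pvec u f g 0] = f@_(mk2 i j).
Proof.
rewrite -mdeg_mk2 -(proj2 hu) => mu.
have ih : (index (mk2 i j) u < h)%N by rewrite -[ltnRHS](size_tuple u) index_mem.
have iN : (index (mk2 i j) u < N)%N by rewrite -[ltnRHS]num_coefs_half ltn_addr.
by rewrite /fco /var insubT mevalXU mxE coefsE //= ih nth_index.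
Qed.

Lemma meval_gco (f g : A) i j : (i + j <= n)%N -> (gco i j).@[pvec u f g 0] = g@_(mk2 i j).
Proof.
rewrite -mdeg_mk2 -(proj2 hu) => mu.
have ih : (index (mk2 i j) u < h)%N by rewrite -[ltnRHS](size_tuple u) index_mem.
have iN : (h + index (mk2 i j) u < N)%N by rewrite -[ltnRHS]num_coefs_half ltn_add2l.
by rewrite /gco /var insubT mevalXU mxE coefsE //= ltnNge leq_addr /= addKn nth_index.
Qed.

Definition minor i j := fco n 0 * gco i j - gco n 0 * fco i j.

Lemma meval_minor t i j : (i + j <= n)%N ->
  (minor i j).@[polymap generic_aut t 0] =
  t n * (t n.+2 * ((mk2 i j == mk2 1 0)%:R + t n.+4 * (mk2 i j == mk2 0 1)%:R) +
    t n.+3 * (mk2 i j == mk2 0 0)%:R).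
Proof.
move=> ijn; rewrite polymap_generic_aut mevalB !mevalM !meval_fco ?meval_gco ?addn0 //.
rewrite !mcoeff_chain_g mcoeff_chain_f ltnSn.
have -> : (mk2 n 0 == mk2 1 0) = false by rewrite eq_mk2 !mk2_0; apply/negbTE; move: n1; clear;
  case: n => [|[]].
have -> : (mk2 n 0 == mk2 0 1) = false by rewrite eq_mk2 !mk2_0; apply/negbTE; move: n1; clear;
  case: n => [|[]].
have -> : (mk2 n 0 == mk2 0 0) = false by rewrite eq_mk2 !mk2_0; apply/negbTE; move: n1; clear;
  case: n => [|[]].
rewrite /=; move: (mk2 i j == mk2 1 0) (mk2 i j == mk2 0 1) (mk2 i j == mk2 0 0) => b1 b2 b3.
by move: ((chain_f n t)@_(mk2 i j)) => x; ring.
Qed.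

Definition param_num i : {mpoly K[N]} := if (i < n.+1)%N then fco i 0 else
  nth 0 [:: gco n 0; minor 1 0; minor 0 0; minor 0 1;
    fco 0 1 * minor 1 0 - fco 1 0 * minor 0 1] (i - n.+1).

Definition param_den i : {mpoly K[N]} := if (i < n.+1)%N then 1 else
  nth 0 [:: fco n 0; fco n 0; fco n 0; minor 1 0; minor 1 0] (i - n.+1).

Lemma param_numE i t : (i < n + 6)%N -> (param_num i).@[polymap generic_aut t 0] = t i *
  (param_den i).@[polymap generic_aut t 0].
Proof.
have n0 : (0 < n)%N by apply: ltnW.
have fn : (fco n 0).@[polymap generic_aut t 0] = t n by rewrite polymap_generic_aut meval_fco
  ?addn0 // mcoeff_chain_f ltnSn.
have f1 : (fco 1 0).@[polymap generic_aut t 0] = t 1%N by rewrite polymap_generic_aut meval_fco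
  // mcoeff_chain_f ltnS n0.
have f01 : (fco 0 1).@[polymap generic_aut t 0] = t n.+4.+1 +
  t 1%N * t n.+4 by rewrite polymap_generic_aut meval_fco // mcoeff_chain_f01.
have gn : (gco n 0).@[polymap generic_aut t 0] = t n.+1 * t n.
  rewrite polymap_generic_aut meval_gco ?addn0 // mcoeff_chain_g mcoeff_chain_f ltnSn.
  have z i' j : (i' < n)%N -> (mk2 n 0 == mk2 i' j) = false.
    by move=> lt; rewrite eq_mk2 !mk2_0 gtn_eqF.
  by rewrite !z // !mulr0 !addr0 !mulr0 addr0.
have m10 : (minor 1 0).@[polymap generic_aut t 0] = t n * t n.+2.
  by rewrite meval_minor // !eq_mk2 !mk2_0 !mk2_1 /= !mulr0 !addr0 mulr1.
have m00 : (minor 0 0).@[polymap generic_aut t 0] = t n * t n.+3.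
  by rewrite meval_minor // !eq_mk2 !mk2_0 !mk2_1 /= !mulr0 !addr0 !mulr0 add0r mulr1.
have m01 : (minor 0 1).@[polymap generic_aut t 0] = t n * (t n.+2 * t n.+4).
  by rewrite meval_minor // !eq_mk2 !mk2_0 !mk2_1 /= !mulr0 addr0 add0r mulr1.
move=> iM; rewrite /param_num /param_den; case: ltnP => [iN|/subnK iN].
  by rewrite polymap_generic_aut meval_fco ?addn0 // mcoeff_chain_f iN meval1 mulr1.
move: iN iM; case: (i - n.+1)%N => [|[|[|[|[|j]]]]] <- iM; last (by lia); rewrite ?(addSn, add0n).
- by rewrite /= gn fn.
- by rewrite /= m10 fn mulrC.
- by rewrite /= m00 fn mulrC.
- by apply: etrans m01 _; rewrite /= m10 mulrA mulrC.
rewrite /=; apply: etrans (mevalB _ _ _) _.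
apply: etrans (f_equal2 (fun x y => x - y) (mevalM _ _ _) (mevalM _ _ _)) _.
apply: etrans (f_equal2 (fun x y => x - y) (f_equal2 *%R f01 m10) (f_equal2 *%R f1 m01)) _;
  rewrite m10.
by move: (t n) (t n.+2) (t n.+4) (t n.+4.+1) (t 1%N) => q d s b q1; ring.
Qed.

Lemma chain_autdeg_ge :
  irreducible_chain (closure [set v | exists f g : A, autdeg n f g /\ v = pvec u f g]) (n + 6).
Proof.
pose w : {mpoly K[n + 6]} := var K (n + 6) n * var K (n + 6) n.+2 * var K (n + 6) n.+4.+1.
have wE (t : nat -> K) : w.@[fun j => t j] = t n * t n.+2 * t n.+4.+1.
  by rewrite !mevalM !meval_var //; lia.
have w0 : w != 0.
  apply/eqP => w0; have := wE (fun=> 1); rewrite w0 meval0 !mulr1 => /eqP.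
  by rewrite eq_sym oner_eq0.
apply: (irreducible_chain_subset (X := closure (range (polymap generic_aut)))).
  apply: closure_min; first exact: closed_closure.
  apply: (range_polymap_closure w0) => t; rewrite wE !mulf_eq0 !negb_or => /andP[/andP[tn d0] b0].
  by exists (chain_f n t), (chain_g n t); split; [exact: autdeg_chain|exact: polymap_generic_aut].
pose c i : K := ((i == n) || (i == n.+2))%:R.
apply: (irreducible_chain_birational (c := c) (num := param_num) (den := param_den));
  first by move=> i t /(param_numE t).
move=> i iM; rewrite /param_den; case: ltnP => [_|/subnK iN]; first by rewrite meval1 oner_eq0.
set t := fun j => _.
have tn : (n < i)%N -> t n = 1 by move=> ni; rewrite /t ltn_eqF // /c eqxx.
have t2 : (n.+2 < i)%N -> t n.+2 = 1 by move=> ni; rewrite /t ltn_eqF // /c eqxx orbT.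
have fn : (n < i)%N -> (fco n 0).@[polymap generic_aut t 0] != 0.
  by move=> ni; rewrite polymap_generic_aut meval_fco ?addn0 // mcoeff_chain_f ltnSn tn // oner_eq0.
have m10 : (n.+2 < i)%N -> (minor 1 0).@[polymap generic_aut t 0] != 0.
  move=> ni; rewrite meval_minor ?(ltnW n1) // !eq_mk2 !mk2_0 !mk2_1 /= !mulr0 !addr0 mulr1.
  by rewrite tn ?t2 ?mulr1 ?oner_eq0 //; lia.
move: iN; case: (i - n.+1)%N => [|[|[|[|[|j]]]]] iN; last by lia.
- by apply: fn; lia.
- by apply: fn; lia.
- by apply: fn; lia.
- by apply: m10; lia.
- by apply: m10; lia.
Qed.

End LowerChain.

Theorem theorem1p2 (K : closedFieldType) (n : nat) (hn : (2 <= n)%N)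
  (u : (num_coefs n)./2.-tuple 'X_{1..2}) (hu : enumerates_monomials u) :
  constructible (coef_vector u @` automorphisms K n) /\
  has_dim (coef_vector u @` automorphisms K n) (n + 6)%N.
Proof.
rewrite coef_vector_automorphisms ?(ltnW hn) //; split; first exact: constructible_autdeg (ltnW hn).
by split; [exact: chain_autdeg_ge|move=> m; exact: chain_autdeg_le].
Qed.
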